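(* Let $\lambda_0>0$. There exists a constant $\theta_{\mathrm{gap}}=\theta_{\mathrm{gap}}(\lambda_0)>0$, depending only on $\lambda_0$, such that the following holds. Let $\lambda\in(0,\lambda_0]$ and let $\varepsilon>0$ be arbitrary. If $(\nabla,\Phi)$ is a smooth solution of $$\varepsilon^2 d_{\nabla}^{*}F_{\nabla}=[\nabla\Phi,\Phi],\qquad \nabla^{*}\nabla\Phi=\frac{\lambda}{2\varepsilon^2}(1-|\Phi|^2)\Phi$$ on an $SU(2)$-bundle $E\to\mathbb{R}^3$ over the Euclidean space $(\mathbb{R}^3,g_{\mathbb{R}^3})$, satisfying in addition $$\varepsilon^{-1}\mathcal{Y}_\varepsilon(\nabla,\Phi)\leqslant\theta_{\mathrm{gap}}\cdot\min\{\lambda,1\},$$ then in fact $\mathcal{Y}_\varepsilon(\nabla,\Phi)=0$.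
   Context: An $SU(2)$-bundle $E$ is the rank-$2$ complex vector bundle $P\times_{SU(2)}\mathbb{C}^2$ for a principal $SU(2)$-bundle $P\to\mathbb{R}^3$. Here $\nabla$ is a smooth $SU(2)$-compatible connection on $E$ with curvature $F_\nabla$, and $\Phi$ is a smooth section of $\mathfrak{su}(E)$, the bundle of traceless skew-Hermitian endomorphisms of $E$, with metric induced by $\langle a,b\rangle=-2\,\mathrm{tr}(ab)$. The Yang--Mills--Higgs energy is $$\mathcal{Y}_\varepsilon(\nabla,\Phi)=\int_{\mathbb{R}^3} \Big(\varepsilon^2|F_\nabla|^2+|\nabla\Phi|^2+\frac{\lambda}{4\varepsilon^2}(1-|\Phi|^2)^2\Big)\mathrm{vol}.$$ $d_\nabla^*$ is the formal adjoint of the exterior covariant derivative $d_\nabla$, and $\nabla^*\nabla$ is the nonnegative rough Laplacian. *)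

(* Defs.v *)
From mathcomp Require Import all_boot all_order all_algebra.
From mathcomp Require Import complex ring lra.
From mathcomp Require Import all_classical all_reals all_analysis.
Import Order.TTheory GRing.Theory Num.Theory.
Import numFieldNormedType.Exports.

Set Implicit Arguments.
Unset Strict Implicit.
Unset Printing Implicit Defensive.

Local Open Scope ring_scope.
Local Open Scope classical_set_scope.
Local Open Scope complex_scope.

Section Calculus.
Variable R : realType.
Implicit Types (U : set 'rV[R]_3) (f : 'rV[R]_3 -> R)
  (M : 'rV[R]_3 -> 'M[R[i]]_2).

Definition partial (k : 'I_3) f : 'rV[R]_3 -> R :=
  fun x => 'D_(delta_mx 0 k) f x.

Fixpoint Ck_on (n : nat) U f : Prop :=
  (forall x, U x -> {for x, continuous f}) /\
  if n is n'.+1 then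
    forall k : 'I_3, (forall x, U x -> derivable f x (delta_mx 0 k)) /\
                     Ck_on n' U (partial k f)
  else True.

(* Meaningful for open U only: the values of f off U are then irrelevant. *)
Definition smooth_on U f : Prop := forall n, Ck_on n U f.

Definition mx_smooth_on U M : Prop := forall a b : 'I_2,
  smooth_on U (fun x => complex.Re (M x a b)) /\
  smooth_on U (fun x => complex.Im (M x a b)).

Definition mx_partial (k : 'I_3) M : 'rV[R]_3 -> 'M[R[i]]_2 :=
  fun x => \matrix_(a, b)
    (partial k (fun y => complex.Re (M y a b)) x
     +i* partial k (fun y => complex.Im (M y a b)) x).

Definition point3 (p : R * R * R) : 'rV[R]_3 :=
  \row_(k < 3) [:: p.1.1; p.1.2; p.2]`_k.

Definition volume3 := ((@lebesgue_measure R \x @lebesgue_measure R)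
                        \x @lebesgue_measure R)%E.

End Calculus.
Arguments volume3 : clear implicits.

Section SU2.
Variable R : realType.
Implicit Types A B : 'M[R[i]]_2.

Definition conjT A : 'M[R[i]]_2 := \matrix_(a, b) (A b a)^*%C.

Definition is_SU2 A : Prop := conjT A *m A = 1%:M /\ \det A = 1.

Definition is_su2 A : Prop := conjT A = - A /\ \tr A = 0.

Definition commmx A B : 'M[R[i]]_2 := A *m B - B *m A.

(* On su(2) the trace of a product is real, so no information is lost. *)
Definition su2_dot A B : R := - 2 * complex.Re (\tr (A *m B)).

Definition su2_sqnorm A : R := su2_dot A A.

End SU2.

(* A principal SU(2)-bundle over R^3, presented by a trivialising open cover
   and its smooth transition functions.  A section of an associated bundle is
   a family of local representatives; for E these obey u_i = g_ij u_j. *)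
Record SU2_bundle (R : realType) := {
  chart : Type;
  dom : chart -> set 'rV[R]_3;
  dom_open : forall i, open (dom i);
  dom_cover : forall x, exists i, dom i x;
  trans : chart -> chart -> 'rV[R]_3 -> 'M[R[i]]_2;
  trans_SU2 : forall i j x, dom i x -> dom j x -> is_SU2 (trans i j x);
  trans_smooth : forall i j, mx_smooth_on (dom i `&` dom j) (trans i j);
  trans_cocycle : forall i j k x, dom i x -> dom j x -> dom k x ->
    trans i j x *m trans j k x = trans i k x
}.

(* In chart i the connection is d + A_i, with A_i = sum_k A_i,k dx^k; values
   in su(2) say that it preserves the Hermitian metric and the determinant. *)
Record connection (R : realType) (E : SU2_bundle R) := {
  conn_form : chart E -> 'I_3 -> 'rV[R]_3 -> 'M[R[i]]_2;
  conn_su2 : forall i k x, dom i x -> is_su2 (conn_form i k x);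
  conn_smooth : forall i k, mx_smooth_on (dom i) (conn_form i k);
  conn_trans : forall i j k x, dom i x -> dom j x ->
    let g := trans i j in
    conn_form j k x = invmx (g x) *m conn_form i k x *m g x
                      + invmx (g x) *m mx_partial k g x
}.

Record su_section (R : realType) (E : SU2_bundle R) := {
  sec : chart E -> 'rV[R]_3 -> 'M[R[i]]_2;
  sec_su2 : forall i x, dom i x -> is_su2 (sec i x);
  sec_smooth : forall i, mx_smooth_on (dom i) (sec i);
  sec_trans : forall i j x, dom i x -> dom j x ->
    sec j x = invmx (trans i j x) *m sec i x *m trans i j x
}.

Section YangMillsHiggs.
Variables (R : realType) (E : SU2_bundle R).
Variables (D : connection E) (Phi : su_section E).
Implicit Types (i : chart E) (k l : 'I_3) (x : 'rV[R]_3).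

(* The operators below give local representatives in chart i, and components
   with respect to the orthonormal frame dx^1, dx^2, dx^3. *)

Definition cov i k (M : 'rV[R]_3 -> 'M[R[i]]_2) : 'rV[R]_3 -> 'M[R[i]]_2 :=
  fun x => mx_partial k M x + commmx (conn_form D i k x) (M x).

Definition curv i k l : 'rV[R]_3 -> 'M[R[i]]_2 :=
  fun x => mx_partial k (conn_form D i l) x - mx_partial l (conn_form D i k) x
           + commmx (conn_form D i k x) (conn_form D i l x).

Definition dcov i (a : 'I_3 -> 'rV[R]_3 -> 'M[R[i]]_2) k l
  : 'rV[R]_3 -> 'M[R[i]]_2 := fun x => cov i k (a l) x - cov i l (a k) x.

Definition codiff i (w : 'I_3 -> 'I_3 -> 'rV[R]_3 -> 'M[R[i]]_2) l
  : 'rV[R]_3 -> 'M[R[i]]_2 := fun x => - \sum_(k < 3) cov i k (w k l) x.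

Definition rough_laplacian i (M : 'rV[R]_3 -> 'M[R[i]]_2)
  : 'rV[R]_3 -> 'M[R[i]]_2 := fun x => - \sum_(k < 3) cov i k (cov i k M) x.

Definition YMH_solution (lambda eps : R) : Prop :=
  forall i x, dom i x ->
    (forall l, (eps ^+ 2)%:C *: codiff i (curv i) l x
               = commmx (cov i l (sec Phi i) x) (sec Phi i x)) /\
    rough_laplacian i (sec Phi i) x
    = (lambda / (2 * eps ^+ 2) * (1 - su2_sqnorm (sec Phi i x)))%:C
      *: sec Phi i x.

(* The norm of 2-forms makes dx^k /\ dx^l, k < l, orthonormal. *)
Definition local_density (lambda eps : R) i x : R :=
  eps ^+ 2 * (\sum_(k < 3) \sum_(l < 3 | (k < l)%N) su2_sqnorm (curv i k l x))
  + \sum_(k < 3) su2_sqnorm (cov i k (sec Phi i) x)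
  + lambda / (4 * eps ^+ 2) * (1 - su2_sqnorm (sec Phi i x)) ^+ 2.

Definition chart_at x : chart E := projT1 (cid (dom_cover E x)).

(* local_density is gauge invariant, so the chart chosen at x is immaterial. *)
Definition density (lambda eps : R) x : R :=
  local_density lambda eps (chart_at x) x.

Definition YMH_energy (lambda eps : R) : \bar R :=
  (\int[volume3 R]_p (density lambda eps (point3 p))%:E)%E.

Lemma partial_su2_dot k (M N : 'rV[R]_3 -> 'M[R[i]]_2) x (U : set 'rV[R]_3) :
  U x -> mx_smooth_on U M -> mx_smooth_on U N ->
  partial k (fun y => su2_dot (M y) (N y)) x
  = su2_dot (mx_partial k M x) (N x) + su2_dot (M x) (mx_partial k N x).
Proof.
move=> Ux sM sN.
have dRe P : mx_smooth_on U P -> forall a b,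
    derivable (fun y => complex.Re (P y a b)) x (delta_mx 0 k).
  by move=> sP a b; have [/(_ 1%N)[_ /(_ k)[+ _]] _] := sP a b; apply.
have dIm P : mx_smooth_on U P -> forall a b,
    derivable (fun y => complex.Im (P y a b)) x (delta_mx 0 k).
  by move=> sP a b; have [_ /(_ 1%N)[_ /(_ k)[+ _]]] := sP a b; apply.
have trE (A B : 'M[R[i]]_2) : su2_dot A B = \sum_(a < 2) \sum_(b < 2)
    (- 2 * (complex.Re (A a b) * complex.Re (B b a))
     + 2 * (complex.Im (A a b) * complex.Im (B b a))).
  rewrite /su2_dot /mxtrace !big_ord_recl !big_ord0 !mxE.
  rewrite !big_ord_recl !big_ord0.
  do ![case: (A _ _) => ? ?]; do ![case: (B _ _) => ? ?].
  by rewrite /=; ring.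
pose h a b y := - 2 * (complex.Re (M y a b) * complex.Re (N y b a))
  + 2 * (complex.Im (M y a b) * complex.Im (N y b a)).
have -> : (fun y => su2_dot (M y) (N y))
    = \sum_(a < 2) \sum_(b < 2) h a b.
  apply/funext => y; rewrite trE fct_sumE; apply: eq_bigr => a _.
  by rewrite fct_sumE.
pose dh a b := - 2 * (partial k (fun y => complex.Re (M y a b)) x
                        * complex.Re (N x b a)
                      + complex.Re (M x a b)
                        * partial k (fun y => complex.Re (N y b a)) x)
  + 2 * (partial k (fun y => complex.Im (M y a b)) x * complex.Im (N x b a)
         + complex.Im (M x a b) * partial k (fun y => complex.Im (N y b a)) x).
have hP a b : is_derive x (delta_mx 0 k) (h a b) (dh a b).
  have H1 := is_deriveM (derivableP (dRe _ sM a b)) (derivableP (dRe _ sN b a)).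
  have H2 := is_deriveM (derivableP (dIm _ sM a b)) (derivableP (dIm _ sN b a)).
  apply: is_derive_eq (is_deriveD (is_deriveZ (- 2) H1) (is_deriveZ 2 H2)) _.
  by rewrite /dh /partial /GRing.scale /=; ring.
rewrite /partial (derive_val (is_derive := is_derive_sum (fun a =>
  is_derive_sum (hP a)))) !trE -big_split; apply: eq_bigr => a _.
by rewrite -big_split; apply: eq_bigr => b _; rewrite /dh !mxE /=; ring.
Qed.

Lemma su2_dotDl (A B C : 'M[R[i]]_2) :
  su2_dot (A + B) C = su2_dot A C + su2_dot B C.
Proof. by rewrite /su2_dot mulmxDl mxtraceD -mulrDr; do 2!case: (\tr _). Qed.

Lemma su2_dotC (A B : 'M[R[i]]_2) : su2_dot A B = su2_dot B A.
Proof. by rewrite /su2_dot mxtrace_mulC. Qed.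

Lemma su2_dotNl (A B : 'M[R[i]]_2) : su2_dot (- A) B = - su2_dot A B.
Proof. by rewrite /su2_dot mulNmx linearN /= -mulrN; case: (\tr _). Qed.

Lemma su2_dot_suml n (F : 'I_n -> 'M[R[i]]_2) (B : 'M[R[i]]_2) :
  su2_dot (\sum_(k < n) F k) B = \sum_(k < n) su2_dot (F k) B.
Proof.
apply: (big_morph (fun A => su2_dot A B)) => [A C|]; first exact: su2_dotDl.
by rewrite /su2_dot mul0mx mxtrace0 mulr0.
Qed.

Lemma su2_dot_comm (A B C : 'M[R[i]]_2) :
  su2_dot (commmx A B) C = - su2_dot B (commmx A C).
Proof.
rewrite [su2_dot B _]su2_dotC -su2_dotNl [RHS]su2_dotC.
rewrite /su2_dot; congr (_ * complex.Re _).
rewrite /commmx opprB mulmxBl mulmxBr !linearB /= -!mulmxA; congr (_ - _).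
by rewrite mxtrace_mulC -mulmxA.
Qed.

(* The connection on su(E) is metric. *)
Lemma partial_cov i k (M N : 'rV[R]_3 -> 'M[R[i]]_2) x :
  dom i x -> mx_smooth_on (dom i) M -> mx_smooth_on (dom i) N ->
  partial k (fun y => su2_dot (M y) (N y)) x
  = su2_dot (cov i k M x) (N x) + su2_dot (M x) (cov i k N x).
Proof.
move=> ix sM sN; rewrite (partial_su2_dot k ix sM sN) /cov su2_dotDl.
rewrite [su2_dot (M x) (_ + _)]su2_dotC su2_dotDl.
rewrite [su2_dot (commmx _ (N x)) _]su2_dotC su2_dot_comm.
by rewrite [su2_dot (mx_partial _ N _) _]su2_dotC; ring.
Qed.

(* Integrated against compactly supported a, these identities say that codiff
   and rough_laplacian are the formal adjoint d_nabla^* on 2-forms and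
   nabla^* nabla. *)
Lemma codiff_adjoint i (w : 'I_3 -> 'I_3 -> 'rV[R]_3 -> 'M[R[i]]_2)
    (a : 'I_3 -> 'rV[R]_3 -> 'M[R[i]]_2) x :
  dom i x -> (forall k l, mx_smooth_on (dom i) (w k l)) ->
  (forall l, mx_smooth_on (dom i) (a l)) ->
  (forall k l y, dom i y -> w l k y = - w k l y) ->
  \sum_(k < 3) \sum_(l < 3 | (k < l)%N) su2_dot (w k l x) (dcov i a k l x)
  = \sum_(l < 3) su2_dot (codiff i w l x) (a l x)
    + \sum_(k < 3) \sum_(l < 3)
        partial k (fun y => su2_dot (w k l y) (a l y)) x.
Proof.
move=> ix sw sa wN.
have dE k l : su2_dot (w k l x) (dcov i a k l x)
    = su2_dot (w k l x) (cov i k (a l) x) + su2_dot (w l k x) (cov i l (a k) x).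
  rewrite /dcov su2_dotC su2_dotDl su2_dotNl (wN k l x ix) su2_dotNl.
  by congr (_ + - _); rewrite su2_dotC.
have w0 k A : su2_dot (w k k x) A = 0.
  by have := su2_dotNl (w k k x) A; rewrite -wN// => ?; lra.
under [X in _ + X]eq_bigr => k _ do under eq_bigr => l _ do
  rewrite (partial_cov k ix (sw k l) (sa l)).
under [X in X + _]eq_bigr => l _ do rewrite su2_dotNl su2_dot_suml.
under [LHS]eq_bigr => k _ do under eq_bigr => l _ do rewrite dE.
rewrite sumrN [X in - X + _]exchange_big -sumrN -big_split /=.
under [RHS]eq_bigr => k _ do rewrite big_split /= addKr.
suff H (P : 'I_3 -> 'I_3 -> R) : (forall k, P k k = 0) ->
    \sum_(k < 3) \sum_(l < 3 | (k < l)%N) (P k l + P l k)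
    = \sum_(k < 3) \sum_(l < 3) P k l.
  exact: (H (fun k l => su2_dot (w k l x) (cov i k (a l) x)) (fun k => w0 k _)).
move=> P0; under eq_bigr => k _ do rewrite big_mkcond.
by rewrite /= !big_ord_recl !big_ord0 /= !P0; ring.
Qed.

Lemma rough_laplacian_adjoint i (M N : 'rV[R]_3 -> 'M[R[i]]_2) x :
  dom i x -> mx_smooth_on (dom i) N ->
  (forall k, mx_smooth_on (dom i) (cov i k M)) ->
  \sum_(k < 3) su2_dot (cov i k M x) (cov i k N x)
  = su2_dot (rough_laplacian i M x) (N x)
    + \sum_(k < 3) partial k (fun y => su2_dot (cov i k M y) (N y)) x.
Proof.
move=> ix sN sc.
under [X in _ + X]eq_bigr => k _ do rewrite (partial_cov k ix (sc k) sN).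
rewrite /rough_laplacian su2_dotNl.
by rewrite su2_dot_suml -sumrN -big_split /=; apply: eq_bigr => k _; ring.
Qed.

End YangMillsHiggs.

(* Main.v *)
(* Write u = 1 - |Phi|^2. The equations, the Ricci and Bianchi identities and
   integration by parts of three fluxes express
     |DPhi|^2 + eps^2 |D^2 Phi|^2 + |[DPhi, Phi]|^2 + eps^2 |[F, Phi]|^2 / 2 + |du|^2 / 4 + ...
   as a divergence plus the cubic term 3 eps^2 <F, [DPhi, DPhi]> + (2 + lam) u |DPhi|^2,
   which is at most (4 + lam) (h / s + s |DPhi|^4) with h = eps^4 |F|^2 + u^2, for
   every s > 0. By Ladyzhenskaya's inequality for g = eta^2 |DPhi|^2, eta a cutoff
   function, the integral of eta^4 |DPhi|^4 is controlled by eps^-3 times the square of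
   the left-hand side tested against eta^2, while the integral of h is small with
   the energy; this is where the factor min(lam, 1) enters, as u^2 is dominated
   by 4 eps^2 / lam times the energy density. For the best s the cubic term is
   absorbed, and the left-hand side vanishes.
   Hence DPhi = 0, [F, Phi] = 0, and u is constant, so 0 by finiteness of the
   energy. Then |F| = |<F, Phi>|, and <F, Phi> is a closed and coclosed
   square-integrable 2-form on R^3, so its components are harmonic and vanish. *)
From HB Require Import structures.
Require Import Defs.
From mathcomp Require Import all_boot all_order all_algebra.
From mathcomp Require Import complex ring lra.
From mathcomp Require Import all_classical all_reals all_analysis measurable_realfun.
Import Order.TTheory GRing.Theory Num.Theory.
Import numFieldNormedType.Exports.

Set Implicit Arguments.
Unset Strict Implicit.
Unset Printing Implicit Defensive.

Local Open Scope ring_scope.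
Local Open Scope classical_set_scope.
Local Open Scope complex_scope.

(** * Smooth functions on R^3 *)

(** The left-hand side is not known to be integrable over R^3, so every estimate is made on a box of
    half-side [L], with a weight vanishing on its faces: there the weighted integral [n] is finite
    and may be absorbed, and the errors decay as [L] grows. Ladyzhenskaya's inequality is quadratic
    in [n], whereas absorption has to be linear in it. Letting [s] depend on [n], as [eps^3 tau / n]
    up to errors, turns both parts of h / s + s |DPhi|^4 into multiples of [tau n], whatever the
    size of [n]. The bundle is never trivialised. Global work happens on the scalars <S, T>, which
    gauge invariance makes smooth functions on R^3; an identity between sections is proved in a
    chart and then paired with a test section. Constants: the cubic term costs at most [109 C0 tau]
    times [3 n] plus errors, where [C0 = 4 + lambda0], and [1308 = 12 * 109] makes this a quarter of
    [n]. The threshold is [tau^2 / 6], because the integral of h is allowed to be [tau^2 eps^3] and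
    [(2 + 4 / lam) min(lam, 1)] is at most 6. *)

Lemma near_eq_continuous (T U : topologicalType) (f g : T -> U) (x : T) :
  {near x, f =1 g} -> {for x, continuous f} -> {for x, continuous g}.
Proof.
move=> fg; rewrite /prop_for /continuous_at (nbhs_singleton fg).
by move=> cf; apply: cvg_trans cf; exact: near_eq_cvg.
Qed.

Lemma open_near (T : topologicalType) (S : Type) (U : set T) (f g : T -> S) (x : T) :
  open U -> U x -> (forall y, U y -> f y = g y) -> {near x, f =1 g}.
Proof.
by move=> oU Ux fg; apply: filterS fg _; exact: open_nbhs_nbhs.
Qed.

Section SmoothCalculus.
Variable R : realType.
Implicit Types (U V : set 'rV[R]_3) (f g : 'rV[R]_3 -> R) (k l : 'I_3).

Lemma continuous_funD f g : continuous f -> continuous g ->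
  continuous (fun x => f x + g x : R).
Proof. by move=> cf cg x; apply: continuousD; [exact: cf|exact: cg]. Qed.

Lemma continuous_funM f g : continuous f -> continuous g ->
  continuous (fun x => f x * g x : R).
Proof. by move=> cf cg x; apply: continuousM; [exact: cf|exact: cg]. Qed.

Lemma continuous_funZ (c : R) f : continuous f -> continuous (fun x => c * f x : R).
Proof.
by move=> cf; apply: (@continuous_funM (fun=> c)) => // x; exact: cst_continuous.
Qed.

Lemma continuous_fun_norm f : continuous f -> continuous (fun x => `|f x| : R).
Proof.
move=> cf x; apply: (@continuous_comp _ _ _ f (@Num.norm _ R)); first exact: cf.
exact: norm_continuous.
Qed.

Lemma partial_near k f g x : (\near x, f x = g x) -> partial k f x = partial k g x.
Proof. exact: near_eq_derive. Qed.

Lemma Ck_on_eq n U f g : open U -> (forall x, U x -> f x = g x) ->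
  Ck_on n U f -> Ck_on n U g.
Proof.
move=> oU; elim: n f g => [|n IH] f g fg /= [cf Hf].
  split=> // x Ux; apply: near_eq_continuous (cf x Ux).
  exact: open_near oU Ux fg.
split=> [x Ux|k].
  by apply: near_eq_continuous (cf x Ux); exact: open_near oU Ux fg.
have [df Hk] := Hf k; split=> [x Ux|].
  by apply: near_eq_derivable (df _ Ux); exact: open_near oU Ux fg.
by apply: IH Hk => x Ux; apply: partial_near; exact: open_near oU Ux fg.
Qed.

Lemma Ck_onW n U f : Ck_on n.+1 U f -> Ck_on n U f.
Proof.
elim: n f => [|n IH] f; first by case.
by move=> [cf Hf]; split=> // k; have [df Hk] := Hf k; split=> //; exact: IH.
Qed.

Lemma Ck_on_sub n U V f : V `<=` U -> Ck_on n U f -> Ck_on n V f.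
Proof.
move=> VU; elim: n f => [|n IH] f [cf Hf]; split=> //; try by move=> x /VU/cf.
move=> k; have [df Hk] := Hf k; split; last exact: IH.
by move=> x /VU/df.
Qed.

Lemma Ck_on_cst n U (c : R) : open U -> Ck_on n U (fun=> c).
Proof.
move=> oU; elim: n c => [|n IH] c; split=> //; try by move=> x _; exact: cst_continuous.
move=> k; split=> [x _|]; first exact: derivable_cst.
by apply: (Ck_on_eq oU) (IH 0) => x _; rewrite /partial derive_cst.
Qed.

Lemma Ck_onD n U f g : open U -> Ck_on n U f -> Ck_on n U g ->
  Ck_on n U (fun x => f x + g x).
Proof.
move=> oU; elim: n f g => [|n IH] f g [cf Hf] [cg Hg]; split=> //;
  try by move=> x Ux; apply: continuousD; [exact: cf|exact: cg].
move=> k; have [df Hfk] := Hf k; have [dg Hgk] := Hg k; split=> [x Ux|].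
  exact: derivableD (df _ Ux) (dg _ Ux).
apply: (Ck_on_eq oU) (IH _ _ Hfk Hgk) => x Ux.
by rewrite /partial (deriveD (df _ Ux) (dg _ Ux)).
Qed.

Lemma Ck_onM n U f g : open U -> Ck_on n U f -> Ck_on n U g ->
  Ck_on n U (fun x => f x * g x).
Proof.
move=> oU; elim: n f g => [|n IH] f g Cf Cg.
  by case: Cf Cg => cf _ [cg _]; split=> // x Ux;
    apply: continuousM; [exact: cf|exact: cg].
have [Wf Wg] := (Ck_onW Cf, Ck_onW Cg).
case: Cf Cg => cf Hf [cg Hg]; split=> [x Ux|k].
  by apply: continuousM; [exact: cf|exact: cg].
have [df Hfk] := Hf k; have [dg Hgk] := Hg k; split=> [x Ux|].
  exact: derivableM (df _ Ux) (dg _ Ux).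
apply: (Ck_on_eq oU) (Ck_onD oU (IH _ _ Wf Hgk) (IH _ _ Wg Hfk)) => x Ux.
by rewrite /partial (deriveM (df _ Ux) (dg _ Ux)).
Qed.

Lemma smooth_on_eq U f g : open U -> (forall x, U x -> f x = g x) ->
  smooth_on U f -> smooth_on U g.
Proof. by move=> oU fg sf n; exact: Ck_on_eq (sf n). Qed.

Lemma smooth_on_sub U V f : V `<=` U -> smooth_on U f -> smooth_on V f.
Proof. by move=> VU sf n; exact: Ck_on_sub (sf n). Qed.

Lemma smooth_on_cst U (c : R) : open U -> smooth_on U (fun=> c).
Proof. by move=> oU n; exact: Ck_on_cst. Qed.

Lemma smooth_onD U f g : open U -> smooth_on U f -> smooth_on U g ->
  smooth_on U (fun x => f x + g x).
Proof. by move=> oU sf sg n; exact: Ck_onD. Qed.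

Lemma smooth_onM U f g : open U -> smooth_on U f -> smooth_on U g ->
  smooth_on U (fun x => f x * g x).
Proof. by move=> oU sf sg n; exact: Ck_onM. Qed.

Lemma smooth_onN U f : open U -> smooth_on U f -> smooth_on U (fun x => - f x).
Proof.
move=> oU sf; have := smooth_onM oU (smooth_on_cst (-1) oU) sf.
by apply: smooth_on_eq => // x _; rewrite mulN1r.
Qed.

Lemma smooth_onB U f g : open U -> smooth_on U f -> smooth_on U g ->
  smooth_on U (fun x => f x - g x).
Proof. by move=> oU sf sg; apply: smooth_onD => //; exact: smooth_onN. Qed.

Lemma smooth_on_sum U n (f : 'I_n -> 'rV[R]_3 -> R) : open U ->
  (forall i, smooth_on U (f i)) -> smooth_on U (fun x => \sum_(i < n) f i x).
Proof.
move=> oU sf; elim: n f sf => [|n IH] f sf.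
  apply: (smooth_on_eq oU) (smooth_on_cst 0 oU) => x _; by rewrite big_ord0.
apply: (smooth_on_eq oU) (smooth_onD oU (IH _ (fun i => sf (widen_ord (leqnSn n) i)))
  (sf ord_max)) => x _.
by rewrite big_ord_recr.
Qed.

Lemma smooth_on_partial U k f : smooth_on U f -> smooth_on U (partial k f).
Proof. by move=> sf n; have [_ /(_ k)[]] := sf n.+1. Qed.

Lemma smooth_on_derivable U k f x : smooth_on U f -> U x ->
  derivable f x (delta_mx 0 k).
Proof. by move=> sf; have [_ /(_ k)[df _]] := sf 1%N; exact: df. Qed.

Lemma smooth_on_continuous U f x : smooth_on U f -> U x -> {for x, continuous f}.
Proof. by move=> sf; have [cf _] := sf 0%N; exact: cf. Qed.

Lemma partialD U k f g x : smooth_on U f -> smooth_on U g -> U x ->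
  partial k (fun y => f y + g y) x = partial k f x + partial k g x.
Proof. by move=> sf sg Ux; apply: deriveD; apply: smooth_on_derivable Ux. Qed.

Lemma partialM U k f g x : smooth_on U f -> smooth_on U g -> U x ->
  partial k (fun y => f y * g y) x = partial k f x * g x + f x * partial k g x.
Proof.
move=> sf sg Ux; rewrite /partial deriveM; try exact: smooth_on_derivable Ux.
by rewrite addrC [X in X + _]mulrC.
Qed.

Lemma partial_cst k (c : R) x : partial k (fun=> c) x = 0.
Proof. exact: derive_cst. Qed.

Lemma partialN U k f x : smooth_on U f -> U x ->
  partial k (fun y => - f y) x = - partial k f x.
Proof. by move=> sf Ux; apply: deriveN; apply: smooth_on_derivable Ux. Qed.

Lemma partial_sum U k n (f : 'I_n -> 'rV[R]_3 -> R) x :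
  (forall i, smooth_on U (f i)) -> U x ->
  partial k (fun y => \sum_(i < n) f i y) x = \sum_(i < n) partial k (f i) x.
Proof.
move=> sf Ux; rewrite /partial -fct_sumE derive_sum // => i.
exact: smooth_on_derivable Ux.
Qed.

Lemma is_derive_line f (x : 'rV[R]_3) k (t : R) : derivable f (x + t *: delta_mx 0 k) (delta_mx 0 k) ->
  is_derive t 1 (fun s => f (x + s *: delta_mx 0 k))
    (partial k f (x + t *: delta_mx 0 k)).
Proof.
move=> df.
have E : (fun h : R => h^-1 *: ((fun s => f (x + s *: delta_mx 0 k)) (h *: 1 + t)
           - f (x + t *: delta_mx 0 k)))
       = (fun h => h^-1 *: (f (h *: delta_mx 0 k + (x + t *: delta_mx 0 k))
           - f (x + t *: delta_mx 0 k))).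
  apply/funext => h; congr (_ *: (f _ - _)).
  by rewrite scalerDl /GRing.scale /= mulr1 addrCA.
by apply: DeriveDef; rewrite /derivable /derive /partial /derive E.
Qed.

(** The increment [t] may be negative, so the intermediate point is located by absolute values
    instead of an interval. *)
Lemma partial_mvt f (x : 'rV[R]_3) k (t : R) : t != 0 ->
  (forall s, `|s| <= `|t| -> derivable f (x + s *: delta_mx 0 k) (delta_mx 0 k)) ->
  exists2 s, `|s| <= `|t| &
    f (x + t *: delta_mx 0 k) - f x = t * partial k f (x + s *: delta_mx 0 k).
Proof.
move=> t0 df; pose F (s : R) := f (x + s *: delta_mx 0 k).
pose G (s : R) := partial k f (x + s *: delta_mx 0 k).
have x0 : x = x + 0 *: delta_mx 0 k by rewrite scale0r addr0.
have dF (s : R) : `|s| <= `|t| -> is_derive s 1 F (G s).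
  by move=> st; exact/is_derive_line/df.
have cF (i : interval R) : (forall s, s \in i -> `|s| <= `|t|) -> {within [set` i], continuous F}.
  move=> ht; apply: derivable_within_continuous => s si.
  by have [] := dF _ (ht s si).
rewrite {2}x0 -/(F t) -/(F 0).
have [tp|tn|tE] := ltgtP 0 t; last by rewrite -tE eqxx in t0.
  have ht (s : R) : s \in `[0, t]%R -> `|s| <= `|t|.
    by rewrite in_itv /= => /andP[s0 st]; rewrite !ger0_norm// ltW.
  have dF' (s : R) : s \in `]0, t[%R -> is_derive s 1 F (G s).
    by move=> /subset_itv_oo_cc /ht; exact: dF.
  have [s sI ->] := MVT tp dF' (cF _ ht).
  exists s; first by apply/ht/subset_itv_oo_cc.
  by rewrite subr0 mulrC.
have ht (s : R) : s \in `[t, 0]%R -> `|s| <= `|t|.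
  by rewrite in_itv /= => /andP[s0 st]; rewrite !ler0_norm ?lerN2// ltW.
have dF' (s : R) : s \in `]t, 0[%R -> is_derive s 1 F (G s).
  by move=> /subset_itv_oo_cc /ht; exact: dF.
have [s sI E] := MVT tn dF' (cF _ ht).
exists s; first by apply/ht/subset_itv_oo_cc.
by rewrite -opprB E sub0r mulrN opprK mulrC.
Qed.

Lemma shift_quotient f (x c v : 'rV[R]_3) :
  (fun h : R => h^-1 *: ((fun y => f (y + c)) (h *: v + x) - f (x + c)))
  = (fun h => h^-1 *: (f (h *: v + (x + c)) - f (x + c))).
Proof. by apply/funext => h; rewrite addrA. Qed.

Lemma derivable_shift f (x c v : 'rV[R]_3) :
  derivable f (x + c) v -> derivable (fun y => f (y + c)) x v.
Proof. by rewrite /derivable shift_quotient. Qed.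

Lemma partial_shift f k (x c : 'rV[R]_3) :
  partial k (fun y => f (y + c)) x = partial k f (x + c).
Proof. by rewrite /partial /derive shift_quotient. Qed.

(** The left-hand side is symmetric in [k] and [l], which is the source of the symmetry of second
    derivatives. The mean value theorem is used twice: along [k] for the increment of [f] under the
    shift [c], then along [l] for [partial k f]. *)
Lemma second_difference U f k l (x : 'rV[R]_3) (t : R) : smooth_on U f -> t != 0 ->
  (forall s s' : R, `|s| <= `|t| -> `|s'| <= `|t| ->
    U (x + s *: delta_mx 0 k + s' *: delta_mx 0 l)) ->
  exists s s' : R, [/\ `|s| <= `|t|, `|s'| <= `|t| &
    f (x + t *: delta_mx 0 k + t *: delta_mx 0 l) - f (x + t *: delta_mx 0 k)
    - (f (x + t *: delta_mx 0 l) - f x)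
    = t * t * partial l (partial k f) (x + s *: delta_mx 0 k + s' *: delta_mx 0 l)].
Proof.
move=> sf t0 HU; pose c := t *: delta_mx 0 l : 'rV[R]_3.
have U0 s : `|s| <= `|t| -> U (x + s *: delta_mx 0 k).
  by move=> st; have := HU s 0 st; rewrite normr0 normr_ge0 scale0r addr0; apply.
have dc (s : R) : `|s| <= `|t| ->
    derivable (fun y => f (y + c)) (x + s *: delta_mx 0 k) (delta_mx 0 k).
  move=> st; apply: derivable_shift; apply: (smooth_on_derivable (U := U)) => //.
  exact: HU.
have d0 (s : R) : `|s| <= `|t| ->
    derivable f (x + s *: delta_mx 0 k) (delta_mx 0 k).
  by move=> st; apply: (smooth_on_derivable (U := U)) => //; exact: U0.
have [s st E] := @partial_mvt (fun y => f (y + c) - f y) x k t t0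
  (fun s st => derivableB (dc s st) (d0 s st)).
have [s' st' E'] := @partial_mvt (partial k f) (x + s *: delta_mx 0 k) l t t0
  (fun s' st' => smooth_on_derivable (smooth_on_partial k sf) (HU _ _ st st')).
exists s, s'; split=> //.
transitivity (t * partial k (fun y => f (y + c) - f y) (x + s *: delta_mx 0 k)).
  by rewrite -E /c; ring.
rewrite /partial deriveB; [|exact: dc|exact: d0].
by rewrite -!/(partial _ _ _) partial_shift /c E' mulrA.
Qed.

(** The points [y] and [z] may differ, because the two orders of differentiation produce unrelated
    intermediate points; continuity at [x] makes up for this. *)
Lemma continuous_agree (A B : 'rV[R]_3 -> R) (x : 'rV[R]_3) :
  {for x, continuous A} -> {for x, continuous B} ->
  (forall d : R, 0 < d -> exists y z, [/\ ball x d y, ball x d z & A y = B z]) ->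
  A x = B x.
Proof.
move=> cA cB H; apply/eqP; rewrite -subr_eq0 -normr_eq0 eq_le normr_ge0 andbT.
apply/ler_addgt0Pr => e e0; rewrite add0r.
have e20 : 0 < e / 2 by rewrite divr_gt0.
have /cvgrPdist_lt/(_ _ e20) nA := cA.
have /cvgrPdist_lt/(_ _ e20) nB := cB.
have /nbhs_ballP[d /= d0 Hd] :
    nbhs x [set y | `|A x - A y| < e / 2 /\ `|B x - B y| < e / 2].
  exact: filterI nA nB.
have [y [z [/Hd[hy _] /Hd[_ hz] E]]] := H d d0.
rewrite [leRHS]splitr -(subrKA (A y)) {2}E.
by apply: le_trans (ler_normD _ _) _; rewrite lerD ?ltW// distrC.
Qed.

Lemma partialC U f k l x : open U -> smooth_on U f -> U x ->
  partial k (partial l f) x = partial l (partial k f) x.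
Proof.
move=> oU sf Ux; apply: continuous_agree => [||d0 d00].
- by apply: smooth_on_continuous Ux; do 2!apply: smooth_on_partial.
- by apply: smooth_on_continuous Ux; do 2!apply: smooth_on_partial.
have nU : nbhs x U by exact: open_nbhs_nbhs.
have nb : nbhs x (ball x d0) by exact: nbhsx_ballx.
have /nbhs_ballP[d /= d_gt0 Hd] : nbhs x (U `&` ball x d0) by exact: filterI.
(* The summand 1 keeps [c] positive; [t * c < d] keeps the whole parallelogram spanned by the two
   shifts inside the ball. *)
pose c := 1 + `|delta_mx 0 k : 'rV[R]_3| + `|delta_mx 0 l : 'rV[R]_3|.
have c0 : 0 < c by rewrite /c -addrA ltr_wpDr// addr_ge0.
pose t := d / 2 / c.
have t0 : 0 < t by rewrite !divr_gt0.
have tc : t * c < d by rewrite /t divfK ?gt_eqF// ltr_pdivrMr// ltr_pMr// ltr1n.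
have Hb i j (s s' : R) : `|delta_mx 0 i : 'rV[R]_3| + `|delta_mx 0 j : 'rV[R]_3| <= c ->
    `|s| <= `|t| -> `|s'| <= `|t| ->
    ball x d (x + s *: delta_mx 0 i + s' *: delta_mx 0 j).
  move=> ijc; rewrite (gtr0_norm t0) => hs hs'.
  rewrite -ball_normE /= -addrA opprD addrA subrr sub0r normrN.
  apply: le_lt_trans (ler_normD _ _) _; rewrite !normrZ.
  apply: le_lt_trans tc; apply: (@le_trans _ _ (t * (`|delta_mx 0 i : 'rV[R]_3| + `|delta_mx 0 j : 'rV[R]_3|))).
    by rewrite mulrDr lerD// ler_wpM2r.
  by rewrite ler_pM2l.
have kl : `|delta_mx 0 k : 'rV[R]_3| + `|delta_mx 0 l : 'rV[R]_3| <= c.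
  by rewrite /c -addrA lerDr.
have lk : `|delta_mx 0 l : 'rV[R]_3| + `|delta_mx 0 k : 'rV[R]_3| <= c.
  by rewrite addrC.
have [s [s' [hs hs' E]]] := @second_difference U f k l x t sf (lt0r_neq0 t0)
  (fun s s' hs hs' => proj1 (Hd _ (Hb k l s s' kl hs hs'))).
have [r [r' [hr hr' E']]] := @second_difference U f l k x t sf (lt0r_neq0 t0)
  (fun s s' hs hs' => proj1 (Hd _ (Hb l k s s' lk hs hs'))).
have [_ H1] := Hd _ (Hb k l s s' kl hs hs').
have [_ H2] := Hd _ (Hb l k r r' lk hr hr').
have tt0 : t * t != 0 by rewrite mulf_neq0 ?gt_eqF.
do 2!eexists; split; [exact: H2|exact: H1|].
apply: (mulfI tt0); apply: etrans (esym E') _; apply: etrans E.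
rewrite (addrAC x (t *: delta_mx 0 l)).
move: (f _) (f _) (f _) (f _) => f1 f2 f3 f4; ring.
Qed.

End SmoothCalculus.

(** * Integration over boxes *)

Section Measurability.
Variable R : realType.
Let T3 := (R * R * R)%type.

(** Measurable sets of the product are generated by rectangles, so an open set is exhibited as a
    countable union of boxes with rational centres. Two points of an interval of radius [e n] are
    less than [2 * e n] apart, hence the condition on [e]. *)
Lemma open_measurable3 (U : set T3) : open U -> measurable U.
Proof.
move=> oU.
have [e [e_gt0 e_lt]] : exists e : nat -> R,
    (forall n, 0 < e n) /\ forall d, 0 < d -> exists n, 2 * e n < d.
  exists (fun n => n.+1%:R^-1); split=> [n|d d0]; first by rewrite invr_gt0.
  have d20 : 0 < d / 2 by rewrite divr_gt0.
  have [n nd] := ltr_add_invr d20; exists n.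
  by rewrite -ltr_pdivlMl // mulrC -[ltLHS]add0r.
pose I (q : rat) n : set R := `](ratr q - e n)%R, (ratr q + e n)%R[.
pose B (i : rat * rat * rat * nat) : set T3 :=
  (I i.1.1.1 i.2 `*` I i.1.1.2 i.2) `*` I i.1.2 i.2.
have -> : U = \bigcup_i (if `[< B i `<=` U >] then B i else set0).
  apply/seteqP; split=> [p Up|p [i _]]; last by case: asboolP => // + Bp; apply.
  have /nbhs_ballP[d /= d0 Hd] : nbhs p U by exact: open_nbhs_nbhs.
  have [n nd] := e_lt d d0; have e0 := e_gt0 n.
  have appr (x : R) : exists q : rat, I q n x.
    have [q] : exists q, ratr q \in `]x - e n, x + e n[%R.
      by apply: rat_in_itvoo; lra.
    by rewrite in_itv /= => /andP[? ?]; exists q; rewrite /I /= in_itv /=; apply/andP; split; lra.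
  have [q1 h1] := appr p.1.1; have [q2 h2] := appr p.1.2; have [q3 h3] := appr p.2.
  have BU : B (q1, q2, q3, n) `<=` U; last first.
    by exists (q1, q2, q3, n) => //=; rewrite asboolT.
  move=> [[a b] c] [[/= ha hb] /= hc]; apply: Hd.
  have H q (x y : R) : I q n x -> I q n y -> ball x d y.
    rewrite /I /= !in_itv /= => /andP[? ?] /andP[? ?].
    by rewrite -ball_normE /ball_ /= ltr_norml; apply/andP; split; lra.
  split; first split.
  - exact: H h1 ha.
  - exact: H h2 hb.
  - exact: H h3 hc.
apply: countable_bigcupT_measurable => [|i]; first exact: countableP.
case: ifP => // _.
by apply: measurableX; [apply: measurableX|]; exact: measurable_itv.
Qed.

Lemma continuous_measurable3 (f : T3 -> R) : continuous f -> measurable_fun setT f.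
Proof.
move=> /continuousP cf; move=> mD; apply: (measurability _ (RGenOInfty.measurableE R)) => //.
move=> _ [_ [a ->] <-]; rewrite setTI; apply: open_measurable3.
exact/cf/interval_open.
Qed.

Lemma point3_continuous : continuous (@point3 R).
Proof.
move=> p; apply/cvg_ballP => e e0.
have nb : nbhs (p : T3) (ball (p : T3) e) by exact: nbhsx_ballx.
apply: filterS nb; case: p => [[x y] z] [[x' y'] z'] [[/= hx hy] hz].
split=> // i j; rewrite !mxE.
by case: j => -[|[|[|//]]] ? /=.
Qed.

Lemma measurable_point3 (f : 'rV[R]_3 -> R) : continuous f ->
  measurable_fun setT (fun p => f (point3 p)).
Proof.
move=> cf; apply: continuous_measurable3 => p.
by apply: (@continuous_comp _ _ _ (@point3 R) f); [exact: point3_continuous|exact: cf].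
Qed.

Definition box3 (L : R) : set T3 := (`[- L, L] `*` `[- L, L]) `*` `[- L, L].

Lemma measurable_box3 L : measurable (box3 L).
Proof. by apply: measurableX; [apply: measurableX|]; exact: measurable_itv. Qed.

Lemma compact_box3 L : compact (box3 L).
Proof. by do 2?apply: compact_setX; exact: segment_compact. Qed.

Lemma volume3_prod (A B C : set R) : measurable A -> measurable B -> measurable C ->
  volume3 R ((A `*` B) `*` C)
  = (lebesgue_measure A * lebesgue_measure B * lebesgue_measure C)%E.
Proof.
move=> mA mB mC; rewrite /volume3.
rewrite (@product_measure1E _ _ _ _ R (@lebesgue_measure R \x @lebesgue_measure R)%E
  (@lebesgue_measure R)) //; last exact: measurableX.
by rewrite [X in (X * _)%E](@product_measure1E _ _ _ _ R (@lebesgue_measure R)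
  (@lebesgue_measure R)).
Qed.

Lemma lebesgue_measure_segment (a b : R) : a <= b ->
  lebesgue_measure (`[a, b] : set R) = (b - a)%:E.
Proof.
move=> ab; rewrite lebesgue_measure_itv /= lte_fin.
by move: ab; rewrite le_eqVlt => /orP[/eqP ->|->]; rewrite ?ltxx ?subrr.
Qed.

Lemma volume3_box (L : R) : 0 <= L -> volume3 R (box3 L) = ((L *+ 2) ^+ 3)%:E.
Proof.
move=> L0; rewrite /box3 volume3_prod; try exact: measurable_itv.
rewrite lebesgue_measure_segment ?ge0_cp// opprK -mulr2n -!EFinM.
by rewrite !exprS expr0 mulr1 mulrA.
Qed.

Lemma bounded_box3 (f : 'rV[R]_3 -> R) L : continuous f ->
  exists M : R, forall p, box3 L p -> `|f (point3 p)| <= M.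
Proof.
move=> cf.
have cfp : continuous (fun p => f (point3 p)).
  move=> p; by apply: (@continuous_comp _ _ _ (@point3 R) f);
    [exact: point3_continuous|exact: cf].
have /compact_bounded[M [_ H]] :=
  continuous_compact (continuous_subspaceT cfp) (@compact_box3 L).
by exists (M + 1) => p Bp; apply: (H (M + 1)); [rewrite ltrDl|exists p].
Qed.

Lemma integrable_box3 (f : 'rV[R]_3 -> R) L : continuous f ->
  (volume3 R).-integrable (box3 L) (EFin \o (fun p => f (point3 p))).
Proof.
move=> cf; apply: measurable_bounded_integrable.
- exact: measurable_box3.
- suff : (volume3 R (box3 L) < +oo)%E by [].
  have [L0|L0] := leP 0 L; first by rewrite volume3_box // ltry.
  have -> : box3 L = set0.
    by apply/seteqP; split=> // p [] /= _; rewrite in_itv /= => /andP[]; lra.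
  have -> : volume3 R set0 = 0%E by exact: measure0.
  exact: ltry.
- exact: measurable_funTS (measurable_point3 cf).
- have [M HM] := bounded_box3 L cf.
  by exists M; split; rewrite ?num_real // => r Mr p Bp; apply: le_trans (HM p Bp) (ltW Mr).
Qed.

End Measurability.

Section ProductMeasure.
Local Open Scope ereal_scope.
Context d1 d2 (T1 : measurableType d1) (T2 : measurableType d2) (R : realType).
Variables (m1 : {sigma_finite_measure set T1 -> \bar R})
  (m2 : {sigma_finite_measure set T2 -> \bar R}).

(* [m1 \x m2] under a name that carries the sigma-finite structure, which
   inference does not find on [\x] itself. *)
Definition sigma_finite_prod : set (T1 * T2) -> \bar R := m1 \x m2.

HB.instance Definition _ := Measure.on sigma_finite_prod.
HB.instance Definition _ : isSFinite _ _ _ sigma_finite_prod :=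
  lebesgue_integral_fubini.measure_function_Measure_isSigmaFinite__to__measure_function_isSFinite m1 m2.
HB.instance Definition _ : isSigmaFinite _ _ _ sigma_finite_prod :=
  lebesgue_integral_fubini.measure_function_Measure_isSigmaFinite__to__measure_function_isSigmaFinite m1 m2.

End ProductMeasure.

(** * Ladyzhenskaya's inequality in abstract form: integration over slices *)

Section SliceInequality.
Local Open Scope ereal_scope.
Context d1 d2 d3 (T1 : measurableType d1) (T2 : measurableType d2)
  (T3 : measurableType d3) (R : realType).
Variables (m1 : {sigma_finite_measure set T1 -> \bar R})
  (m2 : {sigma_finite_measure set T2 -> \bar R})
  (m3 : {sigma_finite_measure set T3 -> \bar R}).

Lemma ge0_integral_mul (f : T2 -> \bar R) (g : T1 -> \bar R) :
  measurable_fun setT f -> measurable_fun setT g ->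
  (forall y, 0 <= f y) -> (forall x, 0 <= g x) ->
  \int[m1]_x \int[m2]_y (f y * g x) = (\int[m2]_y f y) * (\int[m1]_x g x).
Proof.
move=> mf mg f0 g0.
under eq_integral => x _ do rewrite ge0_integralZr//.
by rewrite ge0_integralZl// integral_ge0.
Qed.

(** Optimisation over [s], in the extended reals because the integrals over a slice may be infinite.
    If [Q] is finite, then [s = 1] shows that [A] is finite. *)
Lemma le_sqr_of_amgm (A Q : \bar R) (h : R) : (0 < h)%R -> 0 <= A -> 0 <= Q ->
  (forall s : R, (0 < s)%R -> A <= (s * h)%:E + (s^-1)%:E * Q) ->
  A * A <= (4 * h)%:E * Q.
Proof.
move=> h0 A0 Q0 H; have h40 : (0 < 4 * h)%R by rewrite mulr_gt0.
case: Q Q0 H => [r r0 H|_ _|//]; last by rewrite gt0_muley ?lte_fin// leey.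
case: A A0 H => [a a0 H|_ H|//]; last by have := H 1%R ltr01; rewrite -EFinM -EFinD leye_eq.
rewrite -!EFinM lee_fin.
have [->|an0] := eqVneq a 0%R; first by rewrite mul0r mulr_ge0// ltW.
have ap : (0 < a)%R by rewrite lt_neqAle eq_sym an0 -lee_fin.
(* For this [s] the term [s * h] is [a / 2], which the left-hand side absorbs. *)
have := H (a / (2 * h))%R; rewrite divr_gt0 ?mulr_gt0// => /(_ isT).
rewrite -EFinM -EFinD lee_fin invf_div.
have -> : (a / (2 * h) * h = a / 2)%R by field; rewrite gt_eqF.
rewrite -(ler_pM2l ap) => H'.
have E : (a * (a / 2 + 2 * h / a * r) = a * a / 2 + 2 * h * r)%R.
  by field; rewrite gt_eqF.
by move: H'; rewrite E; lra.
Qed.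

Notation m12 := (sigma_finite_prod m1 m2).

Variables (G D Q : T1 * T2 * T3 -> \bar R) (h : R).
Hypotheses (mG : measurable_fun setT G) (mD : measurable_fun setT D)
  (mQ : measurable_fun setT Q).
Hypotheses (G0 : forall p, 0 <= G p) (D0 : forall p, 0 <= D p)
  (Q0 : forall p, 0 <= Q p).
Hypothesis G1 : forall x y z, G (x, y, z) <= \int[m1]_t D (t, y, z).
Hypothesis G2 : forall x y z, G (x, y, z) <= \int[m2]_t D (x, t, z).
Hypothesis G3 : forall x y z, G (x, y, z) <= \int[m3]_t D (x, y, t).
Hypothesis DGQ : forall s : R, (0 < s)%R -> forall p,
  D p <= s%:E * G p + (s^-1)%:E * Q p.
Hypothesis h0 : (0 < h)%R.
Hypothesis Dh : \int[m12 \x m3]_p D p <= h%:E.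

(* Ladyzhenskaya's inequality: on the slice at height z the integral of G^2 is
   at most the squared integral of D, hence at most 4 h times that of Q. *)
Lemma slice_inequality :
  \int[m12 \x m3]_p (G p * G p) <= (4 * h)%:E * \int[m12 \x m3]_p Q p.
Proof.
have mz (f : T1 * T2 * T3 -> \bar R) (z : T3) : measurable_fun setT f ->
    measurable_fun setT (fun q => f (q, z)).
  by move=> mf; exact: measurableT_comp mf (pair2_measurable z).
have mGG : measurable_fun setT (fun p => G p * G p) by exact: emeasurable_funM.
have GG0 p : 0 <= G p * G p by exact: mule_ge0.
rewrite (fubini_tonelli2 (fun p => G p * G p) mGG GG0) (fubini_tonelli2 Q mQ Q0).
rewrite -ge0_integralZl//; last 3 first.
- exact: (measurable_fun_fubini_tonelli_G).
- by move=> z _; exact: integral_ge0.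
- by rewrite lee_fin mulr_ge0// ltW.
apply: ge0_le_integral => //.
- by move=> z _; exact: integral_ge0.
- exact: (measurable_fun_fubini_tonelli_G (fun p => G p * G p)).
- apply: emeasurable_funM => //.
  exact: (measurable_fun_fubini_tonelli_G).
move=> z _; rewrite /fubini_G.
pose A := \int[m12]_q D (q, z).
apply: (@le_trans _ _ (A * A)); last first.
  apply: le_sqr_of_amgm => //; try exact: integral_ge0.
  move=> s s0.
  (* Integrating [G3] over the slice bounds its [G]-mass by [h], uniformly in [z]. *)
  have Gh : \int[m12]_q G (q, z) <= h%:E.
    apply: le_trans Dh; rewrite (fubini_tonelli1 D)//.
    apply: ge0_le_integral => //.
    + exact: mz.
    + exact: (measurable_fun_fubini_tonelli_F).
    + by move=> [x y] _; exact: G3.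
  apply: (@le_trans _ _ (\int[m12]_q (s%:E * G (q, z) + (s^-1)%:E * Q (q, z)))).
    apply: ge0_le_integral => //.
    + exact: mz.
    + by apply: emeasurable_funD; apply: emeasurable_funM => //; exact: mz.
    + by move=> q _; exact: DGQ.
  rewrite ge0_integralD//; first last.
  - by apply: emeasurable_funM => //; exact: mz.
  - by move=> q _; rewrite mule_ge0// lee_fin invr_ge0 ltW.
  - by apply: emeasurable_funM => //; exact: mz.
  - by move=> q _; rewrite mule_ge0// lee_fin ltW.
  rewrite !ge0_integralZl//; last 4 first.
  - exact: mz.
  - by rewrite lee_fin invr_ge0 ltW.
  - exact: mz.
  - by rewrite lee_fin ltW.
  by rewrite EFinM leeD2r// lee_pmul2l.
have mDz : measurable_fun setT (fun q => D (q, z)) by exact: mz.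
(* On the slice, [G^2] is at most [al y * be x] by [G1] and [G2]. The variables separate, and both
   single integrals equal the integral of [D] over the slice, so their product is [A * A]. *)
pose al (y : T2) := \int[m1]_t D (t, y, z).
pose be (x : T1) := \int[m2]_t D (x, t, z).
have mal : measurable_fun setT al.
  exact: (measurable_fun_fubini_tonelli_G (fun q => D (q, z))).
have mbe : measurable_fun setT be.
  exact: (measurable_fun_fubini_tonelli_F (fun q => D (q, z))).
have al0 y : 0 <= al y by exact: integral_ge0.
have be0 x : 0 <= be x by exact: integral_ge0.
have mab : measurable_fun setT (fun q : T1 * T2 => al q.2 * be q.1).
  by apply: emeasurable_funM; apply: measurableT_comp.
apply: (@le_trans _ _ (\int[m12]_q (al q.2 * be q.1))).
  apply: ge0_le_integral => //.
  - exact: mz mGG.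
  - by move=> [x y] _; apply: lee_pmul.
rewrite (fubini_tonelli1)//; last first.
  by move=> q; exact: mule_ge0.
rewrite [X in X <= _]ge0_integral_mul//.
rewrite /A {1}(fubini_tonelli2 (fun q => D (q, z)))//.
by rewrite (fubini_tonelli1 (fun q => D (q, z))).
Qed.

End SliceInequality.

(** * Integrals of continuous functions over boxes *)

Section BoxIntegral.
Variable R : realType.
Implicit Types (f g : 'rV[R]_3 -> R) (L : R).

(** Real-valued, so that ordered-field automation applies to inequalities between integrals. As
    [fine] sends infinite values to 0, linearity and monotonicity are stated for continuous
    functions, whose integral over the compact box is finite. *)
Definition boxint L f : R :=
  fine (\int[volume3 R]_(p in box3 L) (f (point3 p))%:E)%E.

Lemma boxintE L f : continuous f ->
  (boxint L f)%:E = (\int[volume3 R]_(p in box3 L) (f (point3 p))%:E)%E.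
Proof.
move=> cf; rewrite fineK//; apply: integrable_fin_num; first exact: measurable_box3.
exact: integrable_box3.
Qed.

Lemma boxintD L f g : continuous f -> continuous g ->
  boxint L (fun x => f x + g x) = boxint L f + boxint L g.
Proof.
move=> cf cg.
have H := RintegralD _ (integrable_box3 L cf) (integrable_box3 L cg).
by apply: H; exact: measurable_box3.
Qed.

Lemma boxintZ L c f : continuous f -> boxint L (fun x => c * f x) = c * boxint L f.
Proof.
move=> cf.
have H := RintegralZl c _ (integrable_box3 L cf).
by apply: H; exact: measurable_box3.
Qed.

Lemma boxint_le L f g : continuous f -> continuous g ->
  (forall p, box3 L p -> f (point3 p) <= g (point3 p)) -> boxint L f <= boxint L g.
Proof.
move=> cf cg fg.
have H := le_Rintegral _ (integrable_box3 L cf) (integrable_box3 L cg).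
by apply: H => //; exact: measurable_box3.
Qed.

Lemma boxint_ge0 L f : (forall p, box3 L p -> 0 <= f (point3 p)) -> 0 <= boxint L f.
Proof.
move=> f0; apply: fine_ge0; apply: integral_ge0 => p Bp.
by rewrite lee_fin f0.
Qed.

Lemma boxint_le_integral L f : continuous f -> (forall x, 0 <= f x) ->
  ((boxint L f)%:E <= \int[volume3 R]_p (f (point3 p))%:E)%E.
Proof.
move=> cf f0; rewrite boxintE//; apply: ge0_subset_integral => //.
- exact: measurable_box3.
- by apply/measurable_EFinP; exact: measurable_point3.
- by move=> p _; rewrite lee_fin.
Qed.

Lemma boxint_subset L L' f : L <= L' -> continuous f -> (forall x, 0 <= f x) ->
  boxint L f <= boxint L' f.
Proof.
move=> LL cf f0; rewrite -lee_fin !boxintE//; apply: ge0_subset_integral => //.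
- exact: measurable_box3.
- exact: measurable_box3.
- by apply/measurable_EFinP; apply: measurable_funTS; exact: measurable_point3.
- by move=> p _; rewrite lee_fin.
have H : `[- L, L] `<=` `[- L', L'].
  by move=> x /=; rewrite !in_itv /= => /andP[? ?]; apply/andP; split; lra.
by move=> [[x y] z] [[/= /H ? /H ?] /= /H ?].
Qed.

Lemma boxint_cst L (c : R) : 0 <= L -> boxint L (fun=> c) = c * (L *+ 2) ^+ 3.
Proof.
move=> L0; have H := @Rintegral_cst _ _ R (volume3 R) (box3 L) (measurable_box3 L) c.
have E : boxint L (fun=> c) = c * fine (volume3 R (box3 L)) by exact: H.
by rewrite E volume3_box.
Qed.

Lemma measurable_patch_box L f : continuous f ->
  measurable_fun [set: R * R * R] (((fun p => f (point3 p)) \_ (box3 L))).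
Proof.
move=> cf; apply/(measurable_restrictT _ (measurable_box3 L)).
by apply: measurable_funTS; exact: measurable_point3.
Qed.

End BoxIntegral.

(** * Line integrals and the divergence theorem on boxes *)

Section Lines.
Variable R : realType.
Implicit Types (f g : 'rV[R]_3 -> R) (L : R).
Notation mu1 := (@lebesgue_measure R).

Lemma smooth_continuous f : smooth_on setT f -> continuous f.
Proof. by move=> sf x; exact: smooth_on_continuous sf _. Qed.

Lemma continuous_line f (x : 'rV[R]_3) k : continuous f ->
  continuous (fun t : R => f (x + t *: delta_mx 0 k)).
Proof.
move=> cf t.
apply: (@continuous_comp _ _ _ (fun t : R => x + t *: delta_mx 0 k : 'rV[R]_3) f);
  last exact: cf.
by apply: cvgD; [exact: cvg_cst|apply: cvgZr_tmp; exact: cvg_id].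
Qed.

Lemma line_integral f x k (a b : R) : a < b -> smooth_on setT f ->
  (\int[mu1]_(t in `[a, b]) (partial k f (x + t *: delta_mx 0 k))%:E
   = (f (x + b *: delta_mx 0 k) - f (x + a *: delta_mx 0 k))%:E)%E.
Proof.
move=> ab sf; pose F t := f (x + t *: delta_mx 0 k).
have dF t : is_derive t (1 : R) F (partial k f (x + t *: delta_mx 0 k)).
  by apply: is_derive_line; exact: smooth_on_derivable sf _.
have cF : continuous F by apply: continuous_line; exact: smooth_continuous.
rewrite (@continuous_FTC2 _ _ F)//.
- apply: continuous_subspaceT; apply: continuous_line.
  by apply: smooth_continuous; exact: smooth_on_partial.
- split=> [t _||].
  + by have [] := dF t.
  + exact: cvg_at_right_filter (cF a).
  + exact: cvg_at_left_filter (cF b).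
- by move=> t _; rewrite derive1E; exact: derive_val.
Qed.

(** [gam] runs along a line in direction [k]. [P] says that the other two coordinates lie in
    [[- L, L]]: the line meets the box in a full segment or not at all. *)
Variables (x : 'rV[R]_3) (k : 'I_3) (L : R) (gam : R -> R * R * R) (P : Prop).
Hypothesis L0 : 0 < L.
Hypothesis gamE : forall t, point3 (gam t) = x + t *: delta_mx 0 k.
Hypothesis gam_box : forall t, box3 L (gam t) <-> P /\ t \in `[- L, L]%R.

Lemma line_patch (F : R * R * R -> R) : P ->
  (fun t => (F \_ (box3 L)) (gam t)) = (fun t => F (gam t)) \_ `[- L, L].
Proof.
move=> HP; apply/funext => t; rewrite !patchE; congr (if _ then _ else _).
apply/idP/idP; rewrite !inE.
  by move/(gam_box t).1 => [].
by move=> tL; apply/(gam_box t).2.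
Qed.

Lemma line_patch0 (F : R * R * R -> R) : ~ P ->
  (fun t => (F \_ (box3 L)) (gam t)) = cst 0.
Proof.
move=> HP; apply/funext => t; rewrite patchE ifF//.
by apply/negbTE; rewrite notin_setE => /(gam_box t).1 [].
Qed.

Lemma line_integral0 f : smooth_on setT f ->
  (P -> f (x + L *: delta_mx 0 k) = 0) -> (P -> f (x + (- L) *: delta_mx 0 k) = 0) ->
  (\int[mu1]_t ((((fun p => partial k f (point3 p)) \_ (box3 L)) (gam t))%:E) = 0)%E.
Proof.
move=> sf f1 f2; have [HP|HP] := pselect P; last first.
  by have := line_patch0 (fun p => partial k f (point3 p)) HP => /(congr1 (fun F => F _)) E;
  under eq_integral => t _ do rewrite E; rewrite integral0.
have E t := congr1 (fun F => F t) (line_patch (fun p => partial k f (point3 p)) HP).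
under eq_integral => t _ do rewrite /= E patchE.
transitivity (\int[mu1]_(t in `[(- L)%R, L]) (partial k f (x + t *: delta_mx 0 k))%:E)%E.
  rewrite [RHS]integral_mkcond; apply: eq_integral => t _.
  by rewrite patchE gamE; case: ifP.
by rewrite line_integral ?f1 ?f2 ?subrr// (lt_trans _ L0)// oppr_lt0.
Qed.

(** One-sided: the fundamental theorem is applied from the face at [- L], where [f] vanishes, up to
    [t0]; the domain is then enlarged to the whole segment because [D] is nonnegative. *)
Lemma line_integral_ge f (D : R * R * R -> R) t0 : smooth_on setT f ->
  measurable_fun setT (fun t => D (gam t)) -> (forall p, 0 <= D p) ->
  (forall p, `|partial k f (point3 p)| <= D p) ->
  box3 L (gam t0) -> f (x + (- L) *: delta_mx 0 k) = 0 ->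
  ((f (point3 (gam t0)))%:E <= \int[mu1]_t ((D \_ (box3 L)) (gam t))%:E)%E.
Proof.
move=> sf mD D0 DD /(gam_box t0).1 [HP t0L] f0.
have E t := congr1 (fun F => F t) (line_patch D HP).
have -> : (\int[mu1]_t ((D \_ (box3 L)) (gam t))%:E
    = \int[mu1]_(t in `[(- L)%R, L]) (D (gam t))%:E)%E.
  rewrite [RHS]integral_mkcond; apply: eq_integral => t _.
  by rewrite E !patchE; case: ifP.
move: t0L; rewrite in_itv /= => /andP[]; rewrite le_eqVlt => /orP[/eqP <- _|Lt0 t0L].
  by rewrite gamE f0; apply: integral_ge0 => t _; rewrite lee_fin.
rewrite gamE -[f _]subr0 -f0 -line_integral//.
have mp : measurable_fun setT (fun t : R => partial k f (x + t *: delta_mx 0 k)).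
  apply: continuous_measurable_fun; apply: continuous_line.
  by apply: smooth_continuous; exact: smooth_on_partial.
apply: (@le_trans _ _ (\int[mu1]_(t in `[(- L)%R, t0]) (D (gam t))%:E)%E).
  apply: (@le_trans _ _ (\int[mu1]_(t in `[(- L)%R, t0]) (`|partial k f (x + t *: delta_mx 0 k)|)%:E)%E).
    apply: le_trans (lee_abs _) _; apply: le_abse_integral => //.
    by apply/measurable_EFinP; exact: measurable_funTS.
  apply: ge0_le_integral => //.
  - apply/measurable_EFinP; apply: measurable_funTS.
    exact: measurableT_comp.
  - by apply/measurable_EFinP; exact: measurable_funTS.
  - by move=> t _; rewrite lee_fin -gamE.
apply: ge0_subset_integral => //.
- by apply/measurable_EFinP; exact: measurable_funTS.
- by move=> t _; rewrite lee_fin.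
- by apply: subset_itvl; rewrite bnd_simp.
Qed.

End Lines.

Lemma integrable_bounded_support d (T : measurableType d) (R : realType)
    (mu : {measure set T -> \bar R}) (f : T -> R) (Q : set T) (M : R) :
  measurable Q -> (mu Q < +oo)%E -> measurable_fun setT f ->
  (forall x, `|f x| <= M * \1_Q x) -> mu.-integrable setT (EFin \o f).
Proof.
move=> mQ fQ mf fM.
have mI : mu.-integrable setT (fun q => (M%:E * (\1_Q q)%:E)%E).
  apply: integrableZl => //; apply/integrableP; split; first exact/measurable_EFinP.
  rewrite (eq_integral (fun x => (\1_Q x)%:E)); last first.
    by move=> t _; rewrite gee0_abs// lee_fin.
  by rewrite integral_indic// setIT.
apply: (le_integrable _ _ _ mI) => //.
- exact/measurable_EFinP.
- by move=> x _; rewrite !abse_EFin lee_fin; apply: le_trans (fM x) (ler_norm _).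
Qed.

Section BoxTheorems.
Variable R : realType.
Implicit Types (f g : 'rV[R]_3 -> R) (L : R).
Notation mu1 := (@lebesgue_measure R).
Notation mu2 := (sigma_finite_prod (@lebesgue_measure R) (@lebesgue_measure R)).
Notation o0 := (@Ordinal 3 0 isT).
Notation o1 := (@Ordinal 3 1 isT).
Notation o2 := (@Ordinal 3 2 isT).

Lemma point3_line0 (t y z : R) :
  point3 (t, y, z) = point3 (0, y, z) + t *: delta_mx 0 o0.
Proof.
apply/rowP => -[[|[|[|//]]] ?]; rewrite !mxE /= ?mulr1 ?mulr0 ?addr0 ?add0r//.
Qed.

Lemma point3_line1 (x t z : R) :
  point3 (x, t, z) = point3 (x, 0, z) + t *: delta_mx 0 o1.
Proof.
apply/rowP => -[[|[|[|//]]] ?]; rewrite !mxE /= ?mulr1 ?mulr0 ?addr0 ?add0r//.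
Qed.

Lemma point3_line2 (x y t : R) :
  point3 (x, y, t) = point3 (x, y, 0) + t *: delta_mx 0 o2.
Proof.
apply/rowP => -[[|[|[|//]]] ?]; rewrite !mxE /= ?mulr1 ?mulr0 ?addr0 ?add0r//.
Qed.

Lemma box_line0 L (y z t : R) :
  box3 L (t, y, z) <-> (y \in `[- L, L]%R /\ z \in `[- L, L]%R) /\ t \in `[- L, L]%R.
Proof. by split=> [[[/= ? ?] ?]|[[? ?] ?]]. Qed.

Lemma box_line1 L (x z t : R) :
  box3 L (x, t, z) <-> (x \in `[- L, L]%R /\ z \in `[- L, L]%R) /\ t \in `[- L, L]%R.
Proof. by split=> [[[/= ? ?] ?]|[[? ?] ?]]. Qed.

Lemma box_line2 L (x y t : R) :
  box3 L (x, y, t) <-> (x \in `[- L, L]%R /\ y \in `[- L, L]%R) /\ t \in `[- L, L]%R.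
Proof. by split=> [[[/= ? ?] ?]|[[? ?] ?]]. Qed.

Definition vanishes_at L f := forall x : 'rV[R]_3, (exists i, `|x 0 i| = L) -> f x = 0.

Lemma vanish_line L f (x : 'rV[R]_3) (k : 'I_3) : 0 < L -> vanishes_at L f -> x 0 k = 0 ->
  f (x + L *: delta_mx 0 k) = 0 /\ f (x + (- L) *: delta_mx 0 k) = 0.
Proof.
move=> L0 vf xk; split; apply: vf; exists k; rewrite !mxE xk !eqxx /= mulr1 add0r ?normrN;
  exact: gtr0_norm.
Qed.

Section Divergence.
Variables (L : R) (f : 'rV[R]_3 -> R) (k : 'I_3).
Hypotheses (L0 : 0 < L) (sf : smooth_on setT f) (vf : vanishes_at L f).
Let h := (fun p => partial k f (point3 p)) \_ (box3 L).

Let int_h : (volume3 R).-integrable setT (EFin \o h).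
Proof.
rewrite /h -restrict_EFin.
have H : (volume3 R).-integrable (box3 L) (EFin \o (fun p => partial k f (point3 p))).
  by apply: integrable_box3; apply: smooth_continuous; exact: smooth_on_partial.
by apply: (integrable_mkcond _ _).1 H; exact: measurable_box3.
Qed.

Let boxint_h : (boxint L (partial k f))%:E = (\int[volume3 R]_p (h p)%:E)%E.
Proof.
rewrite boxintE; last by apply: smooth_continuous; exact: smooth_on_partial.
by rewrite integral_mkcond; apply: eq_integral => p _; rewrite /h !patchE; case: ifP.
Qed.

(** A second use of Fubini's theorem on the slice needs integrability for every [z], whereas
    integrability on the product yields it for almost every [z]. Boundedness on a bounded square
    provides it. *)
Let int_hz z : mu2.-integrable setT (fun q : R * R => (h (q, z))%:E).
Proof.
pose Q : set (R * R) := `[- L, L] `*` `[- L, L].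
have mQ : measurable Q by apply: measurableX; exact: measurable_itv.
have cp : continuous (partial k f).
  by apply: smooth_continuous; exact: smooth_on_partial.
have [M HM] := bounded_box3 L cp.
have hM q : `|h (q, z)| <= Num.max M 0 * \1_Q q.
  rewrite /h patchE indicE; case: ifPn => [|_]; last first.
    by rewrite normr0 mulr_ge0// le_max lexx orbT.
  rewrite inE => qB; have qQ : Q q by case: qB.
  by rewrite mem_set// mulr1 le_max HM.
have mh : measurable_fun setT (fun q : R * R => h (q, z)).
  by apply: measurableT_comp (pair2_measurable z); exact: measurable_patch_box.
have fQ : (mu2 Q < +oo)%E.
  rewrite [X in (X < _)%E](@product_measure1E _ _ _ _ R mu1 mu1); try exact: measurable_itv.
  by rewrite /= lebesgue_measure_segment ?ge0_cp ?ltW// -EFinM ltry.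
exact: (integrable_bounded_support (mu := mu2) mQ fQ mh hM).
Qed.

(** In each of the three cases the order of integration is arranged so that the coordinate of
    direction [k] is innermost; that inner integral is a difference of values of [f] on two opposite
    faces. *)
Lemma boxint_partial : boxint L (partial k f) = 0.
Proof.
apply: EFin_inj; rewrite boxint_h.
have : k = o0 \/ k = o1 \/ k = o2.
  by case: k => -[|[|[|//]]] i3; [left|right; left|right; right]; exact: val_inj.
case=> [kE|[kE|kE]].
- transitivity (\int[mu1]_z \int[mu2]_q (h (q, z))%:E)%E.
    by apply/esym; exact: (integral21_prod_meas1 (m1 := mu2) int_h).
  apply: integral0_eq => z _.
  transitivity (\int[mu1]_y \int[mu1]_x (h (x, y, z))%:E)%E.
    by apply/esym; exact: (integral21_prod_meas1 (m1 := mu1) (int_hz z)).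
  apply: integral0_eq => y _.
  have [] := @vanish_line L f (point3 (0, y, z)) k L0 vf.
    by rewrite kE mxE.
  move=> f1 f2.
  apply: (@line_integral0 _ (point3 (0, y, z)) k L (fun t => (t, y, z)) _ _ _ _ f sf (fun=> f1) (fun=> f2)) => //.
    by move=> t; rewrite point3_line0 kE.
  by move=> t; exact: box_line0.
- transitivity (\int[mu1]_z \int[mu2]_q (h (q, z))%:E)%E.
    by apply/esym; exact: (integral21_prod_meas1 (m1 := mu2) int_h).
  apply: integral0_eq => z _.
  transitivity (\int[mu1]_x \int[mu1]_y (h (x, y, z))%:E)%E.
    by apply/esym; exact: (integral12_prod_meas1 (m1 := mu1) (int_hz z)).
  apply: integral0_eq => x _.
  have [] := @vanish_line L f (point3 (x, 0, z)) k L0 vf.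
    by rewrite kE mxE.
  move=> f1 f2.
  apply: (@line_integral0 _ (point3 (x, 0, z)) k L (fun t => (x, t, z)) _ _ _ _ f sf (fun=> f1) (fun=> f2)) => //.
    by move=> t; rewrite point3_line1 kE.
  by move=> t; exact: box_line1.
- transitivity (\int[mu2]_q \int[mu1]_z (h (q, z))%:E)%E.
    by apply/esym; exact: (integral12_prod_meas1 (m1 := mu2) int_h).
  apply: integral0_eq => -[x y] _.
  have [] := @vanish_line L f (point3 (x, y, 0)) k L0 vf.
    by rewrite kE mxE.
  move=> f1 f2.
  apply: (@line_integral0 _ (point3 (x, y, 0)) k L (fun t => (x, y, t)) _ _ _ _ f sf (fun=> f1) (fun=> f2)) => //.
    by move=> t; rewrite point3_line2 kE.
  by move=> t; exact: box_line2.
Qed.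

End Divergence.

End BoxTheorems.

(** * Ladyzhenskaya's inequality *)

Section BoxInequality.
Variable R : realType.
Notation mu1 := (@lebesgue_measure R).
Notation mu2 := (sigma_finite_prod (@lebesgue_measure R) (@lebesgue_measure R)).
Notation o0 := (@Ordinal 3 0 isT).
Notation o1 := (@Ordinal 3 1 isT).
Notation o2 := (@Ordinal 3 2 isT).
Variables (L : R) (g q : 'rV[R]_3 -> R).
Hypotheses (L0 : 0 < L) (sg : smooth_on setT g) (cq : continuous q)
  (g0 : forall x, 0 <= g x) (q0 : forall x, 0 <= q x) (vg : vanishes_at L g)
  (dg : forall k x, (partial k g x) ^+ 2 <= 4 * (g x * q x)).
Let D (x : 'rV[R]_3) : R := \sum_(k < 3) `|partial k g x|.

Let cg : continuous g. Proof. exact: smooth_continuous. Qed.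

Let cdg k : continuous (partial k g).
Proof. by apply: smooth_continuous; exact: smooth_on_partial. Qed.

Let cD : continuous D.
Proof.
have -> : D = (fun x => `|partial ord0 g x| + (`|partial (lift ord0 ord0) g x|
    + `|partial (lift ord0 (lift ord0 ord0)) g x|)).
  by apply/funext => x; rewrite /D !big_ord_recl big_ord0 addr0.
apply: continuous_funD; first exact: continuous_fun_norm.
by apply: continuous_funD; exact: continuous_fun_norm.
Qed.

(** Each partial derivative is at most [2 sqrt (g q)], which is [2 sqrt ((s g) (9 q / s)) / 3]; the
    9 is chosen so that the three of them add up to the right-hand side. *)
Let D_amgm (s : R) x : 0 < s -> D x <= s * g x + s^-1 * (9 * q x).
Proof.
move=> s0.
suff H k : `|partial k g x| <= (s * g x + s^-1 * (9 * q x)) / 3.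
  rewrite /D !big_ord_recl big_ord0.
  have := H ord0; have := H (lift ord0 ord0); have := H (lift ord0 (lift ord0 ord0)).
  move: (`|_|) (`|_|) (`|_|) (s * g x + _) => a b c d; lra.
set t := s * g x; set r := s^-1 * (9 * q x).
have t0 : 0 <= t by rewrite mulr_ge0// ltW.
have r0 : 0 <= r by rewrite !mulr_ge0// invr_ge0 ltW.
have E : g x * q x * 9 = t * r.
  by rewrite /t /r; field; rewrite gt_eqF.
rewrite -(@ler_pXn2r _ 2)// ?nnegrE// ?divr_ge0 ?addr_ge0// real_normK ?num_real//.
apply: le_trans (dg k x) _.
have {E} -> : g x * q x = t * r / 9 by rewrite -E mulfK.
move: t r t0 r0 => t r t0 r0.
have : 0 <= (t - r) ^+ 2 by exact: sqr_ge0.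
by rewrite !expr2; lra.
Qed.

(** Extension by zero, since [slice_inequality] lives on the whole space. As [g] vanishes on the
    faces, its truncation is still dominated by the line integrals of the truncated [D]. *)
Let pa (f : 'rV[R]_3 -> R) : R * R * R -> R := (fun p => f (point3 p)) \_ (@box3 R L).

Let pa_ge0 f : (forall x, 0 <= f x) -> forall p, (0 <= (pa f p)%:E)%E.
Proof. by move=> f0 p; rewrite lee_fin /pa patchE; case: ifP. Qed.

Let int_pa f : continuous f ->
  (\int[volume3 R]_p (pa f p)%:E)%E = (boxint L f)%:E.
Proof.
move=> cf; rewrite boxintE// [RHS]integral_mkcond; apply: eq_integral => p _.
by rewrite /pa !patchE; case: ifP.
Qed.

Let mpa f : continuous f -> measurable_fun [set: R * R * R] (fun p => (pa f p)%:E).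
Proof. by move=> cf; apply/measurable_EFinP; exact: measurable_patch_box. Qed.

Let D0 x : 0 <= D x. Proof. exact: sumr_ge0. Qed.

Let partial_le_D k x : `|partial k g x| <= D x.
Proof. by rewrite /D (bigD1 k)//= lerDl sumr_ge0. Qed.

Let pa_out f p : ~ box3 L p -> pa f p = 0.
Proof. by move=> nB; rewrite /pa patchE ifF//; apply/negbTE; rewrite notin_setE. Qed.

Let pa_in f p : box3 L p -> pa f p = f (point3 p).
Proof. by move=> Bp; rewrite /pa patchE mem_set. Qed.

Let mDline (gam : R -> R * R * R) (x : 'rV[R]_3) k :
  (forall t, point3 (gam t) = x + t *: delta_mx 0 k) ->
  measurable_fun setT (fun t => D (point3 (gam t))).
Proof.
move=> gE; apply: continuous_measurable_fun; under eq_fun do rewrite gE.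
exact: continuous_line.
Qed.

Let g_line (gam : R -> R * R * R) (x : 'rV[R]_3) k (P : Prop) t0 :
  (forall t, point3 (gam t) = x + t *: delta_mx 0 k) -> x 0 k = 0 ->
  (forall t, box3 L (gam t) <-> P /\ t \in `[- L, L]%R) ->
  ((pa g (gam t0))%:E <= \int[mu1]_t (pa D (gam t))%:E)%E.
Proof.
move=> gE xk gB; have [Bt|nB] := pselect (box3 L (gam t0)); last first.
  by rewrite pa_out//; apply: integral_ge0 => t _; exact: pa_ge0.
rewrite pa_in//.
have [_ f2] := vanish_line L0 vg xk.
apply: (@line_integral_ge _ x k L gam P gE gB g (fun p => D (point3 p)) t0) => //.
exact: mDline gE.
Qed.

Let box_slice_inequality (h : R) : 0 < h -> boxint L D <= h ->
  boxint L (fun x => g x * g x) <= 36 * h * boxint L q.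
Proof.
move=> h0 Dh.
have cgg := continuous_funM cg cg.
have cq9 := @continuous_funZ R 9 q cq.
have S := @slice_inequality _ _ _ _ _ _ R mu1 mu1 mu1
  (fun p => (pa g p)%:E) (fun p => (pa D p)%:E) (fun p => (pa (fun x => 9 * q x) p)%:E) h
  (mpa cg) (mpa cD) (mpa cq9) (pa_ge0 g0) (pa_ge0 D0).
have {}S := S (pa_ge0 (fun x => mulr_ge0 (ler0n _ 9) (q0 x))).
have {}S := S (fun x y z => @g_line (fun t => (t, y, z)) _ o0 _ x
  (fun t => point3_line0 t y z) ltac:(by rewrite mxE) (fun t => box_line0 L y z t)).
have {}S := S (fun x y z => @g_line (fun t => (x, t, z)) _ o1 _ y
  (fun t => point3_line1 x t z) ltac:(by rewrite mxE) (fun t => box_line1 L x z t)).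
have {}S := S (fun x y z => @g_line (fun t => (x, y, t)) _ o2 _ z
  (fun t => point3_line2 x y t) ltac:(by rewrite mxE) (fun t => box_line2 L x y t)).
have {}S : (\int[volume3 R]_p ((pa g p)%:E * (pa g p)%:E)
    <= (4 * h)%:E * \int[volume3 R]_p (pa (fun x => (9 * q x)%R) p)%:E)%E.
  apply: S => //.
  - move=> s s0 p; rewrite -!EFinM -EFinD lee_fin.
    have [Bp|nB] := pselect (box3 L p); last by rewrite !pa_out// !mulr0 addr0.
    by rewrite !pa_in//; exact: D_amgm.
  - have -> : (\int[mu2 \x mu1]_p (pa D p)%:E = (boxint L D)%:E)%E by exact: int_pa.
    by rewrite lee_fin.
move: S; rewrite int_pa// -EFinM.
have -> : (\int[volume3 R]_p ((pa g p)%:E * (pa g p)%:E)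
    = (boxint L (fun x => (g x * g x)%R))%:E)%E.
  rewrite -int_pa//; apply: eq_integral => p _; rewrite -EFinM; congr (_%:E).
  have [Bp|nB] := pselect (box3 L p); last by rewrite !pa_out// !mulr0.
  by rewrite !pa_in.
rewrite lee_fin boxintZ//; move/le_trans; apply.
by rewrite mulrA; apply: ler_wpM2r; [exact: boxint_ge0|lra].
Qed.

Lemma box_ladyzhenskaya (eps H : R) : 0 < eps -> 0 < H ->
  boxint L (fun x => g x + eps ^+ 2 * q x) <= H ->
  boxint L (fun x => g x * g x) <= 108 * (H ^+ 2 / eps ^+ 3).
Proof.
move=> e0 H0.
rewrite boxintD//; last exact: continuous_funZ.
rewrite boxintZ// => HH.
have Ig : 0 <= boxint L g by exact: boxint_ge0.
have Iq : 0 <= boxint L q by exact: boxint_ge0.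
(* With [s = 3 / eps] both terms of [D_amgm] become multiples of [g + eps ^+ 2 * q], whence the mass
   [3 H / eps]. The integral of [q] is at most [H / eps ^+ 2], and [108 = 36 * 3]. *)
have h0 : 0 < 3 * (H / eps) by rewrite mulr_gt0// divr_gt0.
have s0 : 0 < 3 / eps by rewrite divr_gt0.
apply: le_trans (box_slice_inequality h0 _) _.
  apply: (@le_trans _ _ (boxint L (fun x => 3 / eps * g x + (3 / eps)^-1 * (9 * q x)))).
    apply: boxint_le => //.
      by apply: continuous_funD; do ?apply: continuous_funZ.
    by move=> p _; exact: D_amgm.
  rewrite boxintD//; do ?[apply: continuous_funZ => //].
  rewrite !boxintZ//; last exact: continuous_funZ.
  have -> : 3 / eps * boxint L g + (3 / eps)^-1 * (9 * boxint L q)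
      = 3 * ((boxint L g + eps ^+ 2 * boxint L q) / eps).
    by field; rewrite gt_eqF.
  by rewrite ler_pM2l// ler_pM2r// invr_gt0.
have q1 : boxint L q <= H / eps ^+ 2.
  by rewrite ler_pdivlMr ?exprn_gt0// mulrC; apply: le_trans HH; rewrite lerDr.
apply: le_trans (ler_wpM2l _ q1) _; first by rewrite mulr_ge0// ltW.
suff -> : 36 * (3 * (H / eps)) * (H / eps ^+ 2) = 108 * (H ^+ 2 / eps ^+ 3) by [].
by field; rewrite gt_eqF.
Qed.

End BoxInequality.

(** * From vanishing integrals and derivatives to pointwise statements *)

Section Positivity.
Variable R : realType.
Implicit Types (f g : 'rV[R]_3 -> R) (L : R) (k j : 'I_3).

Lemma point3_surj (x : 'rV[R]_3) : exists p, point3 p = x.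
Proof.
exists (x 0 (@Ordinal 3 0 isT), x 0 (@Ordinal 3 1 isT), x 0 (@Ordinal 3 2 isT)).
by apply/rowP => -[[|[|[|//]]] i3]; rewrite mxE /=; congr (x _ _); exact: val_inj.
Qed.

(** If [f x] were positive, [f] would stay above [f x / 2] on a cube of side [d] around [x], and any
    box containing this cube would have integral at least [d^3 f x / 2]. *)
Lemma boxint_eq0 f : continuous f -> (forall x, 0 <= f x) ->
  (forall L, 0 < L -> boxint L f <= 0) -> forall x, f x = 0.
Proof.
move=> cf f0 If x; apply/eqP; rewrite eq_le f0 andbT leNgt; apply/negP => fx0.
have [p px] := point3_surj x.
have c20 : 0 < f x / 2 by rewrite divr_gt0.
have cfp : continuous (fun p => f (point3 p)).
  move=> r; by apply: (@continuous_comp _ _ _ (@point3 R) f);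
    [exact: point3_continuous|exact: cf].
have /nbhs_ballP[d /= d0 Hd] : nbhs p [set r | `|f (point3 p) - f (point3 r)| < f x / 2].
  have /cvgrPdist_lt := cfp p; exact.
pose M := `|p.1.1| + `|p.1.2| + `|p.2| + d.
have M0 : 0 < M by rewrite /M ltr_wpDl// !addr_ge0.
pose K : set (R * R * R) := (`[p.1.1 - d / 2, p.1.1 + d / 2] `*`
   `[p.1.2 - d / 2, p.1.2 + d / 2]) `*` `[p.2 - d / 2, p.2 + d / 2].
have mK : measurable K.
  by apply: measurableX; [apply: measurableX|]; exact: measurable_itv.
have inB (u v w r s : R) : 0 <= u -> 0 <= v -> `|s| = w ->
    r \in `[s - d / 2, s + d / 2]%R -> r \in `[- (u + v + w + d), (u + v + w + d)]%R.
  move=> u0 v0; rewrite !in_itv /= => ws /andP[].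
  have := ler_norm s; have := ler_norm (- s); rewrite normrN ws => h1 h2 h3 h4.
  by apply/andP; split; lra.
have KB : K `<=` box3 M.
  move=> [[r1 r2] r3] [[/= h1 h2] h3]; split; first split => /=.
  - have -> : M = `|p.1.2| + `|p.2| + `|p.1.1| + d by rewrite /M; lra.
    exact: inB h1.
  - have -> : M = `|p.1.1| + `|p.2| + `|p.1.2| + d by rewrite /M; lra.
    exact: inB h2.
  - exact: inB h3.
have fK r : K r -> f x / 2 <= f (point3 r).
  move=> Kr; have : ball p d r.
    case: r Kr => [[r1 r2] r3] [[/= h1 h2] h3].
    have B (s r : R) : r \in `[s - d / 2, s + d / 2]%R -> ball s d r.
      rewrite in_itv /= => /andP[? ?].
      by rewrite -ball_normE /ball_ /= ltr_norml; apply/andP; split; lra.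
    by split; [split|]; apply: B.
  by move/Hd => /=; rewrite px ltr_norml => /andP[]; lra.
have := If M M0; rewrite -lee_fin boxintE//; apply/negP; rewrite -ltNge.
have mf (A : set (R * R * R)) : measurable A -> measurable_fun A (EFin \o (fun r => f (point3 r))).
  by move=> mA; apply/measurable_EFinP; apply: measurable_funTS; exact: measurable_point3.
apply: (@lt_le_trans _ _ (\int[volume3 R]_(r in K) (f (point3 r))%:E)%E); last first.
  apply: ge0_subset_integral => //.
  - exact: measurable_box3.
  - by apply: mf; exact: measurable_box3.
  - by move=> r _; rewrite lee_fin.
apply: (@lt_le_trans _ _ (\int[volume3 R]_(r in K) (f x / 2)%:E)%E); last first.
  apply: ge0_le_integral => //.
  - by move=> r Kr; rewrite lee_fin ltW.
  - exact: mf.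
have -> : (\int[volume3 R]_(r in K) (f x / 2)%:E = (f x / 2)%:E * volume3 R K)%E.
  exact: integral_cst.
have E : volume3 R K = (d * d * d)%:E.
  rewrite /K volume3_prod; try exact: measurable_itv.
  have D (s : R) : s + d / 2 - (s - d / 2) = d by lra.
  by rewrite !lebesgue_measure_segment ?D//; lra.
by rewrite E -EFinM lte_fin !mulr_gt0.
Qed.

Lemma constant_of_partial0 f : smooth_on setT f -> (forall k x, partial k f x = 0) ->
  forall x y, f x = f y.
Proof.
move=> sf f0.
have st (x : 'rV[R]_3) k (t : R) : f (x + t *: delta_mx 0 k) = f x.
  have [->|t0] := eqVneq t 0; first by rewrite scale0r addr0.
  have [s _] := @partial_mvt _ f x k t t0 (fun s _ => smooth_on_derivable sf I).
  by rewrite f0 mulr0 => /eqP; rewrite subr_eq0 => /eqP.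
suff H x : f x = f 0 by move=> x y; rewrite !H.
have [[[a b] c] <-] := point3_surj x.
rewrite point3_line2 st point3_line1 st point3_line0 st; congr f.
by apply/rowP => -[[|[|[|//]]] ?]; rewrite !mxE.
Qed.

End Positivity.

(** * Small energy forces vanishing *)

Section Cutoff.
Variable R : realType.
Implicit Types (f g : 'rV[R]_3 -> R) (L : R) (k j : 'I_3).
Notation o0 := (@Ordinal 3 0 isT).
Notation o1 := (@Ordinal 3 1 isT).
Notation o2 := (@Ordinal 3 2 isT).

Lemma is_derive_coord k j (x : 'rV[R]_3) :
  is_derive x (delta_mx 0 j) (fun y : 'rV[R]_3 => y 0 k) ((j == k)%:R : R).
Proof.
have E : (h^-1 *: ((fun y : 'rV[R]_3 => y 0 k) (h *: delta_mx 0 j + x) - x 0 k))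
    @[h --> (0:R)^'] --> ((j == k)%:R : R).
  apply: cvg_near_cst; near=> h.
  have h0 : h != 0 by near: h; exact: nbhs_dnbhs_neq.
  rewrite !mxE eqxx /= addrK /GRing.scale /= mulrA mulVf// mul1r.
  by rewrite eq_sym.
apply: DeriveDef; first by apply/cvg_ex; eexists; exact: E.
exact: cvg_lim E.
Unshelve. all: by end_near. Qed.

Lemma partial_coord k j (x : 'rV[R]_3) : partial j (fun y : 'rV[R]_3 => y 0 k) x = (j == k)%:R.
Proof. by have [_] := is_derive_coord k j x. Qed.

Lemma smooth_coord k : smooth_on setT (fun y : 'rV[R]_3 => y 0 k).
Proof.
case=> [|n]; split=> //; try by move=> x _; exact: coord_continuous.
move=> j; split=> [x _|]; first by have [] := is_derive_coord k j x.
by apply: (Ck_on_eq openT) (Ck_on_cst n ((j == k)%:R) openT) => x _; rewrite partial_coord.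
Qed.

Let w L k (x : 'rV[R]_3) : R := 1 - L^-2 * (x 0 k * x 0 k).

(** A polynomial in place of a bump function: it is zero on the faces and has slope of order [1 / L]
    inside, which suffices because every integral is taken over the box. *)
Definition cutoff L (x : 'rV[R]_3) : R := w L o0 x * (w L o1 x * w L o2 x).

Let smooth_w L k : smooth_on setT (w L k).
Proof.
apply: smooth_onB (openT) (smooth_on_cst _ openT) _.
apply: smooth_onM (openT) (smooth_on_cst _ openT) _.
by apply: smooth_onM; [exact: openT|exact: smooth_coord|exact: smooth_coord].
Qed.

Lemma smooth_cutoff L : smooth_on setT (cutoff L).
Proof. by do 2?apply: smooth_onM; do ?exact: openT; exact: smooth_w. Qed.

Let partial_w L k j x : partial j (w L k) x = - (2 * L^-2 * x 0 k) * (j == k)%:R.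
Proof.
have sxx := smooth_onM openT (smooth_coord k) (smooth_coord k).
have sc := smooth_on_cst (L^-2) (@openT 'rV[R]_3).
have sm := smooth_onM openT sc sxx.
rewrite /w (partialD j (smooth_on_cst _ openT) (smooth_onN openT sm) I).
rewrite partial_cst (partialN j sm I) (partialM j sc sxx I) partial_cst.
rewrite (partialM j (smooth_coord k) (smooth_coord k) I) !partial_coord; ring.
Qed.

Lemma cutoff_vanish L : 0 < L -> vanishes_at L (cutoff L).
Proof.
move=> L0 x [i xi].
have w0 : w L i x = 0.
  have xx : x 0 i * x 0 i = L ^+ 2 by rewrite -xi real_normK ?num_real// expr2.
  by rewrite /w xx mulVf ?subrr// expf_neq0// gt_eqF.
rewrite /cutoff; have : i = o0 \/ i = o1 \/ i = o2.
  by case: i {xi w0} => -[|[|[|//]]] i3; [left|right; left|right; right]; exact: val_inj.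
by case=> [iE|[iE|iE]]; rewrite -iE w0 ?mul0r ?mulr0.
Qed.

Let w_box L k p : 0 < L -> box3 L p -> 0 <= w L k (point3 p) <= 1.
Proof.
move=> L0 Bp.
have : `|point3 p 0 k| <= L.
  rewrite mxE; case: p Bp => [[x y] z] [[/= + +] +]; rewrite !in_itv /= -!ler_norml.
  by case: k => -[|[|[|//]]].
move=> xk; rewrite /w; set t := point3 p 0 k in xk *.
have : t * t <= L ^+ 2.
  by rewrite -expr2 -real_normK ?num_real// ler_pXn2r// nnegrE// ltW.
have L2 : 0 < L ^+ 2 by rewrite exprn_gt0.
move=> tL; have t0 : 0 <= t * t by rewrite -expr2 sqr_ge0.
have h0 : 0 <= L^-2 * (t * t) by rewrite mulr_ge0// invr_ge0 ltW.
have h1 : L^-2 * (t * t) <= 1 by rewrite mulrC ler_pdivrMr// mul1r.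
by apply/andP; split; lra.
Qed.

Lemma partial_cutoff_box L k p : 0 < L -> box3 L p ->
  (partial k (cutoff L) (point3 p)) ^+ 2 <= 4 * L^-2.
Proof.
move=> L0 Bp; have /andP[a0 a1] := w_box o0 L0 Bp.
have /andP[b0 b1] := w_box o1 L0 Bp; have /andP[c0 c1] := w_box o2 L0 Bp.
have L2 : 0 < L ^+ 2 by rewrite exprn_gt0.
have dw i : (2 * L^-2 * point3 p 0 i) ^+ 2 <= 4 * L^-2.
  have : `|point3 p 0 i| <= L.
    rewrite mxE; case: p Bp {a0 a1 b0 b1 c0 c1} => [[x y] z] [[/= + +] +]; rewrite !in_itv /= -!ler_norml.
    by case: i => -[|[|[|//]]].
  set t := point3 p 0 i => tL.
  have tt : t ^+ 2 <= L ^+ 2 by rewrite -real_normK ?num_real// ler_pXn2r// nnegrE// ltW.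
  have -> : (2 * L^-2 * t) ^+ 2 = 4 * L^-2 * (L^-2 * t ^+ 2) by ring.
  have h1 : L^-2 * t ^+ 2 <= 1 by rewrite mulrC ler_pdivrMr// mul1r.
  by apply: ler_piMr => //; rewrite mulr_ge0// invr_ge0 ltW.
rewrite /cutoff (partialM k (@smooth_w L o0)
  (smooth_onM openT (@smooth_w L o1) (@smooth_w L o2)) I).
rewrite (partialM k (@smooth_w L o1) (@smooth_w L o2) I) !partial_w.
have shrink (a b c : R) : a ^+ 2 <= 4 * L^-2 -> 0 <= b <= 1 -> 0 <= c <= 1 ->
    (a * (b * c)) ^+ 2 <= 4 * L^-2.
  move=> ha /andP[hb0 hb1] /andP[hc0 hc1]; rewrite exprMn; apply: le_trans ha.
  by rewrite ler_piMr ?sqr_ge0// exprn_ile1// ?mulr_ge0// mulr_ile1.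
have : k = o0 \/ k = o1 \/ k = o2.
  by case: k => -[|[|[|//]]] i3; [left|right; left|right; right]; exact: val_inj.
move: dw; move: (point3 p) a0 a1 b0 b1 c0 c1 => x a0 a1 b0 b1 c0 c1 dw.
case=> [->|[->|->]] /=; rewrite !(mulr0, mulr1, mul0r, add0r, addr0).
- by rewrite mulNr sqrrN; apply: shrink => //; apply/andP.
- rewrite (_ : w L o0 x * _ = - ((2 * L^-2 * x 0 o1) * (w L o0 x * w L o2 x))); last ring.
  by rewrite sqrrN; apply: shrink => //; apply/andP.
- rewrite (_ : w L o0 x * _ = - ((2 * L^-2 * x 0 o2) * (w L o0 x * w L o1 x))); last ring.
  by rewrite sqrrN; apply: shrink => //; apply/andP.
Qed.

(** Each factor is at least 3/4 when its coordinate is at most [L / 2] in absolute value, and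
    [(27 / 64)^2] exceeds [1 / 16]. *)
Lemma cutoff_half L M p : 0 < L -> 2 * M <= L -> box3 M p ->
  1 <= 16 * (cutoff L (point3 p)) ^+ 2.
Proof.
move=> L0 ML Bp.
have wl k : 3 / 4 <= w L k (point3 p).
  have : `|point3 p 0 k| <= M.
    rewrite mxE; case: p Bp => [[x y] z] [[/= + +] +]; rewrite !in_itv /= -!ler_norml.
    by case: k => -[|[|[|//]]].
  rewrite /w; set t := point3 p 0 k => tM.
  have L2 : 0 < L ^+ 2 by rewrite exprn_gt0.
  have M0 : 0 <= M by apply: le_trans tM.
  have : (2 * t) ^+ 2 <= L ^+ 2.
    rewrite -[leLHS]real_normK ?num_real// ler_pXn2r// ?nnegrE ?(ltW L0)//.
    by apply: le_trans ML; rewrite normrM ger0_norm// ler_pM2l.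
  move=> tt; have iL : 0 < L^-2 by rewrite invr_gt0.
  have : L^-2 * (2 * t) ^+ 2 <= 1 by rewrite mulrC ler_pdivrMr// mul1r.
  have -> : L^-2 * (2 * t) ^+ 2 = 4 * (L^-2 * (t * t)) by ring.
  lra.
have c1 : 27 / 64 <= cutoff L (point3 p).
  have := wl o0; have := wl o1; have := wl o2; rewrite /cutoff.
  move: (w L _ _) (w L _ _) (w L _ _) => a b c ha hb hc.
  have bc : 9 / 16 <= b * c.
    have -> : 9 / 16 = 3 / 4 * (3 / 4) :> R by field.
    by apply: ler_pM => //; lra.
  have -> : 27 / 64 = 3 / 4 * (9 / 16) :> R by field.
  by apply: ler_pM => //; lra.
move: c1; move: (cutoff L _) => c c1.
have : 27 / 64 * (27 / 64) <= c * c by apply: ler_pM => //; lra.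
by rewrite expr2; lra.
Qed.

End Cutoff.

(** * The absorption argument for abstract densities *)

Section SmallEnergy.
Variable R : realType.
Implicit Types (L s : R) (k : 'I_3) (x : 'rV[R]_3).
Variables (a e N hh cub : 'rV[R]_3 -> R) (W : 'I_3 -> 'rV[R]_3 -> R).
Variables (eps C0 tau K E : R).
Hypotheses (eps0 : 0 < eps) (C0_gt0 : 0 < C0) (tau0 : 0 < tau) (K0 : 0 <= K)
  (E0 : 0 <= E) (small : 1308 * (C0 * tau) <= 1).
Hypotheses (sa : smooth_on setT a) (sW : forall k, smooth_on setT (W k)).
Hypotheses (ce : continuous e) (cN : continuous N) (chh : continuous hh)
  (ccub : continuous cub).
Hypotheses (a0 : forall x, 0 <= a x) (ae : forall x, a x <= e x)
  (aN : forall x, a x <= N x) (hh0 : forall x, 0 <= hh x).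
Hypothesis Ndiv : forall x, N x <= cub x + \sum_(k < 3) partial k (W k) x.
Hypothesis cub_le : forall s x, 0 < s -> cub x <= C0 * (s^-1 * hh x + s * (a x * a x)).
Hypothesis W_le : forall k x, (W k x) ^+ 2 <= K * (e x * N x).
Hypothesis da_le : forall k x, eps ^+ 2 * (partial k a x) ^+ 2 <= 4 * (a x * N x).
Hypothesis int_e : forall L, 0 < L -> boxint L e <= E.
Hypothesis int_hh : forall L, 0 < L -> boxint L hh <= tau ^+ 2 * eps ^+ 3.

Let N0 x : 0 <= N x. Proof. exact: le_trans (a0 x) (aN x). Qed.
Let e0 x : 0 <= e x. Proof. exact: le_trans (a0 x) (ae x). Qed.

(* 109 = 1 + 108, where 108 is the constant of [box_ladyzhenskaya]. *)
Let small12 : C0 * tau * 109 <= 12^-1.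
Proof. by move: small; move: (C0 * tau) => z; lra. Qed.

Section OnBox.
Variable L : R.
Hypothesis L1 : 1 <= L.
Let L0 : 0 < L. Proof. exact: lt_le_trans L1. Qed.
Let eta := cutoff L.
Let seta : smooth_on setT eta. Proof. exact: smooth_cutoff. Qed.
Let ceta : continuous eta. Proof. exact: smooth_continuous. Qed.
Let ca : continuous a. Proof. exact: smooth_continuous. Qed.
Let iL0 : 0 <= L^-2. Proof. by rewrite invr_ge0 exprn_ge0// ltW. Qed.

Let sq x := eta x * eta x.
Let ssq : smooth_on setT sq. Proof. exact: (smooth_onM openT seta seta). Qed.
Let csq : continuous sq. Proof. exact: smooth_continuous. Qed.
Let sq0 x : 0 <= sq x. Proof. by rewrite /sq -expr2 sqr_ge0. Qed.
Let dsq k x : partial k sq x = 2 * (eta x * partial k eta x).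
Proof. by rewrite /sq (partialM k seta seta I); ring. Qed.

Let n := boxint L (fun x => sq x * N x).

Let n0 : 0 <= n. Proof. by apply: boxint_ge0 => p _; rewrite mulr_ge0. Qed.

Let sum3_continuous (F : 'I_3 -> 'rV[R]_3 -> R) : (forall k, continuous (F k)) ->
  continuous (fun x => \sum_(k < 3) F k x : R).
Proof.
move=> cF.
have -> : (fun x => \sum_(k < 3) F k x : R)
    = (fun x => F ord0 x + (F (lift ord0 ord0) x + F (lift ord0 (lift ord0 ord0)) x)).
  by apply/funext => x; rewrite !big_ord_recl big_ord0 addr0.
by apply: continuous_funD => //; apply: continuous_funD.
Qed.

Let boxint_sum (F : 'I_3 -> 'rV[R]_3 -> R) : (forall k, continuous (F k)) ->
  boxint L (fun x => \sum_(k < 3) F k x) = \sum_(k < 3) boxint L (F k).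
Proof.
move=> cF.
have -> : (fun x => \sum_(k < 3) F k x : R)
    = (fun x => F ord0 x + (F (lift ord0 ord0) x + F (lift ord0 (lift ord0 ord0)) x)).
  by apply/funext => x; rewrite !big_ord_recl big_ord0 addr0.
rewrite boxintD//; last exact: continuous_funD.
by rewrite boxintD// !big_ord_recl big_ord0 addr0.
Qed.

Let deta x := \sum_(k < 3) partial k eta x * partial k eta x.

Let cdeta : continuous deta.
Proof.
apply: sum3_continuous => k; apply: continuous_funM; apply: smooth_continuous;
  exact: smooth_on_partial.
Qed.

Let deta_ge k x : partial k eta x * partial k eta x <= deta x.
Proof. by rewrite /deta (bigD1 k)//= lerDl sumr_ge0// => j _; rewrite -expr2 sqr_ge0. Qed.

Let deta0 x : 0 <= deta x.
Proof. by apply: sumr_ge0 => j _; rewrite -expr2 sqr_ge0. Qed.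

Let deta_box p : box3 L p -> deta (point3 p) <= 12 * L^-2.
Proof.
move=> Bp; have H k : partial k eta (point3 p) * partial k eta (point3 p) <= 4 * L^-2.
  by rewrite -expr2; exact: partial_cutoff_box.
apply: le_trans (ler_sum _ (fun k _ => H k)) _.
by rewrite sumr_const card_ord (_ : _ *+ 3 = 12 * L^-2)//; ring.
Qed.

(* Integrating [div (eta^2 W)] gives zero, so the divergence costs only the
   cross terms [2 eta (d eta) W], half of which is absorbed by [eta^2 N]. *)
Let div_term : boxint L (fun x => sq x * \sum_(k < 3) partial k (W k) x)
  <= n / 2 + 72 * K * E * L^-2.
Proof.
pose cross k x := 2 * (eta x * partial k eta x) * W k x.
have ccross k : continuous (cross k).
  apply: continuous_funM; last exact: smooth_continuous.
  apply: continuous_funZ; apply: continuous_funM => //.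
  by apply: smooth_continuous; exact: smooth_on_partial.
have cdW k : continuous (fun x => sq x * partial k (W k) x).
  by apply: continuous_funM => //; apply: smooth_continuous; exact: smooth_on_partial.
have E1 : (fun x => sq x * \sum_(k < 3) partial k (W k) x)
    = (fun x => \sum_(k < 3) sq x * partial k (W k) x).
  by apply/funext => x; rewrite mulr_sumr.
rewrite E1 boxint_sum//.
have Hk k : boxint L (fun x => sq x * partial k (W k) x) <= n / 6 + 24 * K * E * L^-2.
  have sqW := smooth_onM openT ssq (sW k).
  have H : boxint L (partial k (fun x => sq x * W k x)) = 0.
    apply: boxint_partial => // x xL.
    by rewrite /sq /eta (cutoff_vanish L0 xL) !mul0r.
  have E2 : partial k (fun x => sq x * W k x) = (fun x => cross k x + sq x * partial k (W k) x).
    by apply/funext => x; rewrite (partialM k ssq (sW k) I) dsq.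
  move: H; rewrite E2 boxintD// => /eqP; rewrite addrC addr_eq0 => /eqP ->.
  rewrite -mulN1r -boxintZ//.
  have c1 : continuous (fun x => 6^-1 * (sq x * N x)).
    by apply: continuous_funZ; exact: continuous_funM.
  have c2 : continuous (fun x => (24 * K * L^-2) * e x) by exact: continuous_funZ.
  apply: (@le_trans _ _ (boxint L (fun x => 6^-1 * (sq x * N x) + (24 * K * L^-2) * e x))).
    apply: boxint_le => //; first exact: continuous_funZ.
      exact: continuous_funD.
    move=> p Bp.
    have := partial_cutoff_box k L0 Bp; have := W_le k (point3 p).
    have := N0 (point3 p); have := e0 (point3 p); rewrite /cross /sq -/eta.
    move: (eta _) (partial k eta _) (W k _) (N _) (e _) => t d v m u u0 m0 vm dL.
    apply: (@le_trans _ _ `|2 * (t * d) * v|); first by rewrite mulN1r -normrN ler_norm.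
    have X0 : 0 <= t * t * m by rewrite mulr_ge0// -expr2 sqr_ge0.
    have Y0 : 0 <= K * u * (4 * L^-2) by rewrite !mulr_ge0.
    (* Young's inequality [2 sqrt (X Y) <= X / 6 + 6 Y] with [X] the weighted [N] and
       [Y = 4 K e / L^2]; the weight 1/6 makes three components cost exactly half of [n]. *)
    apply: (@le_trans _ _ (6^-1 * (t * t * m) + 6 * (K * u * (4 * L^-2)))); last lra.
    have XY0 : 0 <= 6^-1 * (t * t * m) + 6 * (K * u * (4 * L^-2)).
      by apply: addr_ge0; apply: mulr_ge0 => //; rewrite invr_ge0.
    rewrite -(@ler_pXn2r _ 2)// ?nnegrE//.
    rewrite real_normK ?num_real//.
    apply: (@le_trans _ _ (4 * (t * t * m) * (K * u * (4 * L^-2)))).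
      have -> : (2 * (t * d) * v) ^+ 2 = 4 * (t * t) * (v ^+ 2 * d ^+ 2) by ring.
      have -> : 4 * (t * t * m) * (K * u * (4 * L^-2))
              = 4 * (t * t) * (K * (u * m) * (4 * L^-2)) by ring.
      apply: ler_wpM2l; first by rewrite mulr_ge0// -expr2 sqr_ge0.
      by apply: ler_pM => //; exact: sqr_ge0.
    move: (t * t * m) (K * u * (4 * L^-2)) => X Y.
    have : 0 <= (6^-1 * X - 6 * Y) ^+ 2 by exact: sqr_ge0.
    by rewrite !expr2; lra.
  rewrite boxintD// !boxintZ//; last exact: continuous_funM.
  rewrite -/n; have := int_e L0 => eE.
  have : 24 * K * L^-2 * boxint L e <= 24 * K * L^-2 * E.
    by apply: ler_wpM2l => //; rewrite !mulr_ge0.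
  by lra.
rewrite !big_ord_recl big_ord0.
have := Hk ord0; have := Hk (lift ord0 ord0); have := Hk (lift ord0 (lift ord0 ord0)).
move: (boxint _ _) (boxint _ _) (boxint _ _) => u v w; lra.
Qed.

Let eps2 : 0 <= eps ^+ 2. Proof. exact: sqr_ge0. Qed.

Let rest0 : 0 <= 3 * n + 24 * eps ^+ 2 * E * L^-2.
Proof.
apply: addr_ge0; first exact: mulr_ge0.
by apply: mulr_ge0 => //; apply: mulr_ge0 => //; exact: mulr_ge0.
Qed.

(** The first two terms bound the integral of [g + eps ^+ 2 * q] for the [g] and [q] to which
    Ladyzhenskaya's inequality is applied below. The last one makes [H] strictly positive, since [s]
    is a quotient by [H]. *)
Let H := 3 * n + 24 * eps ^+ 2 * E * L^-2 + L^-2.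

Let cub_term : boxint L (fun x => sq x * cub x) <= C0 * tau * 109 * H.
Proof.
have L2 : 0 < L^-2 by rewrite invr_gt0 exprn_gt0.
have H0 : 0 < H by rewrite /H ltr_wpDl.
pose g x := sq x * a x.
(* Dictated by [dg]: by [(v + w)^2 <= 2 v^2 + 2 w^2], the derivative of [eta^2 a] splits into a part
   with the derivative of [eta] and a part controlled by [da_le], each a multiple of [g]. *)
pose q x := 2 * (deta x * a x + eps^-2 * (sq x * N x)).
have sg : smooth_on setT g := smooth_onM openT ssq sa.
have g0 x : 0 <= g x by rewrite mulr_ge0.
have ie0 : 0 <= eps^-2 by rewrite invr_ge0 exprn_ge0// ltW.
have cdeta_a : continuous (fun x => deta x * a x) by exact: continuous_funM.
have csqN : continuous (fun x => sq x * N x) by exact: continuous_funM.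
have csqN' : continuous (fun x => eps^-2 * (sq x * N x)) by exact: continuous_funZ.
have cq : continuous q by apply: continuous_funZ; exact: continuous_funD.
have q0 x : 0 <= q x by rewrite mulr_ge0// addr_ge0// mulr_ge0// mulr_ge0.
have vg : vanishes_at L g.
  by move=> x xL; rewrite /g /sq /eta (cutoff_vanish L0 xL) !mul0r.
have dg k x : (partial k g x) ^+ 2 <= 4 * (g x * q x).
  rewrite /g (partialM k ssq sa I) dsq /q /sq.
  have := da_le k x; have := deta_ge k x; have := a0 x; have := N0 x.
  move: (eta x) (partial k eta x) (partial k a x) (a x) (N x) (deta x) => t d b u m D m0 u0 dD bm.
  have bm' : b ^+ 2 <= 4 * (u * (eps^-2 * m)).
    have e2 : 0 < eps ^+ 2 by rewrite exprn_gt0.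
    rewrite -(ler_pM2l e2); apply: le_trans bm _.
    by rewrite (_ : eps ^+ 2 * _ = 4 * (u * m))//; field; rewrite gt_eqF.
  apply: (@le_trans _ _ (2 * (2 * (t * d) * u) ^+ 2 + 2 * (t * t * b) ^+ 2)).
    have : 0 <= (2 * (t * d) * u - t * t * b) ^+ 2 by exact: sqr_ge0.
    by rewrite !expr2; lra.
  have h1 : t * t * (u * u) * (d * d) <= t * t * (u * u) * D.
    by apply: ler_wpM2l => //; rewrite mulr_ge0// -expr2 sqr_ge0.
  have h2 : t * t * (t * t) * b ^+ 2 <= t * t * (t * t) * (4 * (u * (eps^-2 * m))).
    by apply: ler_wpM2l => //; rewrite mulr_ge0// -expr2 sqr_ge0.
  by move: h1 h2; rewrite !expr2; lra.
have Iq : boxint L (fun x => g x + eps ^+ 2 * q x) <= H.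
  rewrite boxintD//; [|exact: smooth_continuous|exact: continuous_funZ].
  rewrite boxintZ// boxintZ; last exact: continuous_funD.
  rewrite boxintD// boxintZ// -/n.
  have i1 : boxint L g <= n.
    apply: boxint_le => //; first exact: smooth_continuous.
    by move=> p _; rewrite /g ler_wpM2l.
  have i2 : boxint L (fun x => deta x * a x) <= 12 * L^-2 * E.
    apply: (@le_trans _ _ (boxint L (fun x => 12 * L^-2 * e x))).
      apply: boxint_le => //; first exact: continuous_funZ.
      by move=> p Bp; apply: ler_pM => //; exact: deta_box.
    by rewrite boxintZ//; apply: ler_wpM2l; [rewrite mulr_ge0|exact: int_e].
  rewrite (_ : eps ^+ 2 * _ = 2 * (eps ^+ 2 * boxint L (fun x => deta x * a x)) + 2 * n); last first.
    by field; rewrite gt_eqF.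
  have i3 : eps ^+ 2 * boxint L (fun x => deta x * a x) <= eps ^+ 2 * (12 * L^-2 * E).
    exact: ler_wpM2l.
  move: i1 i3; rewrite /H; move: (boxint L g) (boxint L (fun x => deta x * a x)) => u v; lra.
have lad := box_ladyzhenskaya L0 sg cq g0 q0 vg dg eps0 H0 Iq.
(* This value balances the two terms: [tau^2 eps^3 / s] equals [tau H], and [108 s H^2 / eps^3]
   equals [108 tau H]. The outcome is linear in [H]. *)
pose s := eps ^+ 3 * tau / H.
have e3 : 0 < eps ^+ 3 by rewrite exprn_gt0.
have s0 : 0 < s by rewrite divr_gt0// mulr_gt0.
have cgg : continuous (fun x => g x * g x).
  by apply: continuous_funM; exact: smooth_continuous.
have c1 : continuous (fun x => s^-1 * hh x) by exact: continuous_funZ.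
have c2 : continuous (fun x => s * (g x * g x)) by exact: continuous_funZ.
apply: (@le_trans _ _ (boxint L (fun x => C0 * (s^-1 * hh x + s * (g x * g x))))).
  apply: boxint_le => //; first exact: continuous_funM.
    by apply: continuous_funZ; exact: continuous_funD.
  move=> p _; rewrite /g.
  have [->|sqn] := eqVneq (sq (point3 p)) 0.
    by rewrite !mul0r mulr0 addr0 !mulr_ge0// ?invr_ge0 ltW.
  have sqp : 0 < sq (point3 p) by rewrite lt_neqAle eq_sym sqn sq0.
  (* The parameter of [cub_le] may vary with the point. Taking it proportional to [eta^2] cancels
     the weight in front of [hh] and puts [eta^4] in front of [a^2], as Ladyzhenskaya's inequality
     requires. *)
  have := @cub_le (s * sq (point3 p)) (point3 p) (mulr_gt0 s0 sqp).
  rewrite -(ler_pM2l sqp) => /le_trans; apply.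
  rewrite (_ : sq _ * (C0 * _) = C0 * (s^-1 * hh (point3 p)
    + s * (sq (point3 p) * a (point3 p) * (sq (point3 p) * a (point3 p))))) //.
  by field; rewrite sqn gt_eqF.
rewrite boxintZ; last exact: continuous_funD.
rewrite boxintD// !boxintZ//.
have h1 : s^-1 * boxint L hh <= tau * H.
  apply: (@le_trans _ _ (s^-1 * (tau ^+ 2 * eps ^+ 3))).
    by apply: ler_wpM2l; [rewrite invr_ge0 ltW|exact: int_hh].
  rewrite (_ : s^-1 * _ = tau * H)// /s; field.
  by rewrite !gt_eqF.
have h2 : s * boxint L (fun x => g x * g x) <= 108 * (tau * H).
  apply: (@le_trans _ _ (s * (108 * (H ^+ 2 / eps ^+ 3)))).
    by apply: ler_wpM2l; [exact: ltW|].
  rewrite (_ : s * _ = 108 * (tau * H))// /s; field.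
  by rewrite !gt_eqF.
apply: (@le_trans _ _ (C0 * (tau * H + 108 * (tau * H)))).
  by apply: ler_wpM2l; [exact: ltW|exact: lerD].
lra.
Qed.

(** The cubic term contributes at most [3 n / 12] and the divergence [n / 2]; the quarter of [n]
    left over explains the factor 4. All other terms carry [L^-2], weakened to [L^-1] by
    [1 <= L]. *)
Lemma cutoff_energy_le :
  boxint L (fun x => cutoff L x ^+ 2 * N x) <= (4 * (72 * K * E + 2 * eps ^+ 2 * E + 1)) / L.
Proof.
have -> : (fun x => cutoff L x ^+ 2 * N x) = (fun x => sq x * N x).
  by apply/funext => x; rewrite expr2.
rewrite -/n.
have cdiv : continuous (fun x => \sum_(k < 3) partial k (W k) x : R).
  by apply: sum3_continuous => k; apply: smooth_continuous; exact: smooth_on_partial.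
have : n <= boxint L (fun x => sq x * cub x)
    + boxint L (fun x => sq x * \sum_(k < 3) partial k (W k) x).
  rewrite -boxintD; try exact: continuous_funM.
  apply: boxint_le; first exact: continuous_funM.
    by apply: continuous_funD; exact: continuous_funM.
  by move=> p _; rewrite -mulrDr ler_wpM2l.
move: cub_term div_term; rewrite /H => c1 c2 c3.
have Hp : 0 <= 3 * n + 24 * eps ^+ 2 * E * L^-2 + L^-2.
  exact: addr_ge0.
have c4 : C0 * tau * 109 * (3 * n + 24 * eps ^+ 2 * E * L^-2 + L^-2)
    <= 12^-1 * (3 * n + 24 * eps ^+ 2 * E * L^-2 + L^-2).
  exact: ler_wpM2r.
have LL : L^-2 <= L^-1 by rewrite lef_pV2 ?posrE ?exprn_gt0// expr2 ler_peMl// ltW.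
have Kc : (72 * K * E + 2 * eps ^+ 2 * E + 1) * L^-2
    <= (72 * K * E + 2 * eps ^+ 2 * E + 1) * L^-1.
  apply: ler_wpM2l => //; apply: addr_ge0 => //; apply: addr_ge0.
    by apply: mulr_ge0 => //; exact: mulr_ge0.
  by apply: mulr_ge0 => //; exact: mulr_ge0.
move: c1 c2 c3 c4 Kc iL0 => c1 c2 c3 c4.
have {c1 c4}c1 := le_trans c1 c4.
move: c1 c2 c3; move: (boxint L _) (boxint L _) n (L^-2) (L^-1) => b1 b2 m l l'.
by move: (K * E) (eps ^+ 2 * E) => u v; rewrite -!(mulrA _ K E) -!(mulrA _ (eps ^+ 2) E); lra.
Qed.

End OnBox.

(** Stated for abstract densities because it serves twice: for [coercive], and, with [a], [hh] and
    [cub] zero, as a Caccioppoli estimate for harmonic functions. *)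
Lemma small_energy_vanishing x : N x = 0.
Proof.
apply: boxint_eq0 => // M M0; apply/ler_addgt0Pr => r r0; rewrite add0r.
set B := 4 * (72 * K * E + 2 * eps ^+ 2 * E + 1).
(* The summands give in turn [1 <= L], a box of half-side [M] on which [16 * cutoff L ^+ 2] is at
   least 1, and an error [16 * B / L] of at most [r]. *)
pose L := 1 + 2 * M + 16 * `|B| / r.
have B0 : 0 <= 16 * `|B| / r by rewrite divr_ge0 ?mulr_ge0// ltW.
have L1 : 1 <= L by rewrite /L; lra.
have L0 : 0 < L by exact: lt_le_trans L1.
have cc : continuous (cutoff L) by apply: smooth_continuous; exact: smooth_cutoff.
have cN' : continuous (fun x => cutoff L x ^+ 2 * N x).
  by under eq_fun do rewrite expr2; apply: continuous_funM => //; exact: continuous_funM.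
have c16 : continuous (fun x => 16 * (cutoff L x ^+ 2 * N x)) by exact: continuous_funZ.
apply: (@le_trans _ _ (boxint M (fun x => 16 * (cutoff L x ^+ 2 * N x)))).
  apply: boxint_le => // p Bp; rewrite mulrA.
  by apply: ler_peMl => //; apply: (cutoff_half L0 _ Bp); rewrite /L; lra.
apply: (@le_trans _ _ (boxint L (fun x => 16 * (cutoff L x ^+ 2 * N x)))).
  apply: boxint_subset => //; first by rewrite /L; lra.
  by move=> y; apply: mulr_ge0 => //; apply: mulr_ge0 => //; exact: sqr_ge0.
rewrite boxintZ//.
apply: (@le_trans _ _ (16 * (B / L))); first by apply: ler_wpM2l => //; exact: cutoff_energy_le.
rewrite mulrA ler_pdivrMr//.
have : 16 * `|B| <= r * L.
  by rewrite -ler_pdivrMl// mulrC /L lerDr; lra.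
by apply: le_trans; apply: ler_wpM2l => //; exact: ler_norm.
Qed.

End SmallEnergy.

(** * Matrix-valued functions and su(2) *)

Section MatrixCalculus.
Variable R : realType.
Implicit Types (U : set 'rV[R]_3) (k l : 'I_3) (x : 'rV[R]_3).
Implicit Types (f g : 'rV[R]_3 -> R[i]) (M N : 'rV[R]_3 -> 'M[R[i]]_2).

Definition csmooth_on U f :=
  smooth_on U (fun x => complex.Re (f x)) /\ smooth_on U (fun x => complex.Im (f x)).

Definition cpartial k f x : R[i] :=
  partial k (fun y => complex.Re (f y)) x +i* partial k (fun y => complex.Im (f y)) x.

Lemma csmoothD U f g : open U -> csmooth_on U f -> csmooth_on U g ->
  csmooth_on U (fun x => f x + g x).
Proof.
move=> oU [f1 f2] [g1 g2]; split.
  by apply: smooth_on_eq (smooth_onD oU f1 g1) => // x _; case: (f x); case: (g x).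
by apply: smooth_on_eq (smooth_onD oU f2 g2) => // x _; case: (f x); case: (g x).
Qed.

Lemma csmoothM U f g : open U -> csmooth_on U f -> csmooth_on U g ->
  csmooth_on U (fun x => f x * g x).
Proof.
move=> oU [f1 f2] [g1 g2]; split.
  apply: smooth_on_eq (smooth_onB oU (smooth_onM oU f1 g1) (smooth_onM oU f2 g2)) => // x _.
  by case: (f x); case: (g x).
apply: smooth_on_eq (smooth_onD oU (smooth_onM oU f1 g2) (smooth_onM oU f2 g1)) => // x _.
by case: (f x); case: (g x) => /= *; ring.
Qed.

Lemma cpartialD U k f g x : csmooth_on U f -> csmooth_on U g -> U x ->
  cpartial k (fun y => f y + g y) x = cpartial k f x + cpartial k g x.
Proof.
move=> [f1 f2] [g1 g2] Ux; rewrite /cpartial.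
have E1 : (fun y => complex.Re (f y + g y)) = (fun y => complex.Re (f y) + complex.Re (g y)).
  by apply/funext => y; case: (f y); case: (g y).
have E2 : (fun y => complex.Im (f y + g y)) = (fun y => complex.Im (f y) + complex.Im (g y)).
  by apply/funext => y; case: (f y); case: (g y).
by rewrite E1 E2 (partialD k f1 g1 Ux) (partialD k f2 g2 Ux).
Qed.

Lemma cpartialM U k f g x : open U -> csmooth_on U f -> csmooth_on U g -> U x ->
  cpartial k (fun y => f y * g y) x = cpartial k f x * g x + f x * cpartial k g x.
Proof.
move=> oU [f1 f2] [g1 g2] Ux; rewrite /cpartial.
have E1 : (fun y => complex.Re (f y * g y))
    = (fun y => complex.Re (f y) * complex.Re (g y) + - (complex.Im (f y) * complex.Im (g y))).
  by apply/funext => y; case: (f y); case: (g y).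
have E2 : (fun y => complex.Im (f y * g y))
    = (fun y => complex.Re (f y) * complex.Im (g y) + complex.Im (f y) * complex.Re (g y)).
  by apply/funext => y; case: (f y); case: (g y) => /= *; ring.
rewrite E1 E2.
have s11 := smooth_onM oU f1 g1; have s22 := smooth_onM oU f2 g2.
have s12 := smooth_onM oU f1 g2; have s21 := smooth_onM oU f2 g1.
rewrite (partialD k s11 (smooth_onN oU s22) Ux) (partialN k s22 Ux).
rewrite (partialD k s12 s21 Ux) (partialM k f1 g1 Ux) (partialM k f2 g2 Ux).
rewrite (partialM k f1 g2 Ux) (partialM k f2 g1 Ux).
move: (partial _ _ _) (partial _ _ _) (partial _ _ _) (partial _ _ _) => p1 p2 p3 p4.
case: (f x) => fr fi; case: (g x) => gr gi.
by apply/eqP; rewrite eq_complex /=; apply/andP; split; apply/eqP; ring.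
Qed.

Lemma eq_cpartial k f g x : f =1 g -> cpartial k f x = cpartial k g x.
Proof. by move=> /funext ->. Qed.

Lemma eq_partial k (f g : 'rV[R]_3 -> R) x : f =1 g -> partial k f x = partial k g x.
Proof. by move=> /funext ->. Qed.

Lemma cpartial_near k f g x : {near x, f =1 g} -> cpartial k f x = cpartial k g x.
Proof.
move=> fg; rewrite /cpartial; congr (_ +i* _); apply: partial_near;
  by apply: filterS fg => y ->.
Qed.

Lemma mx_partialE k M x a b : mx_partial k M x a b = cpartial k (fun y => M y a b) x.
Proof. by rewrite mxE. Qed.

Lemma csmooth_on_eq U f g : open U -> (forall x, U x -> f x = g x) ->
  csmooth_on U f -> csmooth_on U g.
Proof. by move=> oU fg [f1 f2]; split; [apply: smooth_on_eq f1|apply: smooth_on_eq f2] => // x /fg ->. Qed.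

Lemma mx_smooth_on_sub U V M : V `<=` U -> mx_smooth_on U M -> mx_smooth_on V M.
Proof. by move=> VU sM a b; have [] := sM a b; split; apply: smooth_on_sub; eassumption. Qed.

Lemma mx_partial_near k M N x : {near x, M =1 N} -> mx_partial k M x = mx_partial k N x.
Proof.
move=> MN; apply/matrixP => a b; rewrite !mx_partialE; apply: cpartial_near.
by apply: filterS MN => y ->.
Qed.

Lemma mx_partial_eq U k M N x : open U -> U x -> (forall y, U y -> M y = N y) ->
  mx_partial k M x = mx_partial k N x.
Proof.
by move=> oU Ux MN; apply: mx_partial_near; apply: open_near oU Ux MN.
Qed.

Lemma mx_smoothD U M N : open U -> mx_smooth_on U M -> mx_smooth_on U N ->
  mx_smooth_on U (fun x => M x + N x).
Proof.
move=> oU sM sN a b; apply: (csmooth_on_eq oU) (csmoothD oU (sM a b) (sN a b)) => x _.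
by rewrite mxE.
Qed.

Lemma mx_smoothN U M : open U -> mx_smooth_on U M -> mx_smooth_on U (fun x => - M x).
Proof.
move=> oU sM a b; have [s1 s2] := sM a b; split.
  by apply: (smooth_on_eq oU) (smooth_onN oU s1) => x _; rewrite mxE; case: (M x a b).
by apply: (smooth_on_eq oU) (smooth_onN oU s2) => x _; rewrite mxE; case: (M x a b).
Qed.

Lemma mx_smoothB U M N : open U -> mx_smooth_on U M -> mx_smooth_on U N ->
  mx_smooth_on U (fun x => M x - N x).
Proof. by move=> oU sM sN; apply: mx_smoothD => //; exact: mx_smoothN. Qed.

Lemma mulmx2E (A B : 'M[R[i]]_2) a b :
  (A *m B) a b = A a ord0 * B ord0 b + A a ord_max * B ord_max b.
Proof.
rewrite mxE !big_ord_recl big_ord0 addr0; congr (_ + A _ _ * B _ _); exact: val_inj.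
Qed.

Lemma addmxE (A B : 'M[R[i]]_2) a b : (A + B) a b = A a b + B a b.
Proof. exact: mxE. Qed.

Lemma oppmxE (A : 'M[R[i]]_2) a b : (- A) a b = - A a b.
Proof. exact: mxE. Qed.

(** Rewriting with these reduces an identity between noncommuting matrices to polynomial identities
    between entries, which [ring] decides. *)
Definition mx2E := (mulmx2E, addmxE, oppmxE).

Lemma mx_smoothM U M N : open U -> mx_smooth_on U M -> mx_smooth_on U N ->
  mx_smooth_on U (fun x => M x *m N x).
Proof.
move=> oU sM sN a b; apply: (csmooth_on_eq oU)
  (csmoothD oU (csmoothM oU (sM a ord0) (sN ord0 b)) (csmoothM oU (sM a ord_max) (sN ord_max b))).
by move=> x _; rewrite mulmx2E.
Qed.

Lemma mx_smooth_comm U M N : open U -> mx_smooth_on U M -> mx_smooth_on U N ->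
  mx_smooth_on U (fun x => commmx (M x) (N x)).
Proof. by move=> oU sM sN; apply: mx_smoothB => //; exact: mx_smoothM. Qed.

Lemma mx_smooth_partial U k M : open U -> mx_smooth_on U M -> mx_smooth_on U (mx_partial k M).
Proof.
move=> oU sM a b; have [s1 s2] := sM a b; split.
  by apply: (smooth_on_eq oU) (smooth_on_partial k s1) => x _; rewrite mxE.
by apply: (smooth_on_eq oU) (smooth_on_partial k s2) => x _; rewrite mxE.
Qed.

Lemma mx_partialD U k M N x : mx_smooth_on U M -> mx_smooth_on U N -> U x ->
  mx_partial k (fun y => M y + N y) x = mx_partial k M x + mx_partial k N x.
Proof.
move=> sM sN Ux; apply/matrixP => a b.
rewrite [LHS]mx_partialE [RHS]mxE (mx_partialE k M) (mx_partialE k N).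
apply: etrans (cpartialD k (sM a b) (sN a b) Ux).
by apply: eq_cpartial => y; rewrite mxE.
Qed.

Lemma mx_partialN U k M x : mx_smooth_on U M -> U x ->
  mx_partial k (fun y => - M y) x = - mx_partial k M x.
Proof.
move=> sM Ux; apply/matrixP => a b; have [s1 s2] := sM a b; rewrite !mxE.
have E1 : (fun y => complex.Re ((- M y) a b)) = (fun y => - complex.Re (M y a b)).
  by apply/funext => y; rewrite mxE; case: (M y a b).
have E2 : (fun y => complex.Im ((- M y) a b)) = (fun y => - complex.Im (M y a b)).
  by apply/funext => y; rewrite mxE; case: (M y a b).
by rewrite E1 E2 (partialN k s1 Ux) (partialN k s2 Ux).
Qed.

Lemma mx_partialB U k M N x : open U -> mx_smooth_on U M -> mx_smooth_on U N -> U x ->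
  mx_partial k (fun y => M y - N y) x = mx_partial k M x - mx_partial k N x.
Proof.
by move=> oU sM sN Ux; rewrite (mx_partialD k sM (mx_smoothN oU sN) Ux) (mx_partialN k sN Ux).
Qed.

Lemma mx_partialM U k M N x : open U -> mx_smooth_on U M -> mx_smooth_on U N -> U x ->
  mx_partial k (fun y => M y *m N y) x = mx_partial k M x *m N x + M x *m mx_partial k N x.
Proof.
move=> oU sM sN Ux; apply/matrixP => a b.
rewrite [LHS]mx_partialE [RHS]mxE !mulmx2E !mx_partialE.
transitivity (cpartial k (fun y => M y a ord0 * N y ord0 b + M y a ord_max * N y ord_max b) x).
  by apply: eq_cpartial => y; rewrite mulmx2E.
rewrite (cpartialD k (csmoothM oU (sM a ord0) (sN ord0 b)) (csmoothM oU (sM a ord_max) (sN ord_max b)) Ux).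
rewrite (cpartialM k oU (sM a ord0) (sN ord0 b) Ux) (cpartialM k oU (sM a ord_max) (sN ord_max b) Ux).
by rewrite addrACA.
Qed.

Lemma mx_partial_comm U k M N x : open U -> mx_smooth_on U M -> mx_smooth_on U N -> U x ->
  mx_partial k (fun y => commmx (M y) (N y)) x
  = commmx (mx_partial k M x) (N x) + commmx (M x) (mx_partial k N x).
Proof.
move=> oU sM sN Ux; rewrite /commmx.
rewrite (mx_partialB k oU (mx_smoothM oU sM sN) (mx_smoothM oU sN sM) Ux).
rewrite (mx_partialM k oU sM sN Ux) (mx_partialM k oU sN sM Ux).
by rewrite opprD [- _ - _]addrC addrACA.
Qed.

Lemma mx_partialC U k l M x : open U -> mx_smooth_on U M -> U x ->
  mx_partial k (mx_partial l M) x = mx_partial l (mx_partial k M) x.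
Proof.
move=> oU sM Ux; apply/matrixP => a b; have [s1 s2] := sM a b.
have E j : cpartial k (fun y => mx_partial j M y a b) x
  = partial k (partial j (fun y => complex.Re (M y a b))) x
    +i* partial k (partial j (fun y => complex.Im (M y a b))) x.
  by congr (_ +i* _); apply: eq_partial => y; rewrite mxE.
have E' j : cpartial l (fun y => mx_partial j M y a b) x
  = partial l (partial j (fun y => complex.Re (M y a b))) x
    +i* partial l (partial j (fun y => complex.Im (M y a b))) x.
  by congr (_ +i* _); apply: eq_partial => y; rewrite mxE.
rewrite [LHS]mx_partialE [RHS]mx_partialE E E'.
by rewrite (partialC k l oU s1 Ux) (partialC k l oU s2 Ux).
Qed.

End MatrixCalculus.

(** * The Lie algebra su(2) *)

Section SU2Algebra.
Variable R : realType.
Implicit Types A B C g : 'M[R[i]]_2.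

Lemma conjTD A B : conjT (A + B) = conjT A + conjT B.
Proof. by apply/matrixP => a b; rewrite !mxE rmorphD. Qed.

Lemma conjTN A : conjT (- A) = - conjT A.
Proof. by apply/matrixP => a b; rewrite !mxE rmorphN. Qed.

Lemma conjTM A B : conjT (A *m B) = conjT B *m conjT A.
Proof.
apply/matrixP => a b; rewrite mxE !mulmx2E !mxE rmorphD !rmorphM /=.
by rewrite [X in X + _]mulrC [X in _ + X]mulrC.
Qed.

Lemma is_su2D A B : is_su2 A -> is_su2 B -> is_su2 (A + B).
Proof.
move=> [A1 A2] [B1 B2]; split; first by rewrite conjTD A1 B1 opprD.
by rewrite mxtraceD A2 B2 addr0.
Qed.

Lemma is_su2N A : is_su2 A -> is_su2 (- A).
Proof. by move=> [A1 A2]; split; [rewrite conjTN A1|rewrite raddfN /= A2 oppr0]. Qed.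

Lemma is_su2_comm A B : is_su2 A -> is_su2 B -> is_su2 (commmx A B).
Proof.
move=> [A1 A2] [B1 B2]; split.
  rewrite /commmx conjTD conjTN !conjTM A1 B1 !mulNmx !mulmxN !opprK.
  by rewrite opprB.
by rewrite /commmx raddfB /= mxtrace_mulC subrr.
Qed.

(* Coordinates of [A = [[i p, q + i r], [- q + i r, - i p]]]. *)
Definition su2_coord A : R * R * R :=
  (complex.Im (A ord0 ord0), complex.Re (A ord0 ord_max), complex.Im (A ord0 ord_max)).

Lemma su2_entries A (t := su2_coord A) : is_su2 A ->
  [/\ A ord0 ord0 = 0 +i* t.1.1, A ord0 ord_max = t.1.2 +i* t.2,
      A ord_max ord0 = - t.1.2 +i* t.2 & A ord_max ord_max = 0 +i* - t.1.1].
Proof.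
move=> [/matrixP A1 A2]; rewrite /t /su2_coord /=.
have trE : A ord0 ord0 + A ord_max ord_max = 0.
  by rewrite -A2 /mxtrace !big_ord_recl big_ord0 addr0; congr (_ + A _ _); exact: val_inj.
have := A1 ord0 ord0; have := A1 ord0 ord_max; move: trE; rewrite !mxE.
case: (A ord0 ord0) => a00 b00; case: (A ord_max ord_max) => a11 b11.
case: (A ord0 ord_max) => a01 b01; case: (A ord_max ord0) => a10 b10.
move=> /eqP; rewrite eq_complex /= => /andP[/eqP h1 /eqP h2].
move=> /eqP; rewrite eq_complex /= => /andP[/eqP h3 /eqP h4].
move=> /eqP; rewrite eq_complex /= => /andP[/eqP h5 /eqP h6].
by split; congr (_ +i* _); lra.
Qed.

Lemma trmulmx2E A B : \tr (A *m B) = A ord0 ord0 * B ord0 ord0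
  + A ord0 ord_max * B ord_max ord0
  + (A ord_max ord0 * B ord0 ord_max + A ord_max ord_max * B ord_max ord_max).
Proof.
rewrite /mxtrace !big_ord_recl big_ord0 addr0.
by rewrite (_ : lift ord0 ord0 = ord_max) ?mulmx2E//; exact: val_inj.
Qed.

Lemma su2_dotE A B (s := su2_coord A) (t := su2_coord B) : is_su2 A -> is_su2 B ->
  su2_dot A B = 4 * (s.1.1 * t.1.1 + s.1.2 * t.1.2 + s.2 * t.2).
Proof.
move=> /su2_entries [a1 a2 a3 a4] /su2_entries [b1 b2 b3 b4].
rewrite /su2_dot trmulmx2E a1 a2 a3 a4 b1 b2 b3 b4 /= -/s -/t; ring.
Qed.

Lemma su2_coord_comm A B (s := su2_coord A) (t := su2_coord B) : is_su2 A -> is_su2 B ->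
  su2_coord (commmx A B) = (2 * (s.1.2 * t.2 - s.2 * t.1.2),
    2 * (s.2 * t.1.1 - s.1.1 * t.2), 2 * (s.1.1 * t.1.2 - s.1.2 * t.1.1)).
Proof.
move=> /su2_entries [a1 a2 a3 a4] /su2_entries [b1 b2 b3 b4].
have cE a b : commmx A B a b = (A *m B) a b - (B *m A) a b.
  by rewrite /commmx mxE [X in _ + X]mxE.
rewrite {1}/su2_coord !cE !mulmx2E.
rewrite a1 a2 a3 a4 b1 b2 b3 b4 /= -/s -/t.
by congr (_, _, _); ring.
Qed.

Lemma su2_sqnorm_ge0 A : is_su2 A -> 0 <= su2_sqnorm A.
Proof.
move=> sA; rewrite /su2_sqnorm su2_dotE// mulr_ge0//.
by rewrite !addr_ge0// -expr2 sqr_ge0.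
Qed.

(** Lagrange's identity: twice the vector of coordinates is an isometry from su(2) with the inner
    product -2 tr(ab) to Euclidean R^3, and it carries the commutator to the cross product. *)
Lemma su2_sqnorm_comm A B : is_su2 A -> is_su2 B ->
  su2_sqnorm A * su2_sqnorm B = su2_dot A B ^+ 2 + su2_sqnorm (commmx A B).
Proof.
move=> sA sB; rewrite /su2_sqnorm !su2_dotE//; last 2 first.
- exact: is_su2_comm.
- exact: is_su2_comm.
by rewrite su2_coord_comm//=; ring.
Qed.

Lemma su2_dot_sqr_le A B : is_su2 A -> is_su2 B ->
  su2_dot A B ^+ 2 <= su2_sqnorm A * su2_sqnorm B.
Proof.
move=> sA sB; rewrite su2_sqnorm_comm// lerDl su2_sqnorm_ge0//.
exact: is_su2_comm.
Qed.

Lemma su2_dot_conj A B g : g \in unitmx ->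
  su2_dot (invmx g *m A *m g) (invmx g *m B *m g) = su2_dot A B.
Proof.
move=> ug; rewrite /su2_dot; congr (_ * complex.Re _).
by rewrite !mulmxA mulmxK// mxtrace_mulC !mulmxA mulmxV// mul1mx.
Qed.

Lemma is_su2_partial (U : set 'rV[R]_3) k (M : 'rV[R]_3 -> 'M[R[i]]_2) x :
  open U -> U x -> mx_smooth_on U M -> (forall y, U y -> is_su2 (M y)) ->
  is_su2 (mx_partial k M x).
Proof.
move=> oU Ux sM su.
have nr a b : partial k (fun y => complex.Re (M y b a)) x
    = - partial k (fun y => complex.Re (M y a b)) x.
  rewrite -(partialN k (sM a b).1 Ux); apply: partial_near.
  apply: (open_near oU Ux) => y /su [/matrixP/(_ a b) + _]; rewrite !mxE.
  by case: (M y b a) => u v; case: (M y a b) => u' v' [].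
have ni a b : partial k (fun y => complex.Im (M y b a)) x
    = partial k (fun y => complex.Im (M y a b)) x.
  apply: partial_near.
  apply: (open_near oU Ux) => y /su [/matrixP/(_ a b) + _]; rewrite !mxE.
  by case: (M y b a) => u v; case: (M y a b) => u' v' [_] /oppr_inj.
split.
  by apply/matrixP => a b; rewrite !mxE nr ni.
have E : mx_partial k M x ord0 ord0 + mx_partial k M x ord_max ord_max = 0.
  rewrite !mx_partialE -(cpartialD k (sM ord0 ord0) (sM ord_max ord_max) Ux).
  transitivity (cpartial k (fun=> 0 : R[i]) x).
    apply: cpartial_near; apply: (open_near oU Ux) => y /su [_ <-].
    by rewrite /mxtrace !big_ord_recl big_ord0 addr0; congr (_ + M y _ _); exact: val_inj.
  by rewrite /cpartial /= partial_cst.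
rewrite /mxtrace !big_ord_recl big_ord0 addr0 -[RHS]E; congr (_ + _).
by rewrite (_ : lift ord0 ord0 = ord_max)//; exact: val_inj.
Qed.

End SU2Algebra.

(** * Covariant calculus in a chart *)

Section LocalIdentities.
Variables (R : realType) (E : SU2_bundle R) (D : connection E).
Implicit Types (i j : chart E) (k l m : 'I_3) (x : 'rV[R]_3).
Implicit Types (X Y : 'rV[R]_3 -> 'M[R[i]]_2).
Notation A := (conn_form D).

Let oD i : open (dom i) := @dom_open R E i.

Lemma smooth_cov i k X : mx_smooth_on (dom i) X -> mx_smooth_on (dom i) (cov D i k X).
Proof.
move=> sX; apply: mx_smoothD => //; first exact: mx_smooth_partial.
by apply: mx_smooth_comm => //; exact: conn_smooth.
Qed.

Lemma smooth_curv i k l : mx_smooth_on (dom i) (curv D i k l).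
Proof.
have sA m := conn_smooth D i m.
apply: mx_smoothD => //; last exact: mx_smooth_comm.
by apply: mx_smoothB => //; exact: mx_smooth_partial.
Qed.

Lemma su2_cov i k X x : dom i x -> mx_smooth_on (dom i) X ->
  (forall y, dom i y -> is_su2 (X y)) -> is_su2 (cov D i k X x).
Proof.
move=> ix sX suX; apply: is_su2D; first exact: is_su2_partial ix sX suX.
by apply: is_su2_comm; [exact: conn_su2|exact: suX].
Qed.

Lemma su2_curv i k l x : dom i x -> is_su2 (curv D i k l x).
Proof.
move=> ix; have sA m := conn_smooth D i m; have suA m y := @conn_su2 _ _ D i m y.
apply: is_su2D; last by apply: is_su2_comm; exact: suA.
apply: is_su2D; first exact: is_su2_partial ix (sA l) (suA l).
by apply: is_su2N; exact: is_su2_partial ix (sA k) (suA k).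
Qed.

Lemma cov_comm i k X Y x : dom i x -> mx_smooth_on (dom i) X -> mx_smooth_on (dom i) Y ->
  cov D i k (fun y => commmx (X y) (Y y)) x
  = commmx (cov D i k X x) (Y x) + commmx (X x) (cov D i k Y x).
Proof.
move=> ix sX sY; rewrite /cov (mx_partial_comm k (@oD i) sX sY ix).
move: (mx_partial _ _ _) (mx_partial _ _ _) (A i k x) (X x) (Y x) => dX dY a u v.
rewrite /commmx; apply/matrixP => p q.
by rewrite !mx2E; ring.
Qed.

Lemma ricci i k l X x : dom i x -> mx_smooth_on (dom i) X ->
  cov D i k (cov D i l X) x - cov D i l (cov D i k X) x = commmx (curv D i k l x) (X x).
Proof.
move=> ix sX; have sA m := conn_smooth D i m.
have dcov p q : mx_partial p (cov D i q X) x = mx_partial p (mx_partial q X) x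
    + (commmx (mx_partial p (A i q) x) (X x) + commmx (A i q x) (mx_partial p X x)).
  rewrite -(mx_partial_comm p (@oD i) (sA q) sX ix).
  exact: (mx_partialD p (mx_smooth_partial q (@oD i) sX) (mx_smooth_comm (@oD i) (sA q) sX) ix).
rewrite /cov -/(cov D i l X) -/(cov D i k X) !dcov (mx_partialC k l (@oD i) sX ix) /curv.
move: (mx_partial l (mx_partial k X) x) (mx_partial k X x) (mx_partial l X x) => ddX dk dl.
move: (mx_partial k (A i l) x) (mx_partial l (A i k) x) (A i k x) (A i l x) (X x) => p q a b u.
rewrite /commmx; apply/matrixP => r s.
by rewrite !mx2E; ring.
Qed.

(** The second derivatives of the connection form cancel in pairs by symmetry; what remains is the
    Leibniz rule and the Jacobi identity, checked entrywise. *)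
Lemma bianchi i k l m x : dom i x ->
  cov D i k (curv D i l m) x + cov D i l (curv D i m k) x + cov D i m (curv D i k l) x = 0.
Proof.
move=> ix; have sA n := conn_smooth D i n.
have dcurv n p q : mx_partial n (curv D i p q) x
    = mx_partial n (mx_partial p (A i q)) x - mx_partial n (mx_partial q (A i p)) x
      + (commmx (mx_partial n (A i p) x) (A i q x) + commmx (A i p x) (mx_partial n (A i q) x)).
  have s1 := mx_smooth_partial p (@oD i) (sA q); have s2 := mx_smooth_partial q (@oD i) (sA p).
  rewrite -(mx_partial_comm n (@oD i) (sA p) (sA q) ix) -(mx_partialB n (@oD i) s1 s2 ix).
  exact: (mx_partialD n (mx_smoothB (@oD i) s1 s2) (mx_smooth_comm (@oD i) (sA p) (sA q)) ix).
rewrite /cov !dcurv /curv.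
rewrite (mx_partialC m l (@oD i) (sA k) ix) (mx_partialC m k (@oD i) (sA l) ix).
rewrite (mx_partialC l k (@oD i) (sA m) ix).
move: (mx_partial l (mx_partial m (A i k)) x) (mx_partial k (mx_partial m (A i l)) x)
  (mx_partial k (mx_partial l (A i m)) x) => D1 D2 D3.
move: (mx_partial k (A i l) x) (mx_partial l (A i k) x) => p1 p2.
move: (mx_partial k (A i m) x) (mx_partial m (A i k) x) => p3 p4.
move: (mx_partial l (A i m) x) (mx_partial m (A i l) x) => p5 p6.
move: (A i k x) (A i l x) (A i m x) => a b c.
rewrite /commmx; apply/matrixP => r s; rewrite [RHS]mxE.
by rewrite !mx2E; ring.
Qed.

End LocalIdentities.

(** * Global sections *)

Section Gauge.
Variables (R : realType) (E : SU2_bundle R) (D : connection E).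
Implicit Types (i j : chart E) (k l m : 'I_3) (x : 'rV[R]_3).
Implicit Types (X Y : 'rV[R]_3 -> 'M[R[i]]_2) (S T : su_section E).
Notation A := (conn_form D).

Let oD i : open (dom i) := @dom_open R E i.

Lemma trans_unit i j x : dom i x -> dom j x -> trans i j x \in unitmx.
Proof. by move=> ix jx; have [/mulmx1_unit[]] := trans_SU2 ix jx. Qed.

Lemma conj_intertwine (g P Q : 'M[R[i]]_2) : g \in unitmx ->
  g *m P = Q *m g -> P = invmx g *m Q *m g.
Proof. by move=> ug gP; rewrite -mulmxA -gP mulKmx. Qed.

Lemma intertwine_conj (g P Q : 'M[R[i]]_2) : g \in unitmx ->
  P = invmx g *m Q *m g -> g *m P = Q *m g.
Proof. by move=> ug ->; rewrite !mulmxA mulmxV// mul1mx. Qed.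

Lemma intertwine_comm (g P P' Q Q' : 'M[R[i]]_2) : g *m P = P' *m g -> g *m Q = Q' *m g ->
  g *m commmx P Q = commmx P' Q' *m g.
Proof.
move=> gP gQ; rewrite /commmx mulmxBr mulmxBl !mulmxA gP gQ.
by rewrite -!mulmxA gP gQ.
Qed.

(* The covariant derivative on sections of [Hom(_, E)]; under it the
   transformation rule of the connection reads [g A_j = cov_left i g]. *)
Definition cov_left i k Y x := mx_partial k Y x + A i k x *m Y x.

Lemma trans_conn i j k x : dom i x -> dom j x ->
  trans i j x *m A j k x = cov_left i k (trans i j) x.
Proof.
move=> ix jx; rewrite (conn_trans D k ix jx) /=.
have ug := trans_unit ix jx.
by rewrite mulmxDr !mulmxA mulmxV// !mul1mx addrC.
Qed.

Lemma cov_left_trans i j k Y x : dom i x -> dom j x ->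
  mx_smooth_on (dom i `&` dom j) Y ->
  cov_left i k (fun y => trans i j y *m Y y) x = trans i j x *m cov_left j k Y x.
Proof.
move=> ix jx sY; have oU := openI (@oD i) (@oD j).
rewrite /cov_left (mx_partialM k oU (trans_smooth i j) sY (conj ix jx)).
rewrite mulmxDr mulmxA [in RHS]mulmxA trans_conn// /cov_left mulmxDl.
by rewrite addrAC addrA addrC addrA.
Qed.

(** Writing the gauge rule as [g *m Y = X *m g] instead of a conjugation means that no inverse
    matrix has to be differentiated: the product rule is applied to both sides, and [trans_conn]
    replaces the form of chart [j] by that of chart [i]. *)
Lemma cov_intertwine i j k X Y x : dom i x -> dom j x ->
  mx_smooth_on (dom i) X -> mx_smooth_on (dom j) Y ->
  (forall y, dom i y -> dom j y -> trans i j y *m Y y = X y *m trans i j y) ->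
  trans i j x *m cov D j k Y x = cov D i k X x *m trans i j x.
Proof.
move=> ix jx sX sY XY; have oU := openI (@oD i) (@oD j).
have sX' : mx_smooth_on (dom i `&` dom j) X by apply: mx_smooth_on_sub sX => y [].
have sY' : mx_smooth_on (dom i `&` dom j) Y by apply: mx_smooth_on_sub sY => y [].
have E1 : trans i j x *m cov_left j k Y x
    = mx_partial k X x *m trans i j x + X x *m mx_partial k (trans i j) x
      + A i k x *m X x *m trans i j x.
  rewrite -cov_left_trans// /cov_left XY// -(mx_partialM k oU sX' (trans_smooth i j) (conj ix jx)).
  rewrite mulmxA; congr (_ + _); apply: (mx_partial_eq k oU (conj ix jx)) => y [iy jy].
  exact: XY.
have E2 : trans i j x *m (Y x *m A j k x)
    = X x *m mx_partial k (trans i j) x + X x *m A i k x *m trans i j x.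
  by rewrite mulmxA XY// -mulmxA trans_conn// /cov_left mulmxDr mulmxA.
have -> : cov D j k Y x = cov_left j k Y x - Y x *m A j k x.
  by rewrite /cov /cov_left /commmx addrA.
rewrite mulmxBr E1 E2 /cov /commmx mulmxDl mulmxBl.
by rewrite addrAC opprD addrA [_ + _ - X x *m mx_partial _ _ _]addrK addrA addrAC.
Qed.

(** By [trans_conn] and [cov_left_trans], the left-hand side is the commutator of two covariant
    derivatives applied to the transition function. Its second partial derivatives cancel, which
    leaves the curvature of chart [i] acting on it. *)
Lemma curv_intertwine i j k l x : dom i x -> dom j x ->
  trans i j x *m curv D j k l x = curv D i k l x *m trans i j x.
Proof.
move=> ix jx; have oU := openI (@oD i) (@oD j); have Ux := conj ix jx.
have sg : mx_smooth_on (dom i `&` dom j) (trans i j) := trans_smooth i j.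
have sAi m : mx_smooth_on (dom i `&` dom j) (A i m).
  by apply: mx_smooth_on_sub (conn_smooth D i m) => y [].
have sAj m : mx_smooth_on (dom i `&` dom j) (A j m).
  by apply: mx_smooth_on_sub (conn_smooth D j m) => y [].
have cE : curv D j k l x = cov_left j k (A j l) x - cov_left j l (A j k) x.
  by rewrite /curv /cov_left /commmx opprD addrACA.
have step p q : trans i j x *m cov_left j p (A j q) x
    = mx_partial p (mx_partial q (trans i j)) x
      + (mx_partial p (A i q) x *m trans i j x + A i q x *m mx_partial p (trans i j) x)
      + (A i p x *m mx_partial q (trans i j) x + A i p x *m A i q x *m trans i j x).
  rewrite -cov_left_trans// /cov_left.
  have sdg := mx_smooth_partial q oU sg.
  have sAg := mx_smoothM oU (sAi q) sg.
  rewrite -(mx_partialM p oU (sAi q) sg Ux) -(mx_partialD p sdg sAg Ux).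
  rewrite trans_conn// /cov_left mulmxDr mulmxA; congr (_ + _).
  by apply: (mx_partial_eq p oU Ux) => y [iy jy]; exact: trans_conn.
rewrite cE mulmxBr !step (mx_partialC l k oU sg Ux) /curv.
move: (mx_partial k (mx_partial l (trans i j)) x) (mx_partial k (trans i j) x)
  (mx_partial l (trans i j) x) (trans i j x) => ddg dk dl g.
move: (mx_partial k (A i l) x) (mx_partial l (A i k) x) (A i k x) (A i l x) => p q a b.
by rewrite /commmx; apply/matrixP => r s; rewrite !mx2E; ring.
Qed.

Lemma sec_intertwine S i j x : dom i x -> dom j x ->
  trans i j x *m sec S j x = sec S i x *m trans i j x.
Proof.
by move=> ix jx; apply: intertwine_conj; [exact: trans_unit|exact: sec_trans].
Qed.

Definition cov_section_def k S : su_section E.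
Proof.
exists (fun i => cov D i k (sec S i)).
- by move=> i x ix; apply: su2_cov => //; [exact: sec_smooth|move=> y; exact: sec_su2].
- by move=> i; apply: smooth_cov; exact: sec_smooth.
- move=> i j x ix jx; apply: conj_intertwine; first exact: trans_unit.
  apply: cov_intertwine => //; try exact: sec_smooth.
  by move=> y iy jy; exact: sec_intertwine.
Defined.

Definition curv_section_def k l : su_section E.
Proof.
exists (fun i => curv D i k l).
- by move=> i x ix; exact: su2_curv.
- by move=> i; exact: smooth_curv.
- move=> i j x ix jx; apply: conj_intertwine; first exact: trans_unit.
  exact: curv_intertwine.
Defined.

Definition comm_section_def S T : su_section E.
Proof.
exists (fun i x => commmx (sec S i x) (sec T i x)).
- by move=> i x ix; apply: is_su2_comm; exact: sec_su2.
- by move=> i; apply: mx_smooth_comm => //; exact: sec_smooth.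
- move=> i j x ix jx; apply: conj_intertwine; first exact: trans_unit.
  by apply: intertwine_comm; exact: sec_intertwine.
Defined.

End Gauge.

(* Locked: comparing two of these by unfolding is hopelessly slow. *)
HB.lock Definition cov_section (R : realType) (E : SU2_bundle R) (D : connection E)
  (k : 'I_3) (S : su_section E) := cov_section_def D k S.

HB.lock Definition curv_section (R : realType) (E : SU2_bundle R) (D : connection E)
  (k l : 'I_3) := curv_section_def D k l.

HB.lock Definition comm_section (R : realType) (E : SU2_bundle R) (S T : su_section E) :=
  comm_section_def S T.

HB.lock Definition section_dot (R : realType) (E : SU2_bundle R) (S T : su_section E) x :=
  su2_dot (sec S (chart_at E x) x) (sec T (chart_at E x) x).

(** * Pairings of global sections *)

Section SectionCalculus.
Variables (R : realType) (E : SU2_bundle R) (D : connection E).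
Implicit Types (i : chart E) (k l : 'I_3) (x : 'rV[R]_3).
Implicit Types (X Y : 'rV[R]_3 -> 'M[R[i]]_2) (S T : su_section E).

Let oD i : open (dom i) := @dom_open R E i.

Lemma cov_sectionE k S i : sec (cov_section D k S) i = cov D i k (sec S i).
Proof. by rewrite cov_section.unlock. Qed.

Lemma curv_sectionE k l i : sec (curv_section D k l) i = curv D i k l.
Proof. by rewrite curv_section.unlock. Qed.

Lemma comm_sectionE S T i : sec (comm_section S T) i = fun x => commmx (sec S i x) (sec T i x).
Proof. by rewrite comm_section.unlock. Qed.

Lemma section_dot_at S T x :
  section_dot S T x = su2_dot (sec S (chart_at E x) x) (sec T (chart_at E x) x).
Proof. by rewrite section_dot.unlock. Qed.

Lemma chart_atP x : dom (chart_at E x) x.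
Proof. exact: projT2 (cid (dom_cover E x)). Qed.

Lemma section_dotE S T i x : dom i x ->
  section_dot S T x = su2_dot (sec S i x) (sec T i x).
Proof.
move=> ix; have cx := chart_atP x.
rewrite section_dot_at (sec_trans S ix cx) (sec_trans T ix cx).
by apply: su2_dot_conj; exact: trans_unit.
Qed.

Lemma smooth_su2_dot (U : set 'rV[R]_3) X Y : open U -> mx_smooth_on U X ->
  mx_smooth_on U Y -> smooth_on U (fun x => su2_dot (X x) (Y x)).
Proof.
move=> oU sX sY.
have s a b c d := csmoothM oU (sX a b) (sY c d).
have st : csmooth_on U (fun x => \tr (X x *m Y x)).
  have st' := csmoothD oU (csmoothD oU (s ord0 ord0 ord0 ord0) (s ord0 ord_max ord_max ord0))
    (csmoothD oU (s ord_max ord0 ord0 ord_max) (s ord_max ord_max ord_max ord_max)).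
  by apply: (csmooth_on_eq oU) st' => x _; rewrite trmulmx2E.
exact: (smooth_onM oU (smooth_on_cst (- 2) oU) st.1).
Qed.

Lemma smooth_on_local (f : 'rV[R]_3 -> R) :
  (forall x, exists U, [/\ open U, U x & smooth_on U f]) -> smooth_on setT f.
Proof.
move=> H n; have {}H x : exists U, [/\ open U, U x & Ck_on n U f].
  by have [U [oU Ux sf]] := H x; exists U; split => //; exact: sf.
elim: n f H => [|n IH] f H; split=> //.
- by move=> x _; have [U [_ Ux [cf _]]] := H x; exact: cf.
- by move=> x _; have [U [_ Ux [cf _]]] := H x; exact: cf.
move=> k; split=> [x _|].
  by have [U [_ Ux [_ /(_ k)[df _]]]] := H x; exact: df.
by apply: IH => x; have [U [oU Ux [_ /(_ k)[_ Hk]]]] := H x; exists U.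
Qed.

(** The chart chosen by [chart_at] may jump from point to point; gauge invariance allows the chart
    at [x] to be kept on a whole neighbourhood of [x]. *)
Lemma smooth_section_dot S T : smooth_on setT (section_dot S T).
Proof.
apply: smooth_on_local => x; exists (dom (chart_at E x)); split=> //.
  exact: chart_atP.
set i := chart_at E x.
apply: (smooth_on_eq (@oD i)) (smooth_su2_dot (@oD i) (sec_smooth S i) (sec_smooth T i)).
by move=> y iy; rewrite (section_dotE S T iy).
Qed.

Lemma partial_section_dot k S T x : partial k (section_dot S T) x
  = section_dot (cov_section D k S) T x + section_dot S (cov_section D k T) x.
Proof.
have ix := chart_atP x; set i := chart_at E x in ix.
rewrite !(section_dotE _ _ ix) !cov_sectionE.
rewrite -(partial_cov D k ix (sec_smooth S i) (sec_smooth T i)).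
apply: partial_near; apply: (open_near (@oD i) ix) => y iy.
exact: section_dotE.
Qed.

End SectionCalculus.

(** * The Bochner identity *)

Section SectionAlgebra.
Variables (R : realType) (E : SU2_bundle R) (D : connection E).
Implicit Types (k l m : 'I_3) (x : 'rV[R]_3) (S T V : su_section E).
Notation dot := section_dot.

Lemma section_dotC S T x : dot S T x = dot T S x.
Proof. by rewrite !section_dot_at su2_dotC. Qed.

Lemma section_dot_ge0 S x : 0 <= dot S S x.
Proof. by rewrite section_dot_at; apply: su2_sqnorm_ge0; apply: sec_su2; exact: chart_atP. Qed.

Lemma section_dot_sqr_le S T x : dot S T x ^+ 2 <= dot S S x * dot T T x.
Proof.
by rewrite !section_dot_at; apply: su2_dot_sqr_le; apply: sec_su2; exact: chart_atP.
Qed.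

Lemma section_dot_sqrE S T x :
  dot S S x * dot T T x = dot S T x ^+ 2 + dot (comm_section S T) (comm_section S T) x.
Proof.
rewrite !section_dot_at comm_sectionE.
by apply: su2_sqnorm_comm; apply: sec_su2; exact: chart_atP.
Qed.

Lemma commmxN (A B : 'M[R[i]]_2) : commmx A B = - commmx B A.
Proof. by rewrite /commmx opprB. Qed.

Lemma section_dot_ad S T V x : dot (comm_section S T) V x = dot S (comm_section T V) x.
Proof. by rewrite !section_dot_at !comm_sectionE commmxN su2_dotNl su2_dot_comm opprK. Qed.

Lemma section_dot_commN S T V x : dot (comm_section S T) V x = - dot (comm_section T S) V x.
Proof. by rewrite !section_dot_at !comm_sectionE commmxN su2_dotNl. Qed.

Lemma curvN i k l x : curv D i l k x = - curv D i k l x.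
Proof. by rewrite /curv /commmx opprD !opprB. Qed.

Lemma section_dot_curvN k l S x : dot (curv_section D l k) S x = - dot (curv_section D k l) S x.
Proof. by rewrite !section_dot_at !curv_sectionE curvN; exact: su2_dotNl. Qed.

Let dot_eq (A B V : 'M[R[i]]_2) : A = B -> su2_dot A V = su2_dot B V.
Proof. by move=> ->. Qed.

(** Tested against an arbitrary [T], as are the identities below: sections are only ever combined
    after pairing, where the terms are real functions that can be added and differentiated
    globally. *)
Lemma section_ricci k l S T x :
  dot (cov_section D k (cov_section D l S)) T x - dot (cov_section D l (cov_section D k S)) T x
  = dot (comm_section (curv_section D k l) S) T x.
Proof.
have := ricci D k l (chart_atP E x) (sec_smooth S (chart_at E x)).
rewrite !section_dot_at -su2_dotNl -su2_dotDl !cov_sectionE comm_sectionE curv_sectionE.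
move=> /(@dot_eq _ _ (sec T (chart_at E x) x)); exact.
Qed.

Lemma section_cov_comm k S T V x :
  dot (cov_section D k (comm_section S T)) V x
  = dot (comm_section (cov_section D k S) T) V x + dot (comm_section S (cov_section D k T)) V x.
Proof.
have := cov_comm D k (chart_atP E x) (sec_smooth S (chart_at E x)) (sec_smooth T (chart_at E x)).
rewrite !section_dot_at -su2_dotDl !cov_sectionE !comm_sectionE !cov_sectionE.
move=> /(@dot_eq _ _ (sec V (chart_at E x) x)); exact.
Qed.

Lemma section_bianchi k l m S x :
  dot (cov_section D k (curv_section D l m)) S x + dot (cov_section D l (curv_section D m k)) S x
  + dot (cov_section D m (curv_section D k l)) S x = 0.
Proof.
rewrite !section_dot_at -!su2_dotDl !cov_sectionE !curv_sectionE bianchi; last exact: chart_atP.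
by rewrite /su2_dot mul0mx mxtrace0 mulr0.
Qed.

Lemma section_dot0l S T x : dot S S x = 0 -> dot S T x = 0.
Proof.
move=> S0; apply/eqP; rewrite -sqrf_eq0 eq_le sqr_ge0 andbT.
by apply: le_trans (section_dot_sqr_le S T x) _; rewrite S0 mul0r.
Qed.

End SectionAlgebra.

(** * The divergences of the three fluxes *)

Section Identities.
Variables (R : realType) (E : SU2_bundle R) (D : connection E) (Phi : su_section E).
Variables (lam eps : R).
Hypotheses (eps0 : 0 < eps) (sol : YMH_solution D Phi lam eps).
Implicit Types (k l m : 'I_3) (x : 'rV[R]_3) (S T V : su_section E).
Notation dot := section_dot.
Notation cov := (cov_section D).
Notation F := (curv_section D).
Notation DP l := (cov_section D l Phi).
Notation H k l := (cov_section D k (cov_section D l Phi)).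
Notation C l := (comm_section (cov_section D l Phi) Phi).
Notation FP k l := (comm_section (curv_section D k l) Phi).

Definition higgs_sqr x := dot Phi Phi x.
Definition higgs_defect x := 1 - dot Phi Phi x.
Definition grad_sqr x := \sum_(k < 3) dot (DP k) (DP k) x.
Definition hess_sqr x := \sum_(k < 3) \sum_(l < 3) dot (H k l) (H k l) x.
Definition current_sqr x := \sum_(l < 3) dot (C l) (C l) x.
(** The factor 1/2 compensates for counting every pair of indices twice, so this is the squared norm
    of a 2-form; [curv_sqr2] below, without it, is twice the squared norm of F. *)
Definition curv_perp_sqr x := 2^-1 * \sum_(k < 3) \sum_(l < 3) dot (FP k l) (FP k l) x.
Definition curv_sqr2 x := \sum_(k < 3) \sum_(l < 3) dot (F k l) (F k l) x.
Definition triple x := \sum_(k < 3) \sum_(l < 3) dot (F k l) (comm_section (DP l) (DP k)) x.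
Definition defect_grad_sqr x := \sum_(k < 3) partial k higgs_defect x ^+ 2.

Definition flux_curv k x := \sum_(l < 3) dot (F k l) (C l) x.
(** The boundary term that separates the full Hessian of Phi from its rough Laplacian in the L^2
    norm. *)
Definition flux_hess k x := \sum_(l < 3) (dot (H l k) (DP l) x - dot (H l l) (DP k) x).
Definition flux_defect k x := higgs_defect x * partial k higgs_defect x.

Notation u := higgs_defect.
Notation kap := (lam / (2 * eps ^+ 2)).

Let su2_dotZl (c : R) (A B : 'M[R[i]]_2) : su2_dot (c%:C *: A) B = c * su2_dot A B.
Proof. by rewrite /su2_dot -scalemxAl mxtraceZ; case: (\tr _) => a b /=; ring. Qed.

Lemma yang_mills l S x :
  eps ^+ 2 * \sum_(k < 3) dot (cov k (F k l)) S x = - dot (C l) S x.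
Proof.
have [/(_ l) YM _] := sol (chart_atP E x).
have := congr1 (fun M => su2_dot M (sec S (chart_at E x) x)) YM.
rewrite su2_dotZl /codiff su2_dotNl su2_dot_suml section_dot_at comm_sectionE cov_sectionE => <-.
rewrite mulrN opprK; congr (_ * _); apply: eq_bigr => k _.
by rewrite section_dot_at cov_sectionE curv_sectionE.
Qed.

Lemma higgs_equation S x : \sum_(k < 3) dot (H k k) S x = - (kap * u x * dot Phi S x).
Proof.
have [_ HE] := sol (chart_atP E x).
have := congr1 (fun M => su2_dot M (sec S (chart_at E x) x)) HE.
rewrite su2_dotZl /rough_laplacian su2_dotNl su2_dot_suml /higgs_defect !section_dot_at.
move=> <-; rewrite opprK; apply: eq_bigr => k _.
by rewrite section_dot_at !cov_sectionE.
Qed.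

Lemma sum3D (f g : 'I_3 -> R) :
  \sum_(k < 3) (f k + g k) = \sum_(k < 3) f k + \sum_(k < 3) g k.
Proof. exact: big_split. Qed.

Lemma exchange3 (f : 'I_3 -> 'I_3 -> R) :
  \sum_(k < 3) \sum_(l < 3) f k l = \sum_(k < 3) \sum_(l < 3) f l k.
Proof. exact: exchange_big. Qed.

(** By the Ricci identity [FP k l] is the antisymmetrisation [H k l - H l k], and pairing it with
    either half gives the same sum up to sign. *)
Lemma sum_hess_perp x :
  \sum_(k < 3) \sum_(l < 3) dot (H k l) (FP k l) x = curv_perp_sqr x.
Proof.
have E1 : \sum_(k < 3) \sum_(l < 3) dot (FP k l) (FP k l) x
    = \sum_(k < 3) \sum_(l < 3) dot (H k l) (FP k l) x
      + \sum_(k < 3) \sum_(l < 3) dot (H k l) (FP k l) x.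
  rewrite [X in _ + X]exchange3 -sum3D; apply: eq_bigr => k _.
  rewrite -sum3D; apply: eq_bigr => l _.
  rewrite -[LHS]section_ricci; congr (_ + _).
  rewrite [in RHS]section_dotC [in RHS]section_dot_ad section_dot_curvN.
  by rewrite -[in RHS]section_dot_ad [in RHS]section_dotC.
by rewrite /curv_perp_sqr E1; field.
Qed.

(** The derivative of F is turned into the current by the Yang-Mills equation. The derivative of the
    current falls either on DPhi, giving [F, Phi] through [sum_hess_perp], or on Phi, giving
    [triple]. *)
Lemma div_flux_curv x :
  eps ^+ 2 * \sum_(k < 3) partial k (flux_curv k) x
  = - current_sqr x - eps ^+ 2 * curv_perp_sqr x + eps ^+ 2 * triple x.
Proof.
have dV k : partial k (flux_curv k) x
    = \sum_(l < 3) dot (cov k (F k l)) (C l) x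
      + \sum_(l < 3) (- dot (H k l) (FP k l) x + dot (F k l) (comm_section (DP l) (DP k)) x).
  rewrite /flux_curv (@partial_sum _ setT)//; last by move=> l; exact: smooth_section_dot.
  rewrite -sum3D; apply: eq_bigr => l _.
  rewrite (partial_section_dot D); congr (_ + _).
  rewrite section_dotC section_cov_comm; congr (_ + _); last exact: section_dotC.
  by rewrite section_dot_ad section_dotC section_dot_commN section_dotC.
have S1 : eps ^+ 2 * \sum_(k < 3) \sum_(l < 3) dot (cov k (F k l)) (C l) x = - current_sqr x.
  by rewrite exchange3 mulr_sumr -sumrN; apply: eq_bigr => l _; exact: yang_mills.
have S2 : \sum_(k < 3) \sum_(l < 3)
    (- dot (H k l) (FP k l) x + dot (F k l) (comm_section (DP l) (DP k)) x)
    = - curv_perp_sqr x + triple x.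
  rewrite -sum_hess_perp -sumrN -sum3D; apply: eq_bigr => k _.
  by rewrite -sumrN -sum3D.
rewrite (eq_bigr _ (fun k _ => dV k)) sum3D S2 mulrDr S1; ring.
Qed.

Lemma div_flux_hess x :
  \sum_(k < 3) partial k (flux_hess k) x
  = hess_sqr x - curv_perp_sqr x - kap ^+ 2 * u x ^+ 2 * higgs_sqr x - triple x.
Proof.
have dZ k : partial k (flux_hess k) x
    = \sum_(l < 3) dot (cov k (H l k)) (DP l) x + \sum_(l < 3) dot (H l k) (H k l) x
      - \sum_(l < 3) dot (cov k (H l l)) (DP k) x - \sum_(l < 3) dot (H l l) (H k k) x.
  have s1 l := smooth_section_dot (H l k) (DP l).
  have s2 l := smooth_section_dot (H l l) (DP k).
  rewrite /flux_hess (@partial_sum _ setT)//; last by move=> l; exact: smooth_onB openT _ _.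
  rewrite -sum3D -!sumrB; apply: eq_bigr => l _.
  rewrite (partialD k (s1 l) (smooth_onN openT (s2 l)) I) (partialN k (s2 l) I).
  by rewrite !(partial_section_dot D) opprD addrA.
(* Exchanging the two outer derivatives in a third derivative of Phi costs the curvature acting on
   DPhi. The remaining third derivatives cancel between the two parts of the flux. *)
have T1 : \sum_(k < 3) \sum_(l < 3) dot (cov l (H k l)) (DP k) x
    = \sum_(k < 3) \sum_(l < 3) dot (cov k (H l l)) (DP k) x - triple x.
  rewrite /triple -sumrB; apply: eq_bigr => k _; rewrite -sumrB; apply: eq_bigr => l _.
  have := section_ricci D l k (DP l) (DP k) x; rewrite section_dot_ad section_dot_curvN.
  by move/eqP; rewrite subr_eq addrC => /eqP.
have T2 : \sum_(k < 3) \sum_(l < 3) dot (H l k) (H k l) x = hess_sqr x - curv_perp_sqr x.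
  rewrite -sum_hess_perp /hess_sqr -sumrB; apply: eq_bigr => k _; rewrite -sumrB.
  apply: eq_bigr => l _; rewrite [X in _ - X]section_dotC -section_ricci.
  by rewrite subKr.
(* This is the squared norm of the rough Laplacian, which the Higgs equation evaluates. *)
have T3 : \sum_(k < 3) \sum_(l < 3) dot (H l l) (H k k) x = kap ^+ 2 * u x ^+ 2 * higgs_sqr x.
  under eq_bigr do rewrite higgs_equation section_dotC.
  rewrite sumrN -mulr_sumr higgs_equation /higgs_sqr; ring.
rewrite (eq_bigr _ (fun k _ => dZ k)) !sumrB sum3D [X in X + _ - _ - _]exchange3.
rewrite T1 T2 T3; ring.
Qed.

Lemma partial_defect k : partial k u = (fun x => - 2 * dot (DP k) Phi x).
Proof.
apply/funext => x.
have s1 := smooth_section_dot Phi Phi.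
rewrite /higgs_defect (partialD k (smooth_on_cst 1 openT) (smooth_onN openT s1) I).
by rewrite partial_cst (partialN k s1 I) (partial_section_dot D) [dot Phi _ x]section_dotC; ring.
Qed.

Lemma smooth_defect : smooth_on setT u.
Proof. apply: smooth_onB openT (smooth_on_cst 1 openT) _; exact: smooth_section_dot. Qed.

Lemma div_flux_defect x :
  \sum_(k < 3) partial k (flux_defect k) x
  = defect_grad_sqr x + 2 * kap * u x ^+ 2 * higgs_sqr x - 2 * u x * grad_sqr x.
Proof.
have dU k : partial k (flux_defect k) x = partial k u x ^+ 2
    + (- 2 * u x * dot (H k k) Phi x + - 2 * u x * dot (DP k) (DP k) x).
  rewrite /flux_defect (partialM k smooth_defect (smooth_on_partial k smooth_defect) I).
  rewrite expr2; congr (_ + _).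
  have -> : partial k (partial k u) x = - 2 * (dot (H k k) Phi x + dot (DP k) (DP k) x).
    rewrite partial_defect.
    rewrite (partialM k (smooth_on_cst (- 2) openT) (smooth_section_dot (DP k) Phi) I).
    by rewrite partial_cst (partial_section_dot D); ring.
  by ring.
rewrite (eq_bigr _ (fun k _ => dU k)) !sum3D -!mulr_sumr higgs_equation.
by rewrite /defect_grad_sqr /grad_sqr /higgs_sqr; ring.
Qed.

(** Lagrange's identity for DPhi and Phi: |Phi|^2 is [1 - u], and the component of DPhi along Phi is
    minus half the gradient of [u]. *)
Lemma grad_sqr_split x : grad_sqr x
  = current_sqr x + 4^-1 * defect_grad_sqr x + u x * grad_sqr x.
Proof.
have E1 : higgs_sqr x * grad_sqr x = current_sqr x + 4^-1 * defect_grad_sqr x.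
  rewrite /current_sqr /defect_grad_sqr /grad_sqr !mulr_sumr -sum3D.
  apply: eq_bigr => k _; rewrite partial_defect mulrC section_dot_sqrE addrC.
  by congr (_ + _); field.
by rewrite -E1 /higgs_defect /higgs_sqr; ring.
Qed.

(* The weights of the three fluxes in [flux] are chosen so that all these terms
   get a positive coefficient; one of the two copies of [current_sqr] produced
   by [- 2 flux_curv] is traded for [grad_sqr] through [grad_sqr_split]. *)
Definition coercive x := grad_sqr x + eps ^+ 2 * hess_sqr x + current_sqr x
  + eps ^+ 2 * curv_perp_sqr x + (4^-1 + lam / 2) * defect_grad_sqr x
  + (2^-1 + lam / 4) * (lam / eps ^+ 2 * (u x ^+ 2 * higgs_sqr x)).

Definition cubic x := 3 * eps ^+ 2 * triple x + (2 + lam) * u x * grad_sqr x.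

(** [flux_hess] produces one negative [curv_perp_sqr], of which [- 2 * flux_curv] returns two. It
    also produces [- lam^2 / (4 eps^2)] times u^2 |Phi|^2; the weight of [flux_defect] grows with
    [lam] because its share [(1 + lam) * lam / (2 eps^2)] has to outweigh this. *)
Definition flux k x := eps ^+ 2 * (flux_hess k x - 2 * flux_curv k x)
  + (1 + lam) / 2 * flux_defect k x.

Lemma smooth_flux_hess k : smooth_on setT (flux_hess k).
Proof.
apply: smooth_on_sum openT _ => l; apply: smooth_onB openT _ _; exact: smooth_section_dot.
Qed.

Lemma smooth_flux_curv k : smooth_on setT (flux_curv k).
Proof. by apply: smooth_on_sum openT _ => l; exact: smooth_section_dot. Qed.

Lemma smooth_flux_defect k : smooth_on setT (flux_defect k).
Proof.
exact: (smooth_onM openT smooth_defect (smooth_on_partial k smooth_defect)).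
Qed.

Let smooth_flux1 k : smooth_on setT (fun x => flux_hess k x - 2 * flux_curv k x).
Proof.
exact: (smooth_onB openT (smooth_flux_hess k)
  (smooth_onM openT (smooth_on_cst 2 openT) (smooth_flux_curv k))).
Qed.

Lemma smooth_flux k : smooth_on setT (flux k).
Proof.
exact: (smooth_onD openT (smooth_onM openT (smooth_on_cst (eps ^+ 2) openT) (@smooth_flux1 k))
  (smooth_onM openT (smooth_on_cst ((1 + lam) / 2) openT) (smooth_flux_defect k))).
Qed.

Lemma partial_flux k x : partial k (flux k) x = eps ^+ 2 * partial k (flux_hess k) x
  - 2 * (eps ^+ 2 * partial k (flux_curv k) x) + (1 + lam) / 2 * partial k (flux_defect k) x.
Proof.
have c2 := smooth_on_cst (2 : R) (@openT 'rV[R]_3).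
have ce := smooth_on_cst (eps ^+ 2) (@openT 'rV[R]_3).
have cl := smooth_on_cst ((1 + lam) / 2) (@openT 'rV[R]_3).
have sV2 := smooth_onM openT c2 (smooth_flux_curv k).
rewrite /flux (partialD k (smooth_onM openT ce (@smooth_flux1 k))
  (smooth_onM openT cl (smooth_flux_defect k)) I).
rewrite (partialM k ce (@smooth_flux1 k) I) (partialM k cl (smooth_flux_defect k) I).
rewrite (partialD k (smooth_flux_hess k) (smooth_onN openT sV2) I) (partialN k sV2 I).
by rewrite (partialM k c2 (smooth_flux_curv k) I) !partial_cst; ring.
Qed.

Lemma coercive_identity x : coercive x = cubic x + \sum_(k < 3) partial k (flux k) x.
Proof.
have E1 : \sum_(k < 3) partial k (flux k) x
    = eps ^+ 2 * \sum_(k < 3) partial k (flux_hess k) x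
      - 2 * (eps ^+ 2 * \sum_(k < 3) partial k (flux_curv k) x)
      + (1 + lam) / 2 * \sum_(k < 3) partial k (flux_defect k) x.
  by rewrite !mulr_sumr -sumrB -sum3D; apply: eq_bigr => k _; rewrite partial_flux.
rewrite E1 div_flux_hess div_flux_curv div_flux_defect /coercive /cubic.
have := grad_sqr_split x.
move: (grad_sqr x) (hess_sqr x) (current_sqr x) (curv_perp_sqr x) (defect_grad_sqr x)
  (u x) (higgs_sqr x) (triple x) => a b c f d v q t split_a.
have {split_a}-> : c = a - 4^-1 * d - v * a by rewrite {1}split_a; ring.
by field; rewrite gt_eqF.
Qed.

End Identities.

(** * Liouville theorems *)

Section Liouville.
Variable R : realType.
Implicit Types (f : 'rV[R]_3 -> R) (w : 'I_3 -> 'I_3 -> 'rV[R]_3 -> R).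

(** Cauchy-Schwarz without square roots: the factors are only known through a bound on the square of
    each term. Used with nested sums, it bounds pairings of tensors. *)
Lemma sqr_sum_le (I : Type) (r : seq I) (f g h : I -> R) :
  (forall i, 0 <= g i) -> (forall i, 0 <= h i) -> (forall i, f i ^+ 2 <= g i * h i) ->
  (\sum_(i <- r) f i) ^+ 2 <= (\sum_(i <- r) g i) * \sum_(i <- r) h i.
Proof.
move=> g0 h0 fgh.
suff [] : [/\ (\sum_(i <- r) f i) ^+ 2 <= (\sum_(i <- r) g i) * \sum_(i <- r) h i,
    0 <= \sum_(i <- r) g i & 0 <= \sum_(i <- r) h i] by [].
elim/big_rec3: _ => [|i H G F _ [FGH G0 H0]]; first by rewrite expr0n mul0r.
split; [|exact: addr_ge0|exact: addr_ge0].
have := fgh i; move: (g0 i) (h0 i) FGH G0 H0; move: (f i) (g i) (h i) => p q s q0 s0 FGH G0 H0 pqs.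
have cross : 2 * (p * F) <= q * H + G * s.
  apply: le_trans (ler_norm _) _.
  rewrite -(@ler_pXn2r _ 2)// ?nnegrE ?addr_ge0 ?mulr_ge0// real_normK ?num_real//.
  have : (p * F) ^+ 2 <= (q * s) * (G * H) by rewrite exprMn ler_pM ?sqr_ge0.
  have := sqr_ge0 (q * H - G * s); nra.
rewrite sqrrD; nra.
Qed.

Lemma young_le (p g h s : R) : 0 < s -> 0 <= g -> 0 <= h -> p ^+ 2 <= g * h ->
  2 * p <= s^-1 * g + s * h.
Proof.
move=> s0 g0 h0 pgh; have s1 : 0 <= s^-1 by rewrite invr_ge0 ltW.
apply: le_trans (ler_norm _) _.
rewrite -(@ler_pXn2r _ 2)// ?nnegrE ?addr_ge0 ?mulr_ge0// ?(ltW s0)// real_normK ?num_real//.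
have E1 : s^-1 * g * (s * h) = g * h by field; rewrite gt_eqF.
have := sqr_ge0 (s^-1 * g - s * h); rewrite sqrrB sqrrD E1; nra.
Qed.

Lemma constant_L2_eq0 f B : smooth_on setT f -> (forall k x, partial k f x = 0) ->
  (forall L, 0 < L -> boxint L (fun x => f x * f x) <= B) -> forall x, f x = 0.
Proof.
move=> sf f0 fB x; have fc := constant_of_partial0 sf f0.
apply/eqP; rewrite -sqrf_eq0; apply/eqP/le_anti; rewrite sqr_ge0 andbT leNgt.
apply/negP => c0; set c := f x ^+ 2 in c0.
have B0 : 0 <= B by apply: le_trans (fB 1 ltr01); apply: boxint_ge0 => p _; rewrite -expr2 sqr_ge0.
(* The box of half-side [L] has volume [8 L^3], which exceeds [B / c]. *)
pose L := 1 + B / c.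
have Bc : 0 <= B / c by rewrite divr_ge0// ltW.
have L0 : 0 < L by rewrite /L; lra.
have := fB L L0.
have -> : (fun y => f y * f y) = (fun=> c) by apply/funext => y; rewrite (fc y x) /c expr2.
rewrite boxint_cst ?(ltW L0)// leNgt => /negP; apply.
have E1 : B = c * (B / c) by field; rewrite gt_eqF.
rewrite {1}E1 ltr_pM2l// -mulr_natl.
by rewrite /L; move: (B / c) Bc => z z0; nra.
Qed.

(** For harmonic [f] the divergence of f df is |df|^2, so [small_energy_vanishing] applies without a
    cubic term and gives df = 0; a square-integrable constant is 0. *)
Lemma harmonic_L2_eq0 f B : smooth_on setT f ->
  (forall x, \sum_(k < 3) partial k (partial k f) x = 0) ->
  (forall L, 0 < L -> boxint L (fun x => f x * f x) <= B) -> forall x, f x = 0.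
Proof.
move=> sf hf fB.
have sdf k : smooth_on setT (partial k f) by exact: smooth_on_partial.
have B0 : 0 <= B by apply: le_trans (fB 1 ltr01); apply: boxint_ge0 => p _; rewrite -expr2 sqr_ge0.
have sN : smooth_on setT (fun x => \sum_(k < 3) partial k f x * partial k f x).
  apply: smooth_on_sum openT _ => k; exact: smooth_onM openT _ _.
have z0 : smooth_on setT (fun _ : 'rV[R]_3 => 0 : R) by exact: smooth_on_cst openT.
have cz : continuous (fun _ : 'rV[R]_3 => 0 : R) by exact: smooth_continuous.
have le_N k x : partial k f x * partial k f x <= \sum_(j < 3) partial j f x * partial j f x.
  rewrite (bigD1 k)//= lerDl; apply: sumr_ge0 => j _; rewrite -expr2; exact: sqr_ge0.
have [tau [tau0 tau1]] : exists tau : R, 0 < tau /\ 1308 * (1 * tau) <= 1.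
  by exists 1308^-1; split; lra.
have van x : \sum_(k < 3) partial k f x * partial k f x = 0.
  pose W k x := f x * partial k f x.
  pose N x := \sum_(k < 3) partial k f x * partial k f x.
  have fW k y : partial k (W k) y
      = partial k f y * partial k f y + f y * partial k (partial k f) y.
    exact: partialM sf (sdf k) I.
  apply: (@small_energy_vanishing R (fun=> 0) (fun x => f x * f x) N (fun=> 0) (fun=> 0)
    W 1 1 tau 1 B).
  - exact: ltr01.
  - exact: ltr01.
  - exact: tau0.
  - exact: ler01.
  - exact: B0.
  - exact: tau1.
  - exact: z0.
  - by move=> k; exact: smooth_onM openT sf (sdf k).
  - exact: smooth_continuous (smooth_onM openT sf sf).
  - exact: smooth_continuous sN.
  - exact: cz.
  - exact: cz.
  - by move=> y.
  - by move=> y; rewrite -expr2 sqr_ge0.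
  - by move=> y; apply: sumr_ge0 => k _; rewrite -expr2 sqr_ge0.
  - by move=> y.
  - by move=> y; rewrite add0r (eq_bigr _ (fun k _ => fW k y)) big_split /= -mulr_sumr hf mulr0 addr0.
  - by move=> s y s0; rewrite !mulr0 addr0 mulr0.
  - move=> k y; rewrite mul1r exprMn expr2; apply: ler_wpM2l; first by rewrite -expr2 sqr_ge0.
    by rewrite expr2; exact: le_N.
  - by move=> k y; rewrite partial_cst expr0n /= mul0r !mulr0.
  - exact: fB.
  - by move=> L L0; rewrite boxint_cst ?(ltW L0)// mul0r expr1n mulr1 sqr_ge0.
apply: (@constant_L2_eq0 _ B) => // k x; apply/eqP; rewrite -sqrf_eq0 eq_le sqr_ge0 andbT.
by rewrite expr2 -(van x); exact: le_N.
Qed.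

(** Closedness rewrites [partial k (w l m)] through [w k m] and [w k l]; after a further [partial k]
    and summation over [k], both terms are derivatives of the vanishing divergence. *)
Lemma closed_coclosed_harmonic w l m : (forall j k, smooth_on setT (w j k)) ->
  (forall k j x, w j k x = - w k j x) ->
  (forall k x, \sum_(j < 3) partial j (w j k) x = 0) ->
  (forall i j k x, partial i (w j k) x + partial j (w k i) x + partial k (w i j) x = 0) ->
  forall x, \sum_(k < 3) partial k (partial k (w l m)) x = 0.
Proof.
move=> sw wN div0 dw x.
have sd i j k : smooth_on setT (partial i (w j k)) by exact: smooth_on_partial.
have dN i j k y : partial i (w j k) y = - partial i (w k j) y.
  have -> : w j k = (fun y => - w k j y) by apply/funext => z; exact: wN.
  exact: partialN I.
have E1 k : partial k (partial k (w l m)) x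
    = partial l (partial k (w k m)) x - partial m (partial k (w k l)) x.
  have -> : partial k (w l m) = (fun y => partial l (w k m) y - partial m (w k l) y).
    apply/funext => y; have := dw k l m y; rewrite (dN l m k) => H.
    by apply/eqP; rewrite -subr_eq0 opprB addrA addrAC; apply/eqP.
  rewrite (partialD k (sd l k m) (smooth_onN openT (sd m k l)) I) (partialN k (sd m k l) I).
  by rewrite (partialC k l openT (sw k m) I) (partialC k m openT (sw k l) I).
have z j n : \sum_(k < 3) partial j (partial k (w k n)) x = 0.
  rewrite -(@partial_sum _ setT)//.
  have -> : (fun y => \sum_(k < 3) partial k (w k n) y) = (fun=> 0) by apply/funext => y.
  exact: partial_cst.
rewrite (eq_bigr _ (fun k _ => E1 k)) sumrB [X in X - _](z l m) [X in _ - X](z m l).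
exact: subr0.
Qed.

End Liouville.

(** * The energy gap *)

Section Estimates.
Variables (R : realType) (E : SU2_bundle R) (D : connection E) (Phi : su_section E).
Variables (lam eps : R).
Hypotheses (lam0 : 0 < lam) (eps0 : 0 < eps).
Implicit Types (k l m : 'I_3) (x : 'rV[R]_3) (S T V : su_section E).
Notation dot := section_dot.
Notation F := (curv_section D).
Notation DP l := (cov_section D l Phi).
Notation H k l := (cov_section D k (cov_section D l Phi)).
Notation u := (higgs_defect Phi).
Notation a := (grad_sqr D Phi).
Notation b := (hess_sqr D Phi).
Notation c := (current_sqr D Phi).
Notation Q := (curv_sqr2 D).
Notation N := (coercive D Phi lam eps).
Notation e := (density D Phi lam eps).

Let lamw0 : 0 <= lam / (4 * eps ^+ 2).
Proof. by apply: divr_ge0; [exact: ltW|rewrite mulr_ge0 ?sqr_ge0]. Qed.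

Let dot0 S x : 0 <= dot S S x := section_dot_ge0 S x.

Lemma sum_ge_term (p : 'I_3 -> R) k : (forall j, 0 <= p j) -> p k <= \sum_(j < 3) p j.
Proof. by move=> p0; rewrite (bigD1 k)//= lerDl; apply: sumr_ge0 => j _. Qed.

Lemma grad_sqr_ge0 x : 0 <= a x.
Proof. by apply: sumr_ge0 => k _; exact: dot0. Qed.

Lemma hess_sqr_ge0 x : 0 <= b x.
Proof. by do 2!(apply: sumr_ge0 => ? _); exact: dot0. Qed.

Lemma curv_sqr2_ge0 x : 0 <= Q x.
Proof. by do 2!(apply: sumr_ge0 => ? _); exact: dot0. Qed.

Lemma current_sqr_ge0 x : 0 <= c x.
Proof. by apply: sumr_ge0 => k _; exact: dot0. Qed.

Lemma curv_perp_sqr_ge0 x : 0 <= curv_perp_sqr D Phi x.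
Proof. by rewrite mulr_ge0// ?invr_ge0//; do 2!(apply: sumr_ge0 => ? _); exact: dot0. Qed.

Lemma defect_grad_sqr_ge0 x : 0 <= defect_grad_sqr Phi x.
Proof. by apply: sumr_ge0 => k _; exact: sqr_ge0. Qed.

Lemma sum_lt3 (p : 'I_3 -> 'I_3 -> R) : (forall k, p k k = 0) -> (forall k l, p k l = p l k) ->
  \sum_(k < 3) \sum_(l < 3 | (k < l)%N) p k l = 2^-1 * \sum_(k < 3) \sum_(l < 3) p k l.
Proof.
move=> p0 pC; have swap : \sum_(k < 3) \sum_(l < 3 | (k < l)%N) p k l
    = \sum_(k < 3) \sum_(l < 3 | (l < k)%N) p k l.
  rewrite (exchange_big_dep predT)//=; apply: eq_bigr => l _; apply: eq_bigr => k _; exact: pC.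
have -> : \sum_(k < 3) \sum_(l < 3) p k l
    = \sum_(k < 3) \sum_(l < 3 | (k < l)%N) p k l + \sum_(k < 3) \sum_(l < 3 | (l < k)%N) p k l.
  rewrite -big_split; apply: eq_bigr => k _ /=.
  rewrite [LHS](bigID (fun l : 'I_3 => (k < l)%N)) /=; congr (_ + _).
  rewrite (bigD1 k) /= ?ltnn// p0 add0r; apply: eq_bigl => l.
  by rewrite -leqNgt ltn_neqAle andbC.
by rewrite -swap; move: (\sum_(k < 3) _) => z; field.
Qed.

Lemma densityE x : e x = eps ^+ 2 * (2^-1 * Q x) + a x + lam / (4 * eps ^+ 2) * u x ^+ 2.
Proof.
rewrite /density /local_density; congr (_ * _ + _ + _).
- rewrite -sum_lt3.
  + apply: eq_bigr => k _; apply: eq_bigr => l _; by rewrite section_dot_at curv_sectionE.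
  + by move=> k; have := section_dot_curvN D k k (F k k) x; move: (dot _ _ _) => z; lra.
  + by move=> k l; rewrite section_dot_curvN section_dotC section_dot_curvN opprK.
- by apply: eq_bigr => k _; rewrite section_dot_at cov_sectionE.
- by rewrite /higgs_defect section_dot_at.
Qed.

Lemma grad_sqr_le_density x : a x <= e x.
Proof.
rewrite densityE; have := curv_sqr2_ge0 x; have := sqr_ge0 (u x).
have := lamw0; have := sqr_ge0 eps; move: (eps ^+ 2) (lam / _) (u x ^+ 2) (a x) (Q x) => *; nra.
Qed.

Lemma curv_sqr2_le_density x : eps ^+ 2 * Q x <= 2 * e x.
Proof.
rewrite densityE; have := grad_sqr_ge0 x.
have : 0 <= lam / (4 * eps ^+ 2) * u x ^+ 2.
  by rewrite mulr_ge0 ?sqr_ge0.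
move: (a x) (Q x) (eps ^+ 2) (lam / _ * _) => *; nra.
Qed.

Lemma defect_le_density x : u x ^+ 2 <= 4 * eps ^+ 2 / lam * e x.
Proof.
have -> : u x ^+ 2 = 4 * eps ^+ 2 / lam * (lam / (4 * eps ^+ 2) * u x ^+ 2).
  by field; rewrite !gt_eqF.
apply: ler_wpM2l; first by apply: divr_ge0; [rewrite mulr_ge0 ?sqr_ge0|exact: ltW].
by rewrite densityE lerDr addr_ge0 ?grad_sqr_ge0// mulr_ge0 ?sqr_ge0// mulr_ge0 ?curv_sqr2_ge0.
Qed.

Lemma density_ge0 x : 0 <= e x.
Proof. exact: le_trans (grad_sqr_ge0 x) (grad_sqr_le_density x). Qed.

Lemma coercive_ge x : [/\ a x <= N x, eps ^+ 2 * b x <= N x, c x <= N x,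
  4^-1 * defect_grad_sqr Phi x <= N x & eps ^+ 2 * curv_perp_sqr D Phi x <= N x].
Proof.
have := grad_sqr_ge0 x; have := hess_sqr_ge0 x; have := current_sqr_ge0 x.
have := curv_perp_sqr_ge0 x; have := defect_grad_sqr_ge0 x.
have : 0 <= lam / eps ^+ 2 * (u x ^+ 2 * higgs_sqr Phi x).
  apply: mulr_ge0; first by apply: divr_ge0; [exact: ltW|exact: sqr_ge0].
  by apply: mulr_ge0; [exact: sqr_ge0|exact: dot0].
rewrite /coercive; have := sqr_ge0 eps; move: (eps ^+ 2) (a x) (b x) (c x) (curv_perp_sqr D Phi x)
  (defect_grad_sqr Phi x) (lam / _ * _) => w p q r s t z.
move=> w0 z0 t0 s0 r0 q0 p0.
have wq := mulr_ge0 w0 q0; have ws := mulr_ge0 w0 s0.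
have lt := mulr_ge0 (ltW lam0) t0; have lz := mulr_ge0 (ltW lam0) z0.
by split; lra.
Qed.

Lemma flux_curv_le k x : flux_curv D Phi k x ^+ 2 <= Q x * c x.
Proof.
apply: le_trans (_ : (\sum_(l < 3) dot (F k l) (F k l) x) * c x <= _).
  apply: sqr_sum_le => [l|l|l]; [exact: dot0|exact: dot0|exact: section_dot_sqr_le].
rewrite ler_wpM2r ?current_sqr_ge0//.
apply: (sum_ge_term (p := fun j => \sum_(l < 3) dot (F j l) (F j l) x)) => j.
by apply: sumr_ge0 => l _.
Qed.

(** The two sums in the flux have squares at most [a x * b x] and [3 * (a x * b x)], the 3 being the
    number of diagonal terms; [8 = 2 * (1 + 3)]. *)
Lemma flux_hess_le k x : flux_hess D Phi k x ^+ 2 <= 8 * (a x * b x).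
Proof.
rewrite /flux_hess sumrB.
have h0 i : 0 <= \sum_(l < 3) dot (H i l) (H i l) x by apply: sumr_ge0 => l _; exact: dot0.
have le1 : (\sum_(l < 3) dot (H l k) (DP l) x) ^+ 2 <= b x * a x.
  apply: (@sqr_sum_le _ _ _ _ (fun l => \sum_(m < 3) dot (H l m) (H l m) x)) => [l|l|l].
  - exact: h0.
  - exact: dot0.
  - apply: le_trans (section_dot_sqr_le _ _ _) _; rewrite ler_wpM2r ?dot0//.
    exact: (sum_ge_term (p := fun j => dot (H l j) (H l j) x)).
have le2 : (\sum_(l < 3) dot (H l l) (DP k) x) ^+ 2 <= b x * (3 * a x).
  have -> : 3 * a x = \sum_(l < 3) a x by rewrite sumr_const card_ord mulr_natl.
  apply: (@sqr_sum_le _ _ _ _ (fun l => \sum_(m < 3) dot (H l m) (H l m) x)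
    (fun=> a x)) => [l|l|l].
  - exact: h0.
  - exact: grad_sqr_ge0.
  - apply: le_trans (section_dot_sqr_le _ _ _) _; apply: ler_pM; rewrite ?dot0//.
      exact: (sum_ge_term (p := fun j => dot (H l j) (H l j) x)).
    exact: (sum_ge_term (p := fun j => dot (DP j) (DP j) x)).
move: le1 le2; move: (\sum_(l < 3) _) (\sum_(l < 3) _) (a x) (b x) => p q r s.
have := sqr_ge0 (p + q); rewrite sqrrD sqrrB; nra.
Qed.

Lemma flux_defect_le k x :
  flux_defect Phi k x ^+ 2 <= u x ^+ 2 * defect_grad_sqr Phi x.
Proof.
rewrite /flux_defect exprMn ler_wpM2l ?sqr_ge0//.
by apply: (sum_ge_term (p := fun j => partial j u x ^+ 2)) => j; exact: sqr_ge0.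
Qed.

(** Three times the sum of the bounds for the three parts of [flux], of which the first two are
    [8 * eps ^+ 2] each. Its value enters only terms that vanish as the box grows. *)
Definition flux_bound := 48 * eps ^+ 2 + 12 * ((1 + lam) ^+ 2 * eps ^+ 2 / lam).

Lemma flux_bound_ge0 : 0 <= flux_bound.
Proof.
apply: addr_ge0; first by rewrite mulr_ge0 ?sqr_ge0.
by rewrite mulr_ge0// divr_ge0 ?(ltW lam0)// mulr_ge0 ?sqr_ge0.
Qed.

Lemma flux_le k x : flux D Phi lam eps k x ^+ 2 <= flux_bound * (e x * N x).
Proof.
have [aN bN cN dN _] := coercive_ge x.
have N0 : 0 <= N x := le_trans (grad_sqr_ge0 x) aN.
have w0 : 0 <= eps ^+ 2 := sqr_ge0 eps.
have H1 : (eps ^+ 2 * flux_hess D Phi k x) ^+ 2 <= 8 * eps ^+ 2 * (e x * N x).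
  rewrite exprMn; apply: le_trans (ler_wpM2l _ (flux_hess_le k x)) _; first exact: sqr_ge0.
  have : a x * (eps ^+ 2 * b x) <= e x * N x.
    apply: ler_pM => //; [exact: grad_sqr_ge0|by rewrite mulr_ge0 ?hess_sqr_ge0|].
    exact: grad_sqr_le_density.
  by move: (eps ^+ 2) w0 (a x) (b x) (e x * N x) => w w0 p q r; nra.
have H2 : (2 * (eps ^+ 2 * flux_curv D Phi k x)) ^+ 2 <= 8 * eps ^+ 2 * (e x * N x).
  rewrite !exprMn.
  have : flux_curv D Phi k x ^+ 2 * eps ^+ 2 <= 2 * (e x * N x).
    apply: le_trans (ler_wpM2r w0 (flux_curv_le k x)) _.
    rewrite mulrAC [Q x * _]mulrC mulrA; apply: ler_pM => //.
    - by rewrite mulr_ge0 ?curv_sqr2_ge0.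
    - exact: current_sqr_ge0.
    - exact: curv_sqr2_le_density.
  by move: (eps ^+ 2) w0 (_ ^+ 2) (e x * N x) => w w0 p q; nra.
have H3 : ((1 + lam) / 2 * flux_defect Phi k x) ^+ 2
    <= 4 * ((1 + lam) ^+ 2 * eps ^+ 2 / lam) * (e x * N x).
  rewrite exprMn.
  have H4 : flux_defect Phi k x ^+ 2 <= 4 * eps ^+ 2 / lam * e x * (4 * N x).
    apply: le_trans (flux_defect_le k x) _; apply: ler_pM.
    - exact: sqr_ge0.
    - exact: defect_grad_sqr_ge0.
    - exact: defect_le_density.
    - by move: dN; move: (defect_grad_sqr _ _) (N x) => p q; lra.
  apply: le_trans (ler_wpM2l (sqr_ge0 _) H4) _; rewrite le_eqVlt; apply/orP; left; apply/eqP.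
  by field; rewrite gt_eqF.
have -> : flux D Phi lam eps k x = eps ^+ 2 * flux_hess D Phi k x
    - 2 * (eps ^+ 2 * flux_curv D Phi k x) + (1 + lam) / 2 * flux_defect Phi k x.
  by rewrite /flux; ring.
rewrite /flux_bound; move: H1 H2 H3.
move: (eps ^+ 2) (_ / lam) (e x * N x) (eps ^+ 2 * flux_hess _ _ _ _)
  (2 * (eps ^+ 2 * flux_curv _ _ _ _)) (_ / 2 * _) => w z n p q r H1 H2 H3.
have : (p - q + r) ^+ 2 <= 3 * (p ^+ 2 + q ^+ 2 + r ^+ 2).
  have := sqr_ge0 (p + q); have := sqr_ge0 (p - r); have := sqr_ge0 (q + r).
  rewrite !sqrrD !sqrrN; nra.
nra.
Qed.

Lemma partial_grad_sqr_le k x : eps ^+ 2 * partial k a x ^+ 2 <= 4 * (a x * N x).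
Proof.
have -> : partial k a x = 2 * \sum_(l < 3) dot (H k l) (DP l) x.
  rewrite /grad_sqr (@partial_sum _ setT)//; last by move=> l; exact: smooth_section_dot.
  rewrite mulr_sumr; apply: eq_bigr => l _; rewrite (partial_section_dot D).
  by rewrite [X in _ + X]section_dotC -mulr2n mulr_natl.
have [_ bN _ _ _] := coercive_ge x.
have le1 : (\sum_(l < 3) dot (H k l) (DP l) x) ^+ 2 <= b x * a x.
  apply: le_trans (_ : (\sum_(l < 3) dot (H k l) (H k l) x) * a x <= _).
    apply: sqr_sum_le => [l|l|l]; [exact: dot0|exact: dot0|exact: section_dot_sqr_le].
  rewrite ler_wpM2r ?grad_sqr_ge0//.
  apply: (sum_ge_term (p := fun j => \sum_(l < 3) dot (H j l) (H j l) x)) => j.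
  by apply: sumr_ge0 => l _.
rewrite exprMn; apply: le_trans (_ : 4 * ((eps ^+ 2 * b x) * a x) <= _).
  by move: le1 (sqr_ge0 eps); move: (_ ^+ 2) (_ ^+ 2) (a x) (b x) => p w r q; nra.
by rewrite ler_wpM2l// mulrC ler_wpM2l ?grad_sqr_ge0.
Qed.

(** Two nested uses of Cauchy-Schwarz, together with |[X, Y]| <= |X| |Y|, which is Lagrange's
    identity with a square dropped. *)
Lemma triple_sqr_le x : triple D Phi x ^+ 2 <= Q x * a x ^+ 2.
Proof.
have -> : a x ^+ 2 = \sum_(k < 3) dot (DP k) (DP k) x * a x by rewrite -mulr_suml expr2.
apply: sqr_sum_le => [k|k|k].
- by apply: sumr_ge0 => l _; exact: dot0.
- by rewrite mulr_ge0 ?dot0 ?grad_sqr_ge0.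
rewrite {1}/grad_sqr mulr_sumr; apply: sqr_sum_le => [l|l|l].
- exact: dot0.
- by rewrite mulr_ge0 ?dot0.
apply: le_trans (section_dot_sqr_le _ _ _) _; rewrite ler_wpM2l ?dot0//.
by rewrite [leRHS]mulrC section_dot_sqrE lerDr sqr_ge0.
Qed.

(** The quantity h of the overview, with |F|^2 counted twice by the full double sum in
    [curv_sqr2]. *)
Definition forcing x := eps ^+ 4 * Q x + u x ^+ 2.

(** Young's inequality with the same [s] for both products; the resulting coefficients, at most
    [5 / 2 + lam / 2] on the quartic term, are rounded up to a common [4 + lam]. *)
Lemma cubic_le (s : R) x : 0 < s ->
  cubic D Phi lam eps x <= (4 + lam) * (s^-1 * forcing x + s * (a x * a x)).
Proof.
move=> s0; have a0 := grad_sqr_ge0 x; have Q0 := curv_sqr2_ge0 x.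
have aa0 : 0 <= a x ^+ 2 := sqr_ge0 _.
have H1 : 2 * (eps ^+ 2 * triple D Phi x) <= s^-1 * (eps ^+ 4 * Q x) + s * a x ^+ 2.
  apply: young_le => //; first by rewrite mulr_ge0 ?exprn_ge0 ?(ltW eps0).
  by rewrite exprMn -exprM -mulrA ler_wpM2l ?exprn_ge0 ?(ltW eps0)// triple_sqr_le.
have H2 : 2 * (u x * a x) <= s^-1 * u x ^+ 2 + s * a x ^+ 2.
  by apply: young_le => //; [exact: sqr_ge0|rewrite exprMn].
have si0 : 0 <= s^-1 by rewrite invr_ge0 ltW.
have P1 : 0 <= s^-1 * (eps ^+ 4 * Q x) by rewrite !mulr_ge0 ?exprn_ge0 ?(ltW eps0).
have P2 : 0 <= s^-1 * u x ^+ 2 by rewrite mulr_ge0 ?sqr_ge0.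
have P3 : 0 <= s * a x ^+ 2 by rewrite mulr_ge0 ?(ltW s0).
rewrite /cubic.
have -> : 3 * eps ^+ 2 * triple D Phi x + (2 + lam) * u x * a x
   = 3 * (eps ^+ 2 * triple D Phi x) + (2 + lam) * (u x * a x) by ring.
rewrite /forcing [s^-1 * (_ + _)]mulrDr -[a x * a x]expr2.
move: H1 H2 P1 P2 P3; move: (eps ^+ 2 * _) (u x * a x) (s^-1 * _) (s^-1 * _) (s * _).
move=> p q r v w H1 H2 r0 v0 w0; have l0 := ltW lam0.
have lr := mulr_ge0 l0 r0; have lv := mulr_ge0 l0 v0; have lw := mulr_ge0 l0 w0.
have := ler_wpM2l l0 H2; lra.
Qed.

Lemma forcing_le x : forcing x <= (2 + 4 / lam) * eps ^+ 2 * e x.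
Proof.
have := defect_le_density x; have := ler_wpM2l (sqr_ge0 eps) (curv_sqr2_le_density x).
have -> : (2 + 4 / lam) * eps ^+ 2 * e x
    = eps ^+ 2 * (2 * e x) + 4 * eps ^+ 2 / lam * e x by field; rewrite gt_eqF.
have -> : forcing x = eps ^+ 2 * (eps ^+ 2 * Q x) + u x ^+ 2 by rewrite /forcing; ring.
by move=> *; exact: lerD.
Qed.

Lemma smooth_grad_sqr : smooth_on setT a.
Proof. by apply: smooth_on_sum openT _ => k; exact: smooth_section_dot. Qed.

Let smooth_sum2 (p : 'I_3 -> 'I_3 -> 'rV[R]_3 -> R) : (forall k l, smooth_on setT (p k l)) ->
  smooth_on setT (fun x => \sum_(k < 3) \sum_(l < 3) p k l x).
Proof. by move=> sp; do 2!(apply: smooth_on_sum openT _ => ?); exact: sp. Qed.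

Let smoothZ (r : R) p : smooth_on setT p -> smooth_on setT (fun x : 'rV[R]_3 => r * p x).
Proof. by move=> sp; exact: smooth_onM openT (smooth_on_cst r openT) sp. Qed.

Let smooth_sqr p : smooth_on setT p -> smooth_on setT (fun x : 'rV[R]_3 => p x ^+ 2).
Proof.
move=> sp; apply: (smooth_on_eq openT) (smooth_onM openT sp sp) => x _; exact: expr2.
Qed.

Let smooth_curv_sqr2 : smooth_on setT Q.
Proof. by apply: smooth_sum2 => k l; exact: smooth_section_dot. Qed.

Lemma smooth_forcing : smooth_on setT forcing.
Proof.
exact: smooth_onD openT (smoothZ _ smooth_curv_sqr2) (smooth_sqr (smooth_defect Phi)).
Qed.

Lemma smooth_density : smooth_on setT e.
Proof.
apply: (smooth_on_eq openT (fun x _ => esym (densityE x))).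
exact: smooth_onD openT (smooth_onD openT (smoothZ _ (smoothZ _ smooth_curv_sqr2)) smooth_grad_sqr)
  (smoothZ _ (smooth_sqr (smooth_defect Phi))).
Qed.

Lemma smooth_cubic : smooth_on setT (cubic D Phi lam eps).
Proof.
apply: smooth_onD openT (smoothZ _ _) (smooth_onM openT (smoothZ _ (smooth_defect Phi)) smooth_grad_sqr).
by apply: smooth_sum2 => k l; exact: smooth_section_dot.
Qed.

Lemma smooth_coercive : smooth_on setT N.
Proof.
apply: smooth_onD openT _ (smoothZ _ (smoothZ _ (smooth_onM openT (smooth_sqr (smooth_defect Phi)) _)));
  last exact: smooth_section_dot.
apply: smooth_onD openT _ (smoothZ _ _); last first.
  apply: smooth_on_sum openT _ => k; apply: smooth_sqr; apply: smooth_on_partial.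
  exact: smooth_defect.
apply: smooth_onD openT _ (smoothZ _ (smoothZ _ _)); last first.
  by apply: smooth_sum2 => k l; exact: smooth_section_dot.
apply: smooth_onD openT _ _; last by apply: smooth_on_sum openT _ => k; exact: smooth_section_dot.
apply: smooth_onD openT smooth_grad_sqr (smoothZ _ _).
by apply: smooth_sum2 => k l; exact: smooth_section_dot.
Qed.

End Estimates.

(** * Vanishing of the energy density *)

Section Gap.
Variables (R : realType) (E : SU2_bundle R) (D : connection E) (Phi : su_section E).
Variables (lam eps C0 tau B : R).
Hypotheses (lam0 : 0 < lam) (eps0 : 0 < eps) (sol : YMH_solution D Phi lam eps).
Hypotheses (lamC : 4 + lam <= C0) (tau0 : 0 < tau) (small : 1308 * (C0 * tau) <= 1).
Notation dot := section_dot.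
Notation F := (curv_section D).
Notation DP l := (cov_section D l Phi).
Notation e := (density D Phi lam eps).
Notation u := (higgs_defect Phi).
Hypothesis int_e : forall L, 0 < L -> boxint L e <= B.
Hypothesis int_forcing :
  forall L, 0 < L -> boxint L (forcing D Phi eps) <= tau ^+ 2 * eps ^+ 3.
Implicit Types (k l m : 'I_3) (x : 'rV[R]_3).

Let C00 : 0 < C0. Proof. by move: lamC lam0; lra. Qed.

Let ce : continuous e. Proof. exact: smooth_continuous (smooth_density D Phi lam eps). Qed.

Let B0 : 0 <= B.
Proof.
apply: le_trans (int_e ltr01); apply: boxint_ge0 => p _; exact: density_ge0.
Qed.

Let bounded_by_density c (f : 'rV[R]_3 -> R) : 0 <= c -> continuous f ->
  (forall x, f x <= c * e x) -> forall L, 0 < L -> boxint L f <= c * B.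
Proof.
move=> c0 cf fe L L0; apply: le_trans (_ : boxint L (fun x => c * e x) <= _).
  by apply: boxint_le => //; exact: continuous_funZ.
by rewrite boxintZ// ler_wpM2l// int_e.
Qed.

Lemma coercive_eq0 x : coercive D Phi lam eps x = 0.
Proof.
have W0 := flux_bound_ge0 eps lam0.
apply: (@small_energy_vanishing R (grad_sqr D Phi) e _ (forcing D Phi eps)
  (cubic D Phi lam eps) (flux D Phi lam eps) eps C0 tau (flux_bound lam eps) B) => //.
- exact: smooth_grad_sqr.
- by move=> k; exact: smooth_flux.
- by apply: smooth_continuous; exact: smooth_coercive.
- by apply: smooth_continuous; exact: smooth_forcing.
- by apply: smooth_continuous; exact: smooth_cubic.
- by move=> y; exact: grad_sqr_ge0.
- by move=> y; exact: grad_sqr_le_density.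
- by move=> y; have [] := coercive_ge D Phi eps lam0 y.
- move=> y; rewrite /forcing addr_ge0 ?sqr_ge0// mulr_ge0 ?exprn_ge0 ?(ltW eps0)//.
  exact: curv_sqr2_ge0.
- by move=> y; rewrite (coercive_identity eps0 sol).
- move=> s y s0; apply: le_trans (cubic_le D Phi lam0 eps0 y s0) _; apply: ler_wpM2r => //.
  apply: addr_ge0; apply: mulr_ge0; rewrite ?invr_ge0 ?(ltW s0)//; last by rewrite -expr2 sqr_ge0.
  rewrite /forcing addr_ge0 ?sqr_ge0// mulr_ge0 ?exprn_ge0 ?(ltW eps0)//.
  exact: curv_sqr2_ge0.
- by move=> k y; exact: flux_le.
- by move=> k y; exact: partial_grad_sqr_le.
Qed.

Let N_ge x := coercive_ge D Phi eps lam0 x.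

Lemma grad_sqr_eq0 x : grad_sqr D Phi x = 0.
Proof.
apply/le_anti; rewrite grad_sqr_ge0 andbT -(coercive_eq0 x).
by have [] := N_ge x.
Qed.

Let dot_DP k S x : dot (DP k) S x = 0.
Proof.
apply: section_dot0l; apply/le_anti; rewrite section_dot_ge0 andbT -(grad_sqr_eq0 x).
by apply: (@sum_ge_term _ (fun j => dot (DP j) (DP j) x)) => j; exact: section_dot_ge0.
Qed.

Let FP0 k l x : dot (comm_section (F k l) Phi) (comm_section (F k l) Phi) x = 0.
Proof.
pose p i j := dot (comm_section (F i j) Phi) (comm_section (F i j) Phi) x.
have p0 i j : 0 <= p i j by exact: section_dot_ge0.
apply/le_anti; rewrite section_dot_ge0 andbT.
have [_ _ _ _ H] := N_ge x; rewrite coercive_eq0 in H.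
have {}H : curv_perp_sqr D Phi x <= 0.
  by rewrite -(pmulr_rle0 _ (exprn_gt0 2 eps0)).
have le1 : p k l <= \sum_(j < 3) p k j by exact: sum_ge_term.
have le2 : \sum_(j < 3) p k j <= \sum_(i < 3) \sum_(j < 3) p i j.
  by apply: (@sum_ge_term _ (fun i => \sum_(j < 3) p i j)) => i; apply: sumr_ge0.
move: H; rewrite /curv_perp_sqr pmulr_rle0 ?invr_gt0// => H.
exact: le_trans (le_trans le1 le2) H.
Qed.

Lemma defect_eq0 x : u x = 0.
Proof.
apply: (@constant_L2_eq0 _ _ (4 * eps ^+ 2 / lam * B)); first exact: smooth_defect.
  move=> k y; apply/eqP; rewrite -sqrf_eq0 eq_le sqr_ge0 andbT.
  have [_ _ _ + _] := N_ge y; rewrite coercive_eq0 pmulr_rle0 ?invr_gt0//.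
  apply: le_trans; apply: (@sum_ge_term _ (fun j => partial j u y ^+ 2)) => j.
  exact: sqr_ge0.
apply: bounded_by_density.
- by apply: divr_ge0; [rewrite mulr_ge0 ?sqr_ge0|exact: ltW].
- apply: smooth_continuous; exact: smooth_onM openT (smooth_defect _) (smooth_defect _).
- by move=> y; rewrite -expr2; exact: defect_le_density.
Qed.

Let w k l x := dot (F k l) Phi x.

(** Since DPhi = 0, a derivative of [w] falls on the curvature alone, so the Bianchi identity and
    the Yang-Mills equation become dw = 0 and d^* w = 0. *)
Let partial_w m k l x : partial m (w k l) x = dot (cov_section D m (F k l)) Phi x.
Proof. by rewrite (partial_section_dot D) [X in _ + X]section_dotC dot_DP addr0. Qed.

Let curv_sqrE k l x : dot (F k l) (F k l) x = w k l x * w k l x.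
Proof.
have P1 : dot Phi Phi x = 1.
  by have /eqP := defect_eq0 x; rewrite subr_eq0 => /eqP.
have := section_dot_sqrE (F k l) Phi x.
by rewrite P1 FP0 mulr1 addr0 expr2.
Qed.

Lemma curv_eq0 k l x : dot (F k l) (F k l) x = 0.
Proof.
rewrite curv_sqrE.
suff -> : w k l x = 0 by rewrite mul0r.
have sw i j : smooth_on setT (w i j) by exact: smooth_section_dot.
apply: (@harmonic_L2_eq0 _ _ (2 / eps ^+ 2 * B)) => //.
  apply: closed_coclosed_harmonic => //.
  - by move=> i j y; rewrite /w section_dot_curvN.
  - move=> i y; under eq_bigr do rewrite partial_w.
    have := yang_mills sol i Phi y.
    rewrite section_dot_ad dot_DP oppr0 => /eqP.
    by rewrite mulf_eq0 expf_eq0 /= (gt_eqF eps0) => /eqP.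
  - by move=> i j m y; rewrite !partial_w; exact: section_bianchi.
apply: bounded_by_density.
- by rewrite divr_ge0 ?sqr_ge0.
- apply: smooth_continuous; exact: smooth_onM openT (sw _ _) (sw _ _).
move=> y; rewrite -curv_sqrE.
have H := curv_sqr2_le_density D Phi eps lam0 y.
have -> : 2 / eps ^+ 2 * e y = (eps ^+ 2)^-1 * (2 * e y) by field; rewrite gt_eqF.
rewrite ler_pdivlMl ?exprn_gt0//; apply: le_trans H; rewrite ler_wpM2l ?sqr_ge0//.
pose p i j := dot (F i j) (F i j) y.
have p0 i j : 0 <= p i j by exact: section_dot_ge0.
have le1 : p k l <= \sum_(j < 3) p k j by exact: sum_ge_term.
apply: le_trans le1 _.
by apply: (@sum_ge_term _ (fun i => \sum_(j < 3) p i j)) => i; apply: sumr_ge0.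
Qed.

Lemma density_eq0 x : e x = 0.
Proof.
rewrite densityE grad_sqr_eq0 defect_eq0 expr0n mulr0 !addr0 /curv_sqr2.
under eq_bigr do (under eq_bigr do rewrite curv_eq0; rewrite big1//).
by rewrite big1// !mulr0.
Qed.

End Gap.

Lemma energy_gap (R : realType) (lambda0 lam eps tau : R) (E : SU2_bundle R)
    (D : connection E) (Phi : su_section E) :
  0 < lam <= lambda0 -> 0 < eps -> 0 < tau -> 1308 * ((4 + lambda0) * tau) <= 1 ->
  YMH_solution D Phi lam eps ->
  ((eps^-1)%:E * YMH_energy D Phi lam eps <= (tau ^+ 2 / 6 * Num.min lam 1)%:E)%E ->
  forall x, density D Phi lam eps x = 0.
Proof.
move=> /andP[lam0 lamle] eps0 tau0 small sol energy x.
have ce : continuous (density D Phi lam eps).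
  exact: smooth_continuous (smooth_density D Phi lam eps).
(* The hypothesis multiplied by [eps]; it concerns an extended real, hence is read off on each
   box. *)
pose B := eps * (tau ^+ 2 / 6 * Num.min lam 1).
have int_e L : 0 < L -> boxint L (density D Phi lam eps) <= B.
  move=> L0; have H := boxint_le_integral L ce (density_ge0 D Phi eps lam0).
  have {H} := le_trans (lee_wpmul2l _ H) energy.
  rewrite -EFinM !lee_fin invr_ge0 (ltW eps0) => /(_ isT).
  by rewrite ler_pdivrMl.
apply: (density_eq0 lam0 eps0 sol _ tau0 small int_e); first by lra.
move=> L L0; apply: le_trans (_ : (2 + 4 / lam) * eps ^+ 2 * B <= _).
  apply: le_trans (_ : boxint L (fun y => (2 + 4 / lam) * eps ^+ 2 * density D Phi lam eps y) <= _).
    apply: boxint_le => [||p _]; [|exact: continuous_funZ|exact: forcing_le].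
    exact: smooth_continuous (smooth_forcing D Phi eps).
  rewrite boxintZ// ler_wpM2l ?int_e// mulr_ge0 ?sqr_ge0// addr_ge0// divr_ge0//.
  exact: ltW.
(* The summand 2 comes from the curvature and is paired with [min <= 1]; [4 / lam] comes from the
   defect and is paired with [min <= lam]. *)
have m1 : (2 + 4 / lam) * Num.min lam 1 <= 6.
  have le1 : Num.min lam 1 <= 1 by rewrite ge_min lexx orbT.
  have le2 : 4 / lam * Num.min lam 1 <= 4.
    by rewrite mulrAC ler_pdivrMr// ler_wpM2l// ge_min lexx.
  by rewrite mulrDl; move: (Num.min lam 1) (4 / lam * _) le1 le2 => p q; lra.
have -> : (2 + 4 / lam) * eps ^+ 2 * B
    = tau ^+ 2 * eps ^+ 3 * (6^-1 * ((2 + 4 / lam) * Num.min lam 1)).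
  by rewrite /B; field; rewrite gt_eqF.
apply: ler_piMr; first by rewrite mulr_ge0 ?exprn_ge0 ?(ltW eps0) ?(ltW tau0).
by rewrite ler_pdivrMl// mulr1.
Qed.

Theorem theorem1p5 (R : realType) (lambda0 : R) (hlambda0 : 0 < lambda0) :
  exists theta_gap : R, 0 < theta_gap /\
    forall lambda eps : R, 0 < lambda <= lambda0 -> 0 < eps ->
    forall (E : SU2_bundle R) (D : connection E) (Phi : su_section E),
      YMH_solution D Phi lambda eps ->
      ((eps^-1)%:E * YMH_energy D Phi lambda eps
         <= (theta_gap * Num.min lambda 1)%:E)%E ->
      YMH_energy D Phi lambda eps = 0%E.
Proof.
(* The choice depends on [lambda0] alone, since [4 + lam <= 4 + lambda0] for all admissible
   [lam]. *)
have [tau [tau0 small]] : exists tau : R, 0 < tau /\ 1308 * ((4 + lambda0) * tau) <= 1.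
  have c0 : 0 < 1308 * (4 + lambda0) by move: hlambda0; lra.
  exists (1308 * (4 + lambda0))^-1; split; first by rewrite invr_gt0.
  by rewrite mulrA mulfV ?gt_eqF.
exists (tau ^+ 2 / 6); split; first by rewrite divr_gt0// exprn_gt0.
move=> lambda eps hlambda eps0 E D Phi sol energy.
apply: integral0_eq => p _.
by rewrite (energy_gap hlambda eps0 tau0 small sol energy).
Qed.
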